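(* Let $(M^{d},\boldsymbol{c},\sigma)$, $d=n+1\ge3$, be an almost pseudo-Riemannian structure with $\sigma$ a defining density for a hypersurface $\Sigma$ and $I^2$ nowhere zero. Let $\mathcal{E}^\Phi$ be any tractor bundle, $w_0\in\mathbb{R}$, and $h_0:=d+2w_0$. Consider the extension problem: given $f|_\Sigma$ and an arbitrary smooth extension $f_0\in\Gamma(\mathcal{E}^\Phi[w_0])$ of it to $M$, find $f_i\in\Gamma(\mathcal{E}^\Phi[w_0-i])$, $i=1,2,\dots$, such that $f^{(\ell)}=f_0+\sigma f_1+\sigma^2f_2+\cdots+O(\sigma^{\ell+1})$ satisfies $I\cdot D f^{(\ell)}=O(\sigma^\ell)$. For $h_0\notin\mathbb{Z}_{\ge2}$ this problem can be solved to order $\ell=\infty$. For $h_0\in\mathbb{Z}_{\ge2}$ the solution is obstructed by $[P_{h_0-1}f]|_\Sigma$, where $P_k:=(-\frac1{I^2}I\cdot D)^k$; if, for a particular $f$, $[P_{h_0-1}f]|_\Sigma=0$, then there is a family of solutions to order $\ell=\infty$ parametrised by sections $f_{h_0-1}\in\Gamma(\mathcal{E}^\Phi[-d-w_0+1]|_\Sigma)$.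
   Context: All objects are smooth. A conformal manifold $(M^d,\boldsymbol{c})$ is a manifold with a conformal class of metrics of fixed signature. $\mathcal{E}[w]$ is the bundle of conformal densities of weight $w$ (a section is a family of functions $(f^g)_{g\in\boldsymbol{c}}$ with $f^{\Omega^2g}=\Omega^wf^g$). $\mathbf{g}=\sigma_g^2g$ is the conformal metric, with $\sigma_g\in\Gamma(\mathcal{E}[1])$ represented by $1$ in the scale $g$. For $g\in\boldsymbol{c}$, the Levi-Civita connection acts on $\mathcal{E}[w]$ by $\nabla\tau=\sigma_g^wd(\sigma_g^{-w}\tau)$; $P_{ab}$ is the Schouten tensor, $\mathrm{Ric}=(d-2)P+J\mathbf{g}$, $J=\mathbf{g}^{ab}P_{ab}$. The standard tractor bundle $\mathcal{T}=\mathcal{E}_A$ is identified by $g$ with $\mathcal{E}[1]\oplus T^*M[1]\oplus\mathcal{E}[-1]$; for $\widehat g=\Omega^2g$, $\Upsilon=\Omega^{-1}d\Omega$: $\widehat\sigma=\sigma$, $\widehat\mu_b=\mu_b+\Upsilon_b\sigma$, $\widehat\rho=\rho-\Upsilon^b\mu_b-\frac12\Upsilon^b\Upsilon_b\sigma$. Tractor connection: $\nabla_a(\sigma,\mu_b,\rho)=(\nabla_a\sigma-\mu_a,\nabla_a\mu_b+\mathbf{g}_{ab}\rho+P_{ab}\sigma,\nabla_a\rho-P_{ab}\mu^b)$. Tractor metric: $h=2\sigma\rho+\mathbf{g}^{ab}\mu_a\mu_b$ (quadratic form), used to raise/lower tractor indices. A tractor bundle $\mathcal{E}^\Phi$ is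 a (sub)bundle of tensor powers of $\mathcal{T}$ with the induced connection; $\mathcal{E}^\Phi[w]=\mathcal{E}^\Phi\otimes\mathcal{E}[w]$, and $\nabla$ below is the coupled tractor–Levi-Civita connection, $\Delta=\mathbf{g}^{ab}\nabla_a\nabla_b$. The Thomas-D operator $D_A:\mathcal{E}^\Phi[w]\to\mathcal{E}_A\otimes\mathcal{E}^\Phi[w-1]$ is the conformally invariant operator $D_AV\stackrel{g}{=}((d+2w-2)wV,\ (d+2w-2)\nabla_aV,\ -(\Delta V+wJV))$. For $\sigma\in\Gamma(\mathcal{E}[1])$, $I_A=\frac1dD_A\sigma\stackrel{g}{=}(\sigma,\nabla_a\sigma,-\frac1d(\Delta\sigma+J\sigma))$ is the scale tractor, $I^2=I^AI_A$, and $I\cdot D:=I^AD_A:\mathcal{E}^\Phi[w]\to\mathcal{E}^\Phi[w-1]$. Almost pseudo-Riemannian means $I$ is nowhere zero. $\sigma$ is a defining density for $\Sigma$ if $\Sigma=\mathcal{Z}(\sigma)$ and $\nabla^g\sigma$ is nonzero (here also nowhere null) at every point of $\Sigma$. One works locally on the side of $\Sigma$ where $\sigma\ge0$, near $\Sigma$. $O(\sigma^k)$ denotes $\sigma^k$ times a smooth section; order $\ell=\infty$ means that the equation holds to all finite orders in $\sigma$. The operator $P_k$ on $\mathcal{E}^\Phi[\frac{k-n}{2}]$ is tangential along $\Sigma$, i.e. $(P_kf_0)|_\Sigma$ depends only on $f_0|_\Sigma$; for $k=h_0-1$ one has $\frac{k-n}2=w_0$. ''Obstructed by'' means that vanishing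 of the indicated quantity is necessary for the expansion to be continued past order $\ell=h_0-2$. *)

(* Defs.v *)
From HB Require Import structures.
From mathcomp Require Import all_boot all_order all_algebra.
From mathcomp Require Import all_classical all_reals all_analysis.
Set Implicit Arguments.
Unset Strict Implicit.
Unset Printing Implicit Defensive.
Import Order.TTheory GRing.Theory Num.Theory.
Import numFieldNormedType.Exports.
Local Open Scope classical_set_scope.
Local Open Scope ring_scope.

(* The dimension of the manifold is n.+1 throughout (d = n + 1).             *)

Section SmoothManifold.
Variables (R : realType) (n : nat).
Notation V := 'rV[R]_n.+1.

Definition partial (a : 'I_n.+1) (f : V -> R) : V -> R :=
  fun u => 'D_(delta_mx 0 a) f u.

(* All iterated partial derivatives are Frechet differentiable on U; for     *)
(* open U this is C^infinity.                                                *)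
Definition smooth_on (U : set V) (f : V -> R) : Prop :=
  forall (s : seq 'I_n.+1) (u : V), U u -> differentiable (foldr partial f s) u.

(* A manifold is given by an atlas (not required to be maximal).  [param i]  *)
(* is the inverse of [coord i]; both are relevant only on [dom i] and its    *)
(* image.                                                                    *)
Record manifold := Manifold {
  pt :> topologicalType;
  chart : Type;
  dom : chart -> set pt;
  coord : chart -> pt -> V;
  param : chart -> V -> pt;
  _ : @hausdorff_space pt;
  _ : @second_countable pt;
  _ : forall p : pt, exists i, dom i p;
  _ : forall i, open (dom i);
  _ : forall i, open (coord i @` dom i);
  _ : forall i, {in dom i, cancel (coord i) (param i)};
  _ : forall i, {within dom i, continuous (coord i)};
  _ : forall i, {within coord i @` dom i, continuous (param i)};
  _ : forall i j a, smooth_on (coord i @` (dom i `&` dom j))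
        (fun u => coord j (param i u) 0 a)
}.

End SmoothManifold.

(* Index set of the components of a standard tractor (sigma, mu_b, rho).     *)
Variant slot (n : nat) := Top | Mid of 'I_n.+1 | Bot.
Arguments Top {n}.
Arguments Bot {n}.

Definition slot_code n (A : slot n) : option (option 'I_n.+1) :=
  match A with Top => None | Mid b => Some (Some b) | Bot => Some None end.
Definition slot_decode n (x : option (option 'I_n.+1)) : slot n :=
  match x with None => Top | Some (Some b) => Mid b | Some None => Bot end.
Lemma slot_codeK n : cancel (@slot_code n) (@slot_decode n).
Proof. by case. Qed.
HB.instance Definition _ n := Finite.copy (slot n) (can_type (@slot_codeK n)).

Section ConformalTractors.
Variables (R : realType) (n : nat) (M : manifold R n).
Notation d := (n.+1%:R : R).

Definition pd (i : chart M) (a : 'I_n.+1) (F : M -> R) (p : M) : R :=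
  partial a (F \o param i) (coord i p).

(* [F] is smooth on [U `&` dom i] (U open).                                  *)
Definition smooth_in (i : chart M) (U : set M) (F : M -> R) : Prop :=
  smooth_on (coord i @` (U `&` dom i)) (F \o param i).

Definition smooth_fun (U : set M) (F : M -> R) : Prop :=
  forall i, smooth_in i U F.

(* d x_i^c / d x_j^b *)
Definition jac (i j : chart M) (p : M) (c b : 'I_n.+1) : R :=
  pd j b (fun x => coord i x 0 c) p.

Definition metric_field := chart M -> M -> 'M[R]_n.+1.

(* q minus signs *)
Definition has_signature (q : nat) (A : 'M[R]_n.+1) : Prop :=
  exists2 C : 'M[R]_n.+1, C \in unitmx &
    C^T *m A *m C = diag_mx (\row_a (-1) ^+ (a < q)%N).

Definition is_metric (q : nat) (g : metric_field) : Prop :=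
  [/\ forall i a b, smooth_in i setT (fun p => g i p a b),
      forall i p, dom i p -> has_signature q (g i p) &
      forall i j p, dom i p -> dom j p -> forall a b,
        g j p a b = \sum_c \sum_e jac i j p c a * jac i j p e b * g i p c e].

(* ghat = Omega^2 g, Omega > 0 *)
Definition rescaling (Omega : M -> R) (g ghat : metric_field) : Prop :=
  [/\ smooth_fun setT Omega, forall p, 0 < Omega p &
      forall i p, dom i p -> ghat i p = Omega p ^+ 2 *: g i p].

Definition conformal_class (q : nat) (c : set metric_field) : Prop :=
  exists2 g, is_metric q g &
    c = [set ghat | is_metric q ghat /\ exists Omega, rescaling Omega g ghat].

Definition ginv (g : metric_field) (i : chart M) (p : M) (a b : 'I_n.+1) : R :=
  invmx (g i p) a b.

(* christoffel c a b = Gamma^c_{ab} *)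
Definition christoffel (g : metric_field) (i : chart M)
    (c a b : 'I_n.+1) (p : M) : R :=
  2^-1 * \sum_e ginv g i p c e *
    (pd i a (fun x => g i x e b) p + pd i b (fun x => g i x e a) p
     - pd i e (fun x => g i x a b) p).

(* The sign is such that round spheres have positive Ricci curvature.        *)
Definition ricci (g : metric_field) (i : chart M) (b c : 'I_n.+1) (p : M) : R :=
  \sum_a (pd i a (christoffel g i a b c) p - pd i c (christoffel g i a a b) p
    + \sum_e (christoffel g i a a e p * christoffel g i e b c p
              - christoffel g i a c e p * christoffel g i e a b p)).

Definition scal (g : metric_field) (i : chart M) (p : M) : R :=
  \sum_a \sum_b ginv g i p a b * ricci g i a b p.

(* J and P solve Ric = (d - 2) P + J g, J = tr_g P (for d >= 3).             *)
Definition schoutenJ (g : metric_field) (i : chart M) (p : M) : R :=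
  scal g i p / (2 * (d - 1)).
Definition schouten (g : metric_field) (i : chart M) (a b : 'I_n.+1)
    (p : M) : R :=
  (ricci g i a b p - schoutenJ g i p * g i p a b) / (d - 2).

(* A density of weight w is the family (f^g); only scales g in the conformal *)
(* class matter.                                                             *)
Definition density := metric_field -> M -> R.

Definition is_density (c : set metric_field) (w : R) (f : density) : Prop :=
  (forall g, c g -> smooth_fun setT (f g)) /\
  (forall g ghat Omega, c g -> c ghat -> rescaling Omega g ghat ->
     forall p, f ghat p = Omega p `^ w * f g p).

(* In the scale g the weights are trivialised by sigma_g, so that the        *)
(* Levi-Civita connection on E[w] is d, and g represents the conformal       *)
(* metric.                                                                   *)
Definition lap_density (g : metric_field) (i : chart M) (f : M -> R)
    (p : M) : R :=
  \sum_a \sum_b ginv g i p a b *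
    (pd i a (pd i b f) p - \sum_c christoffel g i c a b p * pd i c f p).

(* Components of an m-fold tractor tensor F_{A_1...A_m}, with respect to a   *)
(* scale and a chart.  Indices are lowered with the tractor metric.          *)
Definition multi (m : nat) := {ffun 'I_m -> slot n}.
Definition tensor (m : nat) := multi m -> R.
Definition tractor_field (m : nat) := metric_field -> chart M -> M -> tensor m.

Definition tens_act m (T : slot n -> slot n -> R) (t : tensor m) : tensor m :=
  fun A => \sum_(B : multi m) (\prod_k T (A k) (B k)) * t B.

Definition upsilon (Omega : M -> R) (i : chart M) (p : M) (a : 'I_n.+1) : R :=
  (Omega p)^-1 * pd i a Omega p.

(* (sigma, mu, rho) |-> (sigma, mu_b + Upsilon_b sigma,                      *)
(*    rho - Upsilon^b mu_b - Upsilon^b Upsilon_b sigma / 2); the powers of   *)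
(* Omega come from the weights 1, 1, -1 of the three slots.                  *)
Definition scale_change (Omega : M -> R) (g : metric_field) (i : chart M)
    (p : M) (A B : slot n) : R :=
  let U := upsilon Omega i p in
  match A, B with
  | Top, Top => Omega p
  | Mid b, Top => Omega p * U b
  | Mid b, Mid e => Omega p * (b == e)%:R
  | Bot, Top =>
      - (Omega p)^-1 * (2^-1 * \sum_a \sum_b ginv g i p a b * U a * U b)
  | Bot, Mid e => - (Omega p)^-1 * \sum_b ginv g i p b e * U b
  | Bot, Bot => (Omega p)^-1
  | _, _ => 0
  end.

Definition chart_change (i j : chart M) (p : M) (A B : slot n) : R :=
  match A, B with
  | Top, Top => 1
  | Mid b, Mid e => jac i j p e b
  | Bot, Bot => 1
  | _, _ => 0
  end.

(* nabla_a V_A = d_a V_A + \sum_B tractor_form a A B * V_B                    *)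
Definition tractor_form (g : metric_field) (i : chart M) (p : M)
    (a : 'I_n.+1) (A B : slot n) : R :=
  match A, B with
  | Top, Mid b => - (a == b)%:R
  | Mid b, Top => schouten g i a b p
  | Mid b, Mid e => - christoffel g i e a b p
  | Mid b, Bot => g i p a b
  | Bot, Mid e => - \sum_b schouten g i a b p * ginv g i p b e
  | _, _ => 0
  end.

Definition subst_index m (A : multi m) (k : 'I_m) (B : slot n) : multi m :=
  [ffun l => if l == k then B else A l].

Definition nabla m (g : metric_field) (i : chart M) (a : 'I_n.+1)
    (F : M -> tensor m) (p : M) : tensor m :=
  fun A => pd i a (fun x => F x A) p +
    \sum_(k < m) \sum_(B : slot n)
      tractor_form g i p a (A k) B * F p (subst_index A k B).

Definition lap m (g : metric_field) (i : chart M)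
    (F : M -> tensor m) (p : M) : tensor m :=
  fun A => \sum_a \sum_b ginv g i p a b *
    (nabla g i a (nabla g i b F) p A
     - \sum_c christoffel g i c a b p * nabla g i c F p A).

(* Fibres of a subbundle of the m-th tensor power of the standard tractor    *)
(* bundle, read in a scale and a chart.                                      *)
Definition subbundle (m : nat) := metric_field -> chart M -> M -> set (tensor m).

(* A smooth subbundle: locally framed, independent of the scale and chart,   *)
(* and preserved by the tractor connection, so that the latter induces a     *)
(* connection on it.                                                         *)
Definition tractor_bundle m (c : set metric_field) (Phi : subbundle m) : Prop :=
  [/\ forall g i p0, c g -> dom i p0 ->
        exists (U : set M) (r : nat) (e : 'I_r -> M -> tensor m),
        [/\ open U /\ U p0, U `<=` dom i,
            forall k A, smooth_in i U (fun p => e k p A) &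
            forall p, U p ->
              [/\ forall x : 'I_r -> R,
                    (forall A, \sum_k x k * e k p A = 0) -> forall k, x k = 0,
                  Phi g i p = [set t | exists x : 'I_r -> R,
                                 t = fun A => \sum_k x k * e k p A] &
                  forall k a, Phi g i p (nabla g i a (e k) p)]],
      forall g ghat Omega, c g -> c ghat -> rescaling Omega g ghat ->
        forall i p, dom i p -> forall t, Phi g i p t ->
          Phi ghat i p (tens_act (scale_change Omega g i p) t) &
      forall g i j p, c g -> dom i p -> dom j p -> forall t, Phi g i p t ->
          Phi g j p (tens_act (chart_change i j p) t)].

Section Sections.
Variables (m : nat) (c : set metric_field) (Phi : subbundle m).

Definition section_on (U : set M) (w : R) (F : tractor_field m) : Prop :=
  [/\ forall g i A, c g -> smooth_in i U (fun p => F g i p A),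
      forall g i p, c g -> U p -> dom i p -> Phi g i p (F g i p),
      forall g ghat Omega, c g -> c ghat -> rescaling Omega g ghat ->
        forall i p, U p -> dom i p -> forall A, F ghat i p A =
          Omega p `^ w * tens_act (scale_change Omega g i p) (F g i p) A &
      forall g i j p, c g -> U p -> dom i p -> dom j p -> forall A,
          F g j p A = tens_act (chart_change i j p) (F g i p) A].

Definition is_section : R -> tractor_field m -> Prop := section_on setT.

Definition eq_on (S : set M) (F G : tractor_field m) : Prop :=
  forall g i p, c g -> S p -> dom i p -> forall A, F g i p A = G g i p A.

(* smooth sections of E^Phi[w]|_S; only the values at points of S matter     *)
Definition section_along (S : set M) (w : R) (phi : tractor_field m) : Prop :=
  forall p, S p -> exists (U : set M) (F : tractor_field m),
    [/\ open U, U p, section_on U w F & eq_on (U `&` S) phi F].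

Variable sigma : density.

Definition scale_tractor (g : metric_field) (i : chart M) (p : M)
    (A : slot n) : R :=
  match A with
  | Top => sigma g p
  | Mid a => pd i a (sigma g) p
  | Bot => - d^-1 * (lap_density g i (sigma g) p + schoutenJ g i p * sigma g p)
  end.

(* polarisation of 2 sigma rho + g^{ab} mu_a mu_b *)
Definition tractor_metric (g : metric_field) (i : chart M) (p : M)
    (X Y : slot n -> R) : R :=
  X Top * Y Bot + X Bot * Y Top +
  \sum_a \sum_b ginv g i p a b * X (Mid a) * Y (Mid b).

Definition Isq (g : metric_field) (i : chart M) (p : M) : R :=
  tractor_metric g i p (scale_tractor g i p) (scale_tractor g i p).

Definition thomasD (w : R) (F : tractor_field m) (g : metric_field)
    (i : chart M) (p : M) (B : slot n) : tensor m :=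
  fun A => match B with
  | Top => (d + 2 * w - 2) * w * F g i p A
  | Mid a => (d + 2 * w - 2) * nabla g i a (F g i) p A
  | Bot => - (lap g i (F g i) p A + w * schoutenJ g i p * F g i p A)
  end.

(* I.D on weight w; every weight is trivialised by the scale g.              *)
Definition IdotD (w : R) (F : tractor_field m) : tractor_field m :=
  fun g i p A =>
    tractor_metric g i p (scale_tractor g i p) (fun B => thomasD w F g i p B A).

(* (- I^{-2} I.D)^k on weight w; each factor lowers the weight by one.       *)
Fixpoint Pop (w : R) (k : nat) (F : tractor_field m) : tractor_field m :=
  if k is k'.+1 then
    Pop (w - 1) k' (fun g i p A => - (Isq g i p)^-1 * IdotD w F g i p A)
  else F.

(* F, of weight w, is sigma^k times a smooth section of E^Phi[w - k].        *)
Definition bigO (w : R) (k : nat) (F : tractor_field m) : Prop :=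
  exists2 S, is_section (w - k%:R) S &
    eq_on setT F (fun g i p A => sigma g p ^+ k * S g i p A).

(* f0 + sigma f_1 + ... + sigma^l f_l (the entry f_ 0 is not used)           *)
Definition expansion (f0 : tractor_field m) (f_ : nat -> tractor_field m)
    (l : nat) : tractor_field m :=
  fun g i p A => f0 g i p A +
    \sum_(1 <= k < l.+1) sigma g p ^+ k * f_ k g i p A.

Definition sub_field (F G : tractor_field m) : tractor_field m :=
  fun g i p A => F g i p A - G g i p A.

Definition solves_to (w0 : R) (f0 : tractor_field m)
    (f_ : nat -> tractor_field m) (l : nat) : Prop :=
  (forall k, (1 <= k <= l)%N -> is_section (w0 - k%:R) (f_ k)) /\
  (forall F, is_section w0 F ->
     bigO w0 l.+1 (sub_field F (expansion f0 f_ l)) ->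
     bigO (w0 - 1) l (IdotD w0 F)).

Definition solves_to_infinity (w0 : R) (f0 : tractor_field m)
    (f_ : nat -> tractor_field m) : Prop :=
  forall l, solves_to w0 f0 f_ l.

(* equality of formal expansions with the same f0, to all orders in sigma    *)
Definition same_expansion (w0 : R) (f0 : tractor_field m)
    (f_ h_ : nat -> tractor_field m) : Prop :=
  forall l, bigO w0 l.+1 (sub_field (expansion f0 f_ l) (expansion f0 h_ l)).

End Sections.

Definition defining_density (c : set metric_field) (sigma : density)
    (Sigma : set M) : Prop :=
  forall g, c g ->
    Sigma = [set p | sigma g p = 0] /\
    forall i p, Sigma p -> dom i p ->
      (exists a, pd i a (sigma g) p != 0) /\
      \sum_a \sum_b ginv g i p a b * pd i a (sigma g) p * pd i b (sigma g) p != 0.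

Definition almost_pseudo_riemannian (c : set metric_field)
    (sigma : density) : Prop :=
  is_density c 1 sigma /\
  forall g i p, c g -> dom i p -> exists A, scale_tractor sigma g i p A != 0.

End ConformalTractors.

(* Main.v *)
(** In a scale, [y = - I^{-2} I.D] satisfies on sections [F] of weight [w] the sl(2) relation
    [y (sigma^(k+1) F) = sigma^(k+1) y F - (k+1) (d + 2 w + k) sigma^k F].
    Hence adding [sigma^(l+1) f_(l+1)] changes the coefficient of [sigma^l] in
    [I.D f^(l)] by [(l+1) (h0 - l - 2) I^2 f_(l+1)], so the recursion only breaks down at
    [l = h0 - 2], where the coefficient of [sigma^l] has to vanish along the hypersurface.
    By the same relation [P_k (sigma^k G)] is a nonzero multiple of [G] modulo [sigma],
    while [P_(h0-1)] kills [sigma G] along the hypersurface; so this condition reads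
    [P_(h0-1) f = 0], and then [f_(h0-1)] is arbitrary.

    Weights being trivialised by a scale, that [I.D] maps sections to sections amounts to its
    covariance under changes of scale and of chart, which comes from the transformation laws
    of the Christoffel symbols and of the Schouten tensor.  A section vanishing along the
    hypersurface is [sigma] times a smooth section by a Hadamard-type division lemma, and
    sections along the hypersurface are extended with a partition of unity. *)
Require Import Defs.
From HB Require Import structures.
From mathcomp Require Import all_boot all_order all_algebra.
From mathcomp Require Import all_classical all_reals all_analysis.
From mathcomp Require Import ring lra zify.
Set Implicit Arguments.
Unset Strict Implicit.
Unset Printing Implicit Defensive.
Import Order.TTheory GRing.Theory Num.Theory.
Import numFieldNormedType.Exports.
Local Open Scope classical_set_scope.
Local Open Scope ring_scope.
(* [coord] is also the name of a vector space coordinate function. *)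
Import Defs.

(** * Smooth functions on open sets *)

(** Smoothness means differentiability of all iterated partial derivatives, so it is proved by
    exhibiting a class of differentiable functions stable under partial differentiation. This shapes
    the division lemma: rather than straightening the hypersurface and integrating along its normal,
    one places the quotient in the class of functions that a power of the defining function makes
    smooth and that smooth functions approximate to every order at its zeros. The analytic work lies
    in the stability of this class.

    Covariance is reduced to one gauge law [dT + A' T = T A] for the transition matrices [T] of the
    standard tractor bundle, which the product rule extends to tensor powers. It is checked as an
    identity at one point, derivatives being independent variables. The terms of I.D are not
    separately covariant under changes of scale: each has a defect with the factor [d + 2 w - 2],
    and the defects cancel.

    Sigma has nonzero differential on its zero set, so division by it is unique, and every property
    of a quotient is proved after multiplication by sigma. *)

Lemma diff_eps (R : realType) (V W : normedModType R) (f : V -> W) (u : V)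
    (L : {linear V -> W}) : continuous L ->
  (forall e : R, 0 < e ->
     \forall h \near (0 : V), `|f (h + u) - f u - L h| <= e * `|h|) ->
  differentiable f u /\ ('d f u : V -> W) = L.
Proof.
move=> cL hf.
have fL : f \o shift u = cst (f u) + L +o_ 0 id.
  apply/eqaddoP => _/posnumP[e]; near=> h.
  have -> : (f \o shift u - (cst (f u) + L)) h = f (h + u) - f u - L h.
    by rewrite /= !fctE opprD addrA.
  by near: h; exact: hf.
split; last exact: diff_unique.
have dL := diff_unique cL fL.
by apply/diff_locallyP; split; rewrite ?dL.
Unshelve. all: by end_near. Qed.

Lemma diff_epsE (R : realType) (V W : normedModType R) (f : V -> W) (u : V) :
  differentiable f u -> forall e : R, 0 < e ->
     \forall h \near (0 : V), `|f (h + u) - f u - 'd f u h| <= e * `|h|.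
Proof.
move=> df e e0.
have := diff_locally df; move=> /eqaddoP /(_ e e0) H.
near=> h.
have -> : f (h + u) - f u - 'd f u h = (f \o shift u - (cst (f u) + 'd f u)) h.
  by rewrite /= !fctE opprD addrA.
by near: h.
Unshelve. all: by end_near. Qed.

(** Differentiability depends only on the germ. This is used throughout, because derivatives are
    identified with closed formulas only on open sets. *)
Lemma near_eq_differentiable (R : realType) (V W : normedModType R)
    (f g : V -> W) (u : V) :
  (\near u, f u = g u) -> differentiable f u -> differentiable g u.
Proof.
move=> fg df.
have fgu : f u = g u by exact: nbhs_singleton fg.
suff [] : differentiable g u /\ ('d g u : V -> W) = 'd f u by [].
apply: diff_eps; first exact: diff_continuous.
move=> e e0; near=> h.
rewrite -fgu.
have <- : f (h + u) = g (h + u).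
  near: h.
  by move: fg; rewrite (near_shift 0 u) subr0.
near: h; exact: diff_epsE.
Unshelve. all: by end_near. Qed.

Section Partial.
Variables (R : realType) (n : nat).
Notation V := 'rV[R]_n.+1.
Implicit Types (f g : V -> R) (u : V) (U : set V) (a : 'I_n.+1).

Lemma open_near U u : open U -> U u -> \near u, U u.
Proof. by move=> oU Uu; apply: open_nbhs_nbhs. Qed.

Lemma partial_ext U f g a u : open U -> {in U, f =1 g} -> U u ->
  partial a f u = partial a g u.
Proof.
move=> oU fg Uu; apply: near_eq_derive.
by near=> x; apply: fg; rewrite inE; near: x; exact: open_near.
Unshelve. all: by end_near. Qed.

Lemma differentiable_ext U f g u : open U -> {in U, f =1 g} -> U u ->
  differentiable f u -> differentiable g u.
Proof.
move=> oU fg Uu; apply: near_eq_differentiable.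
by near=> x; apply: fg; rewrite inE; near: x; exact: open_near.
Unshelve. all: by end_near. Qed.

Lemma foldr_partial_ext U f g s : open U -> {in U, f =1 g} ->
  {in U, foldr (@partial R n) f s =1 foldr (@partial R n) g s}.
Proof.
move=> oU fg; elim: s => [|a s IH] //= u.
by rewrite inE => Uu; apply: partial_ext IH Uu.
Qed.

Lemma smooth_on_ext U f g : open U -> {in U, f =1 g} ->
  smooth_on U f -> smooth_on U g.
Proof.
move=> oU fg sf s u Uu.
apply: (differentiable_ext oU _ Uu (sf s u Uu)).
exact: foldr_partial_ext.
Qed.

Lemma smooth_on_sub U U' f : U' `<=` U -> smooth_on U f -> smooth_on U' f.
Proof. by move=> UU sf s u /UU; apply: sf. Qed.

Lemma smooth_on_local U f :
  (forall u, U u -> exists2 W : set V, W u & smooth_on W f) -> smooth_on U f.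
Proof. by move=> h s u /h[W Wu /(_ s u)]; apply. Qed.

Lemma smooth_on_diff U f u : smooth_on U f -> U u -> differentiable f u.
Proof. by move=> sf Uu; exact: (sf [::] u Uu). Qed.

Lemma smooth_on_partial U f a : smooth_on U f -> smooth_on U (partial a f).
Proof.
move=> sf s u Uu; have := sf (rcons s a) u Uu.
by rewrite -cats1 foldr_cat.
Qed.

(** A coinduction principle: every iterated derivative of a member agrees on [U] with a member,
    hence is differentiable there. Derivatives have to stay in [C] only up to equality on the open
    set [U], which is what makes closed formulas usable. *)
Lemma smooth_class U (C : (V -> R) -> Prop) : open U ->
  (forall g, C g -> forall u, U u -> differentiable g u) ->
  (forall g a, C g -> exists2 g', C g' & {in U, partial a g =1 g'}) ->
  forall g, C g -> smooth_on U g.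
Proof.
move=> oU dC pC g Cg.
suff H s : exists2 g', C g' & {in U, foldr (@partial R n) g s =1 g'}.
  move=> s u Uu; have [g' Cg' gg'] := H s.
  apply: (differentiable_ext oU _ Uu (dC _ Cg' _ Uu)).
  by move=> x Ux; rewrite gg'.
elim: s => [|a s [g' Cg' gg']]; first by exists g.
have [g'' Cg'' gg''] := pC g' a Cg'.
exists g'' => // u uU; rewrite /= -gg''//.
by apply: (partial_ext _ oU) => //; move: uU; rewrite inE.
Qed.

Lemma partialD f g a u : differentiable f u -> differentiable g u ->
  partial a (fun x => f x + g x) u = partial a f u + partial a g u.
Proof. by move=> df dg; apply: deriveD; exact: diff_derivable. Qed.

Lemma partialM f g a u : differentiable f u -> differentiable g u ->
  partial a (fun x => f x * g x) u = partial a f u * g u + f u * partial a g u.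
Proof.
move=> df dg; rewrite /partial [LHS]deriveM; [|exact: diff_derivable..].
by rewrite /GRing.scale /= addrC mulrC.
Qed.

Lemma partial_cst k a u : partial a (fun=> k) u = 0.
Proof. exact: derive_cst. Qed.

Lemma partialE f a u : differentiable f u ->
  partial a f u = 'd f u (delta_mx 0 a).
Proof. by move=> df; rewrite /partial deriveE. Qed.

Lemma diff_partial f u h : differentiable f u ->
  'd f u h = \sum_a h 0 a * partial a f u.
Proof.
move=> df; rewrite {1}[h]row_sum_delta linear_sum; apply: eq_bigr => a _.
by rewrite linearZ /= -partialE.
Qed.

(** The algebra generated by [B] over the smooth functions on [U]. By the product rule it is stable
    under differentiation as soon as the derivatives of the generators lie in it, so each closure
    result only has to choose suitable generators. *)
Inductive gen_alg (U : set V) (B : (V -> R) -> Prop) : (V -> R) -> Prop :=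
| gen_base f of B f : gen_alg U B f
| gen_smooth f of smooth_on U f : gen_alg U B f
| gen_add f g of gen_alg U B f & gen_alg U B g : gen_alg U B (fun x => f x + g x)
| gen_mul f g of gen_alg U B f & gen_alg U B g : gen_alg U B (fun x => f x * g x).

Lemma smooth_gen_alg U (B : (V -> R) -> Prop) : open U ->
  (forall g, B g -> forall u, U u -> differentiable g u) ->
  (forall g a, B g -> exists2 g', gen_alg U B g' & {in U, partial a g =1 g'}) ->
  forall g, gen_alg U B g -> smooth_on U g.
Proof.
move=> oU dB pB.
have dA g : gen_alg U B g -> forall u, U u -> differentiable g u.
  elim=> {g} [g /dB//|g sg u|f g _ df _ dg u Uu|f g _ df _ dg u Uu].
  - exact: smooth_on_diff.
  - by apply: differentiableD; [exact: df|exact: dg].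
  - by apply: differentiableM; [exact: df|exact: dg].
apply: smooth_class => // g a; elim=> {g} [g Bg|g sg|f g Af [f' Af' ff'] Ag [g' Ag' gg']|
  f g Af [f' Af' ff'] Ag [g' Ag' gg']].
- by apply: pB.
- by exists (partial a g) => //; apply: gen_smooth; exact: smooth_on_partial.
- exists (fun x => f' x + g' x); first exact: gen_add.
  move=> u uU; have Uu : U u by rewrite inE in uU.
  by rewrite partialD ?ff' ?gg'//; exact: dA.
- exists (fun x => f' x * g x + f x * g' x).
    by apply: gen_add; apply: gen_mul.
  move=> u uU; have Uu : U u by rewrite inE in uU.
  by rewrite partialM ?ff' ?gg'//; exact: dA.
Qed.

Lemma smooth_onD U f g : open U -> smooth_on U f -> smooth_on U g ->
  smooth_on U (fun x => f x + g x).
Proof.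
move=> oU sf sg; apply: (@smooth_gen_alg U (fun=> False)) => //.
by apply: gen_add; exact: gen_smooth.
Qed.

Lemma smooth_onM U f g : open U -> smooth_on U f -> smooth_on U g ->
  smooth_on U (fun x => f x * g x).
Proof.
move=> oU sf sg; apply: (@smooth_gen_alg U (fun=> False)) => //.
by apply: gen_mul; exact: gen_smooth.
Qed.

Lemma smooth_on_cst U k : open U -> smooth_on U (fun=> k).
Proof.
move=> oU; apply: (@smooth_class U (fun g => exists k, g = fun=> k)) => //.
- by move=> _ [c ->] u _; exact: differentiable_cst.
- move=> _ a [c ->]; exists (fun=> 0); first by exists 0.
  by move=> u _; rewrite partial_cst.
- by exists k.
Qed.

Lemma partial_coord a b u : partial b (fun x : V => x 0 a) u = (a == b)%:R.
Proof.
have cont : continuous (fun x : V => x 0 a).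
  by move=> x; exact/differentiable_continuous/differentiable_coord.
have lin : linear (fun x : V => (x 0 a : R)) by move=> k x y; rewrite !mxE.
pose L := GRing.isLinear.Build R V R *:%R (fun x : V => (x 0 a : R)) lin.
pose L' : {linear V -> R} := HB.pack (fun x : V => (x 0 a : R)) L.
rewrite partialE; last exact: differentiable_coord.
have -> : 'd (fun x : V => x 0 a) u = L' :> (V -> R) by exact: (diff_lin (f := L')).
by rewrite /= mxE eqxx.
Qed.

Lemma smooth_on_coord U a : open U -> smooth_on U (fun x => x 0 a).
Proof.
move=> oU; apply: (@smooth_gen_alg U (eq (fun x : V => x 0 a))) => //.
- by move=> _ <- u _; exact: differentiable_coord.
- move=> _ b <-; exists (fun=> (a == b)%:R).
    by apply: gen_smooth; exact: smooth_on_cst.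
  by move=> u _; rewrite partial_coord.
- by apply: gen_base.
Qed.

End Partial.

(** * Compositions, reciprocals and real powers of smooth functions *)

Section Compositions.
Variables (R : realType) (n : nat).
Notation V := 'rV[R]_n.+1.
Implicit Types (f g : V -> R) (u : V) (U : set V) (a : 'I_n.+1).

Lemma smooth_on_bigsum U (I : Type) (r : seq I) (P : pred I) (F : I -> V -> R) :
  open U -> (forall i, smooth_on U (F i)) ->
  smooth_on U (fun x => \sum_(i <- r | P i) F i x).
Proof.
move=> oU sF; elim: r => [|i r IH].
  apply: (smooth_on_ext oU _ (smooth_on_cst 0 oU)) => u _.
  by rewrite big_nil.
case: (boolP (P i)) => Pi.
  apply: (smooth_on_ext oU _ (smooth_onD oU (sF i) IH)) => u _.
  by rewrite big_cons Pi.
apply: (smooth_on_ext oU _ IH) => u _.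
by rewrite big_cons (negbTE Pi).
Qed.

Lemma differentiable_rV (phi : V -> V) u :
  (forall c, differentiable (fun x => phi x 0 c) u) -> differentiable phi u.
Proof.
move=> dphi.
have -> : phi = \sum_c (fun x => phi x 0 c *: (delta_mx 0 c : V)).
  apply/funext => x; rewrite fct_sumE {1}[phi x]row_sum_delta.
  by apply: eq_bigr.
apply: differentiable_sum => c; exact: differentiableZl.
Qed.

Lemma partial_comp (phi : V -> V) f a u :
  (forall c, differentiable (fun x => phi x 0 c) u) -> differentiable f (phi u) ->
  partial a (f \o phi) u =
  \sum_c partial c f (phi u) * partial a (fun x => phi x 0 c) u.
Proof.
move=> dphi df; have dphi' := differentiable_rV dphi.
rewrite partialE; last exact: differentiable_comp.
rewrite diff_comp//= diff_partial//; apply: eq_bigr => c _; rewrite mulrC; congr (_ * _).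
rewrite -deriveE// derive_mx ?mxE//.
exact: diff_derivable.
Qed.

(** The generators are the pullbacks [h \o phi] of smooth functions; by the chain rule their
    derivatives are sums of pullbacks multiplied by derivatives of the components of [phi], which
    stay in the generated algebra. *)
Lemma smooth_on_comp U (W : set V) (phi : V -> V) f : open U -> open W ->
  (forall c, smooth_on U (fun x => phi x 0 c)) -> phi @` U `<=` W ->
  smooth_on W f -> smooth_on U (f \o phi).
Proof.
move=> oU oW sphi UW sf.
pose B g := exists2 h, smooth_on W h & g = h \o phi.
have dphi u : U u -> forall c, differentiable (fun x => phi x 0 c) u.
  by move=> Uu c; exact: smooth_on_diff (sphi c) Uu.
have Wphi u : U u -> W (phi u) by move=> Uu; apply: UW; exists u.
apply: (@smooth_gen_alg R n U B) => //; last by apply: gen_base; exists f.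
- move=> _ [h sh ->] u Uu; apply: differentiable_comp.
    exact/differentiable_rV/dphi.
  exact/(smooth_on_diff sh)/Wphi.
- move=> _ a [h sh ->].
  exists (fun u => \sum_c (partial c h \o phi) u * partial a (fun x => phi x 0 c) u).
    elim: index_enum => [|c s IH].
      rewrite (_ : (fun u => _) = fun=> 0); last by apply/funext => u; rewrite big_nil.
      by apply: gen_smooth; exact: smooth_on_cst.
    rewrite (_ : (fun u => _) = fun u => (partial c h \o phi) u * partial a (fun x => phi x 0 c) u +
      \sum_(c <- s) (partial c h \o phi) u * partial a (fun x => phi x 0 c) u); last first.
      by apply/funext => u; rewrite big_cons.
    apply: gen_add => //; apply: gen_mul.
      by apply: gen_base; exists (partial c h) => //; exact: smooth_on_partial.
    by apply: gen_smooth; exact: smooth_on_partial.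
  move=> u; rewrite inE => Uu; rewrite partial_comp//; first exact: dphi.
  exact/(smooth_on_diff sh)/Wphi.
Qed.

Lemma partial_comp1 (G : R -> R) f a u (d : R) : differentiable f u ->
  is_derive (f u) 1 G d -> partial a (fun x => G (f x)) u = d * partial a f u.
Proof.
move=> df [/derivable1_diffP dG <-].
have -> : (fun x => G (f x)) = G \o f by [].
rewrite !partialE//; last exact: differentiable_comp.
rewrite diff_comp//= -[X in 'd G _ X = _]mulr1 [LHS]linearZ/= mulrC.
by rewrite deriveE.
Qed.

(** The same scheme for a function of one variable, taken from a family [C] closed under
    differentiation on a set [I] containing the values of [f]. Reciprocals, real powers and the flat
    exponential only have to supply such a family. *)
Lemma smooth_on_comp1 (I : set R) (C : (R -> R) -> Prop) U f G : open U ->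
  (forall G, C G -> exists2 G', C G' & forall x, I x -> is_derive x 1 G (G' x)) ->
  smooth_on U f -> (forall u, U u -> I (f u)) -> C G ->
  smooth_on U (fun x => G (f x)).
Proof.
move=> oU hC sf UI CG.
pose B g := exists2 G, C G & g = fun x => G (f x).
apply: (@smooth_gen_alg R n U B) => //; last by apply: gen_base; exists G.
- move=> _ [H CH ->] u Uu; have [H' _ /(_ (f u) (UI _ Uu)) [dH _]] := hC _ CH.
  apply: (@differentiable_comp _ _ _ _ f H); first exact: smooth_on_diff sf Uu.
  exact/derivable1_diffP.
- move=> _ a [H CH ->]; have [H' CH' hH] := hC _ CH.
  exists (fun x => H' (f x) * partial a f x).
    apply: gen_mul; first by apply: gen_base; exists H'.
    by apply: gen_smooth; exact: smooth_on_partial.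
  move=> u; rewrite inE => Uu; apply: partial_comp1; first exact: smooth_on_diff sf Uu.
  exact/hH/UI.
Qed.

Lemma smooth_onN U f : open U -> smooth_on U f -> smooth_on U (fun x => - f x).
Proof.
move=> oU sf.
apply: (smooth_on_ext oU _ (smooth_onM oU (smooth_on_cst (-1) oU) sf)) => u _.
by rewrite mulN1r.
Qed.

Lemma smooth_onB U f g : open U -> smooth_on U f -> smooth_on U g ->
  smooth_on U (fun x => f x - g x).
Proof. by move=> oU sf sg; apply: smooth_onD => //; exact: smooth_onN. Qed.

Lemma smooth_onX U f k : open U -> smooth_on U f -> smooth_on U (fun x => f x ^+ k).
Proof.
move=> oU sf; elim: k => [|k IH]; first exact: smooth_on_cst.
by apply: (smooth_on_ext oU _ (smooth_onM oU sf IH)) => u _; rewrite exprS.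
Qed.

Lemma smooth_onV U f : open U -> (forall u, U u -> f u != 0) ->
  smooth_on U f -> smooth_on U (fun x => (f x)^-1).
Proof.
move=> oU f0 sf.
apply: (@smooth_on_comp1 (fun x => x != 0)
  (fun G => exists c k, G = fun x => c * (x^-1) ^+ k) _ f (fun x => x^-1)) => //.
- move=> _ [c [k ->]]; exists (fun x => - (c * k%:R) * x^-1 ^+ k.+1); first by exists (- (c * k%:R)), k.+1.
  move=> x x0.
  have dV : is_derive x 1 (fun x : R => x^-1) (- x^-1 ^+ 2).
    apply: DeriveDef; first exact: derivableV.
    by rewrite (deriveV (f := id))// derive_id /GRing.scale/= mulr1 -exprVn.
  pose dX := @is_deriveX _ _ _ k _ _ _ dV.
  case: k dX => [|k] dX.
    rewrite mulr0 oppr0 mul0r; under eq_fun do rewrite expr0 mulr1.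
    exact: is_derive_cst.
  have -> : (fun x : R => c * x^-1 ^+ k.+1) = c *: ((fun x => x^-1) ^+ k.+1).
    by apply/funext => y; rewrite !fctE.
  apply: (is_derive_eq (is_deriveZ c dX)).
  rewrite /GRing.scale/= !exprS expr0; set j := k.+1%:R; ring.
- by exists 1, 1%N; apply/funext => x; rewrite mul1r expr1.
Qed.

Lemma smooth_on_powR U f r : open U -> (forall u, U u -> 0 < f u) ->
  smooth_on U f -> smooth_on U (fun x => f x `^ r).
Proof.
move=> oU f0 sf.
apply: (@smooth_on_comp1 (fun x => 0 < x)
  (fun G => exists c r, G = fun x => c * x `^ r) _ f (fun x => x `^ r)) => //.
- move=> _ [c [k ->]]; exists (fun x => (c * k) * x `^ (k - 1)); first by exists (c * k), (k - 1).
  move=> x x0.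
  apply: (is_derive_eq (is_deriveZ c (is_derive1_powR k x0))).
  by rewrite /GRing.scale/= mulrA.
- by exists 1, r; apply/funext => x; rewrite mul1r.
Qed.

End Compositions.

(** * The flat exponential and bump functions *)

Section Bump.
Variable R : realType.

(** The flat function [exp (-1/x)] extended by zero. The extra factor [x^(-k)] is there because
    differentiation produces such powers: the derivative of the member of index [k] combines those
    of indices [k + 1] and [k + 2]. *)
Definition expinv (k : nat) (x : R) : R :=
  if 0 < x then x^-1 ^+ k * expR (- x^-1) else 0.

Lemma expinv_gt0 x : 0 < x -> 0 < expinv 0 x.
Proof. by move=> x0; rewrite /expinv x0 expr0 mul1r expR_gt0. Qed.

Lemma expinv_le0 k x : x <= 0 -> expinv k x = 0.
Proof. by rewrite /expinv ltNge => ->. Qed.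

Lemma expinv_ge0 k x : 0 <= expinv k x.
Proof.
rewrite /expinv; case: ifPn => // x0.
by rewrite mulr_ge0 ?expR_ge0// exprn_ge0// invr_ge0 ltW.
Qed.

(** With [y = 1/x] this is [y^(k+2) <= (k+2)! exp y], one term of the exponential series. Order two
    in [x] makes the difference quotient at the origin tend to zero. *)
Lemma expinv_le k x : 0 < x -> expinv k x <= k.+2`!%:R * x ^+ 2.
Proof.
move=> x0; rewrite /expinv x0.
have y0 : 0 < x^-1 by rewrite invr_gt0.
have := expR_ge1Dxn k.+1 (ltW y0); have : x = (x^-1)^-1 by rewrite invrK.
move: (x^-1) y0 => y y0 xy H.
have F0 : 0 < k.+2`!%:R :> R by rewrite ltr0n fact_gt0.
have H2 : y ^+ k.+2 <= k.+2`!%:R * expR y.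
  rewrite mulrC -ler_pdivrMr//; apply: le_trans H; lra.
rewrite expRN.
rewrite ler_pdivrMr ?expR_gt0// -mulrA [_ ^+ 2 * _]mulrC mulrA xy exprVn.
by rewrite ler_pdivlMr ?exprn_gt0// -exprD addn2.
Qed.

Lemma is_derive_expinv k (x : R) :
  is_derive x 1 (expinv k) (- k%:R * expinv k.+1 x + expinv k.+2 x).
Proof.
have [x0|x0|->] := ltgtP x 0.
- rewrite !expinv_le0 ?(ltW x0)// mulr0 addr0.
  have E0 : \forall y \near x, cst 0 y = expinv k y.
    near=> y; rewrite expinv_le0//; near: y; exact: lt_le_nbhsl.
  exact: (near_eq_is_derive E0 (is_derive_cst _ _ _)).
- pose g := (fun y : R => y^-1 ^+ k) * (fun y => expR (- y^-1)).
  have Eg : \forall y \near x, g y = expinv k y.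
    near=> y; rewrite /expinv ifT//; near: y; exact: lt_nbhsr.
  apply: (near_eq_is_derive Eg).
  have dV : is_derive x 1 (fun x : R => x^-1) (- x^-1 ^+ 2).
    by apply: (is_derive_eq (is_deriveV _ (is_derive_id x 1))); rewrite ?gt_eqF// /GRing.scale/= mulr1 exprVn.
  have dE : is_derive x 1 (fun y : R => expR (- y^-1)) (expR (- x^-1) * x^-1 ^+ 2).
    have := @is_derive1_comp _ expR (fun y => - y^-1) x _ _ (is_derive_expR _) (is_deriveN dV).
    by rewrite opprK.
  have dX : is_derive x 1 (fun y : R => y^-1 ^+ k) (- k%:R * x^-1 ^+ k.+1).
    have -> : (fun y : R => y^-1 ^+ k) = (fun y => y^-1) ^+ k by apply/funext => y; rewrite fctE.
    apply: (is_derive_eq (is_deriveX k dV)); rewrite /GRing.scale/=.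
    case: k {g Eg} => [|k]; first by rewrite !mul0r oppr0 mul0r.
    by rewrite !exprS /=; ring.
  apply: (is_derive_eq (is_deriveM dX dE)).
  rewrite /expinv x0 /GRing.scale/= !exprS expr0; ring.
- rewrite !expinv_le0// mulr0 addr0.
  have E0 : expinv k 0 = 0 by rewrite expinv_le0.
  suff H : h^-1 *: ((expinv k \o shift 0) (h *: 1) - expinv k 0) @[h --> 0^'] --> (0 : R).
    by apply: DeriveDef; [apply/cvg_ex; exists 0|apply/cvg_lim].
  apply/cvgrPdist_le => e e0.
  have F0 : 0 < k.+2`!%:R :> R by rewrite ltr0n fact_gt0.
  near=> h.
  rewrite sub0r normrN E0 subr0 /= addr0 /GRing.scale/= mulr1.
  have [h0|h0] := leP h 0.
    by rewrite expinv_le0// mulr0 normr0 ltW.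
  rewrite ger0_norm; last by rewrite mulr_ge0 ?expinv_ge0// invr_ge0 ltW.
  rewrite mulrC ler_pdivrMr//; apply: (le_trans (expinv_le k h0)).
  rewrite expr2 mulrA ler_pM2r// mulrC -ler_pdivlMr//.
  rewrite -[leLHS]ger0_norm ?(ltW h0)//; near: h.
  apply: dnbhs0_le; exact: divr_gt0.
Unshelve. all: by end_near. Qed.

(** The linear span of the flat functions, generated inductively so that its stability under
    differentiation is a structural induction. *)
Inductive expinv_span : (R -> R) -> Prop :=
| expinv_span1 k : expinv_span (expinv k)
| expinv_spanZ c G of expinv_span G : expinv_span (fun x => c * G x)
| expinv_spanD G H of expinv_span G & expinv_span H : expinv_span (fun x => G x + H x).

Variable n : nat.
Notation V := 'rV[R]_n.+1.

Lemma smooth_on_expinv (U : set V) f : open U -> smooth_on U f ->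
  smooth_on U (fun x => expinv 0 (f x)).
Proof.
move=> oU sf.
apply: (@smooth_on_comp1 R n setT expinv_span) => //; last exact: expinv_span1.
move=> G; elim=> {G} [k|c G SG [G' SG' hG]|G H SG [G' SG' hG] SH [H' SH' hH]].
- exists (fun x => - k%:R * expinv k.+1 x + expinv k.+2 x).
    by apply: expinv_spanD; [apply: expinv_spanZ|]; exact: expinv_span1.
  by move=> x _; exact: is_derive_expinv.
- exists (fun x => c * G' x); first exact: expinv_spanZ.
  by move=> x Ix; exact: is_deriveZ (hG x Ix).
- exists (fun x => G' x + H' x); first exact: expinv_spanD.
  by move=> x Ix; exact: is_deriveD (hG x Ix) (hH x Ix).
Qed.

(** The quotient [A / (A + B)] of flat functions of the Euclidean square distance [q]: [A] vanishes
    for [q >= r^2] and [B] for [q <= r^2 / 2], so they never vanish together and the quotient is one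
    near [u]. *)
Lemma bump_exists (u : V) (r : R) : 0 < r -> exists b : V -> R,
  [/\ smooth_on setT b, \forall x \near u, b x = 1 &
      forall x, r < `|x - u| -> b x = 0].
Proof.
move=> r0.
pose q (x : V) := \sum_a (x 0 a - u 0 a) ^+ 2.
have sq : smooth_on setT q.
  apply: smooth_on_bigsum; first exact: openT.
  move=> a; apply: smooth_onX; first exact: openT.
  apply: smooth_onB; [exact: openT|exact/smooth_on_coord/openT|exact/smooth_on_cst/openT].
pose A x := expinv 0 (r ^+ 2 - q x); pose B x := expinv 0 (q x - r ^+ 2 / 2).
have r20 : 0 < r ^+ 2 by rewrite exprn_gt0.
have AB x : 0 < A x + B x.
  have [h|h] := ltP 0 (r ^+ 2 - q x).
    by apply: ltr_wpDr; [exact: expinv_ge0|exact: expinv_gt0].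
  by apply: ltr_wpDl; [exact: expinv_ge0|apply: expinv_gt0; lra].
have sA : smooth_on setT A.
  apply: smooth_on_expinv; first exact: openT.
  by apply: smooth_onB => //; [exact: openT|exact/smooth_on_cst/openT].
have sB : smooth_on setT B.
  apply: smooth_on_expinv; first exact: openT.
  by apply: smooth_onB => //; [exact: openT|exact/smooth_on_cst/openT].
exists (fun x => A x * (A x + B x)^-1); split.
- apply: smooth_onM => //; first exact: openT.
  apply: smooth_onV; [exact: openT| |by apply: smooth_onD => //; exact: openT].
  by move=> x _; rewrite gt_eqF.
- have : {for u, continuous q} by apply/differentiable_continuous/(smooth_on_diff sq).
  move=> /cvgr_lt /(_ (r ^+ 2 / 2)).
  have -> : q u = 0 by apply: big1 => a _; rewrite subrr expr0n.
  move=> /(_ (divr_gt0 r20 (ltr0Sn _ _))) cq.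
  near=> x.
  have -> : B x = 0.
    rewrite /B expinv_le0// subr_le0 ltW//; near: x; exact: cq.
  rewrite addr0 divff// gt_eqF//; apply: expinv_gt0.
  have : q x < r ^+ 2 / 2 by near: x; exact: cq.
  by lra.
- move=> x rx; rewrite /A expinv_le0 ?mul0r// subr_le0.
  (* The norm of row vectors is the maximum norm, which is bounded by the Euclidean one. *)
  suff : `|x - u| ^+ 2 <= q x.
    apply: le_trans; rewrite lerXn2r ?nnegrE ?normr_ge0 ?(ltW r0)//; exact: ltW.
  have [->|] := eqVneq (`|x - u|) 0.
    by rewrite expr0n/=; apply: sumr_ge0 => a _; exact: sqr_ge0.
  move=> /mx_norm_neq0[[i j] hij].
  rewrite /Num.norm/= hij/= ord1 !mxE real_normK ?num_real//.
  rewrite /q (bigD1 j)//= lerDl; apply: sumr_ge0 => a _; exact: sqr_ge0.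
Unshelve. all: by end_near. Qed.

End Bump.

(** * Mean value estimates and symmetry of second derivatives *)

Section MeanValue.
Variables (R : realType) (n : nat).
Notation V := 'rV[R]_n.+1.
Implicit Types (f g : V -> R) (x u h : V) (U : set V) (a : 'I_n.+1).

Lemma diff_scale f x (t : R) h : 'd f x (t *: h) = t * 'd f x h.
Proof. by rewrite linearZ. Qed.

Lemma is_derive_line f h x (s : R) : differentiable f (s *: h + x) ->
  is_derive s 1 (fun s => f (s *: h + x)) ('d f (s *: h + x) h).
Proof.
move=> df.
have dl : is_diff s (fun s : R => s *: h + x) ( *:%R^~ h : R -> V).
  have := is_diffD (is_diff_scalel s h) (is_diff_cst x s).
  by move=> H; apply: (is_diff_eq H); rewrite addr0.
have dfl : differentiable (f \o (fun s : R => s *: h + x)) s.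
  by apply: differentiable_comp.
apply: DeriveDef; first exact/derivable1_diffP.
rewrite deriveE// diff_comp//= (@diff_val _ _ _ _ _ _ _ dl) scale1r//.
Qed.

Lemma mvt_line f x h : (forall s : R, 0 <= s <= 1 -> differentiable f (s *: h + x)) ->
  exists2 s : R, 0 <= s <= 1 & f (h + x) - f x = 'd f (s *: h + x) h.
Proof.
move=> df.
have H (s : R) : 0 <= s <= 1 ->
  is_derive s 1 (fun s => f (s *: h + x)) ('d f (s *: h + x) h).
  by move=> /df; exact: is_derive_line.
have [||s] := @MVT_segment R (fun s => f (s *: h + x)) (fun s => 'd f (s *: h + x) h) 0 1 ler01.
- by move=> s; rewrite in_itv/= => /andP[s0 s1]; apply: H; rewrite !ltW.
- apply: derivable_within_continuous => s; rewrite in_itv/= => s01.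
  by have [] := H s s01.
- rewrite in_itv/= => s01; rewrite scale1r scale0r add0r subr0 mulr1 => E.
  by exists s.
Qed.

Lemma le_mx_coord h a : `|h 0 a| <= `|h|.
Proof.
rewrite [leRHS]/Num.norm/= mx_normrE.
exact: (@le_bigmax _ _ _ 0 (fun ij : 'I_1 * 'I_n.+1 => `|h ij.1 ij.2|) (0, a)).
Qed.

Lemma norm_delta_mx a : `|delta_mx 0 a : V| <= 1.
Proof.
rewrite [leLHS]/Num.norm/= mx_normrE; apply/bigmax_leP; split => //= -[i j] _ /=.
by rewrite mxE; case: (_ && _); rewrite ?normr1// normr0.
Qed.

Lemma norm_scale_delta (t : R) a : `|t *: delta_mx 0 a : V| <= `|t|.
Proof. by rewrite normrZ; have := norm_delta_mx a; have := normr_ge0 t; nra. Qed.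

(** The mean value theorem in direction [a], applied to the increment in direction [b], turns the
    second difference into an increment of [partial a f]; differentiability of that function at the
    single point [u] then gives the estimate. The points involved lie within [2 t] and [t] of [u],
    whence the share [e / 3]. *)
Lemma second_difference f a b u (e : R) : 0 < e ->
  (\forall x \near u, differentiable f x) -> differentiable (partial a f) u ->
  exists2 d : R, 0 < d & forall t, 0 < t -> t < d ->
    `|f (t *: delta_mx 0 a + (t *: delta_mx 0 b + u)) - f (t *: delta_mx 0 a + u)
      - f (t *: delta_mx 0 b + u) + f u
      - t ^+ 2 * partial b (partial a f) u| <= e * t ^+ 2.
Proof.
move=> e0 df dF; set F := partial a f in dF *.
have i11 : 0 <= (1 : R) <= 1 by rewrite lexx ler01.
have i01 : 0 <= (0 : R) <= 1 by rewrite lexx ler01.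
have e30 : 0 < e / 3 by rewrite divr_gt0.
have /nbhs_normP[d1 /= d10 hd1] := diff_epsE dF e30.
have /nbhs_normP[d2 /= d20 hd2] := df.
exists (Num.min d1 d2 / 2); first by rewrite divr_gt0// lt_min d10.
move=> t t0 td.
have [td1 td2] : t * 2 < d1 /\ t * 2 < d2.
  by move: td; rewrite ltr_pdivlMr// lt_min => /andP[].
set ea : V := delta_mx 0 a; set eb : V := delta_mx 0 b.
have nh (s s' : R) : 0 <= s <= 1 -> 0 <= s' <= 1 -> `|s *: (t *: ea) + s' *: (t *: eb)| <= (s + s') * t.
  move=> s01 s'01.
  have E (r : R) c : 0 <= r <= 1 -> `|r *: (t *: delta_mx 0 c) : V| <= r * t.
    move=> r01; rewrite scalerA; apply: le_trans (norm_scale_delta _ _) _.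
    rewrite ger0_norm// mulr_ge0//; lra.
  apply: le_trans (ler_normD _ _) _; rewrite mulrDl; apply: lerD; exact: E.
have dfl (s s' : R) : 0 <= s <= 1 -> 0 <= s' <= 1 ->
    differentiable f (s *: (t *: ea) + (s' *: (t *: eb) + u)).
  move=> s01 s'01; apply: hd2 => /=.
  rewrite addrA opprD addrCA subrr addr0 normrN.
  apply: le_lt_trans (nh _ _ s01 s'01) _; nra.
pose k (s : R) := f (s *: (t *: ea) + (t *: eb + u)) - f (s *: (t *: ea) + u).
have dk (s : R) : 0 <= s <= 1 -> is_derive s 1 k
    (t * (F (s *: (t *: ea) + (t *: eb + u)) - F (s *: (t *: ea) + u))).
  move=> s01; rewrite /k.
  have d1' := dfl s 1 s01; rewrite scale1r in d1'.
  have d2' := dfl s 0 s01; rewrite scale0r add0r in d2'.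
  have {}d1' := d1' i11.
  have {}d2' := d2' i01.
  apply: (is_derive_eq (is_deriveB (is_derive_line d1') (is_derive_line d2'))).
  rewrite /F (partialE a d1') (partialE a d2') mulrBr; congr (_ - _); exact: diff_scale.
have [||s] := @MVT_segment R k (fun s => t * (F (s *: (t *: ea) + (t *: eb + u)) -
  F (s *: (t *: ea) + u))) 0 1 ler01.
- by move=> s; rewrite in_itv/= => /andP[s0 s1]; apply: dk; rewrite !ltW.
- apply: derivable_within_continuous => s; rewrite in_itv/= => s01.
  by have [] := dk s s01.
rewrite in_itv/= => s01; rewrite subr0 mulr1 {1 2}/k !scale1r !scale0r !add0r => E.
set h1 := s *: (t *: ea) + t *: eb; set h2 := s *: (t *: ea).
have n1 : `|h1| <= 2 * t.
  have := nh s 1 s01 i11; rewrite scale1r -/h1 => H.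
  apply: le_trans H _; nra.
have n2 : `|h2| <= t.
  have := nh s 0 s01 i01; rewrite scale0r addr0 -/h2 => H.
  apply: le_trans H _; nra.
have E1 : `|F (h1 + u) - F u - 'd F u h1| <= e / 3 * (2 * t).
  apply: (@le_trans _ _ (e / 3 * `|h1|)); last by rewrite ler_pM2l.
  by apply: hd1 => /=; rewrite sub0r normrN; lra.
have E2 : `|F (h2 + u) - F u - 'd F u h2| <= e / 3 * t.
  apply: (@le_trans _ _ (e / 3 * `|h2|)); last by rewrite ler_pM2l.
  by apply: hd1 => /=; rewrite sub0r normrN; lra.
have E3 : 'd F u h1 = 'd F u h2 + t * partial b F u.
  by rewrite /h1 linearD/= (partialE b dF); congr (_ + _); exact: diff_scale.
rewrite E3 in E1.
have -> : f (t *: ea + (t *: eb + u)) - f (t *: ea + u) - f (t *: eb + u) + f u =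
   t * (F (h1 + u) - F (h2 + u)).
  have hE : h1 + u = s *: (t *: ea) + (t *: eb + u) by rewrite /h1 addrA.
  by rewrite hE /h2 -E; ring.
have -> : t * (F (h1 + u) - F (h2 + u)) - t ^+ 2 * partial b F u =
  t * ((F (h1 + u) - F u - ('d F u h2 + t * partial b F u)) - (F (h2 + u) - F u - 'd F u h2)) by ring.
rewrite normrM gtr0_norm// expr2 mulrCA ler_pM2l//.
apply: le_trans (ler_normB _ _) _; lra.
Qed.

(** The second difference is symmetric in the two directions, so both mixed derivatives are its
    limit after division by [t^2]. *)
Lemma partialC f a b u U : open U -> smooth_on U f -> U u ->
  partial a (partial b f) u = partial b (partial a f) u.
Proof.
move=> oU sf Uu; apply/eqP; rewrite -subr_eq0 -normr_le0; apply/ler_addgt0Pl => e e0.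
rewrite addr0.
have df : \forall x \near u, differentiable f x.
  by near=> x; apply: (smooth_on_diff sf); near: x; exact: open_near.
have e20 : 0 < e / 2 by rewrite divr_gt0.
have d_ c : differentiable (partial c f) u.
  exact: smooth_on_diff (smooth_on_partial c sf) Uu.
have [d1 d10 h1] := second_difference b e20 df (d_ a).
have [d2 d20 h2] := second_difference a e20 df (d_ b).
pose t := Num.min d1 d2 / 2.
have m0 : 0 < Num.min d1 d2 by rewrite lt_min d10.
have t0 : 0 < t by rewrite divr_gt0.
have tm : t < Num.min d1 d2 by rewrite /t; lra.
move: (tm); rewrite lt_min => /andP[td1 td2].
pose D := f (t *: delta_mx 0 a + (t *: delta_mx 0 b + u)).
pose A := f (t *: delta_mx 0 a + u); pose B := f (t *: delta_mx 0 b + u).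
pose X := partial a (partial b f) u; pose Y := partial b (partial a f) u.
have H1 : `|D - A - B + f u - t ^+ 2 * Y| <= e / 2 * t ^+ 2 := h1 t t0 td1.
have H2 : `|D - B - A + f u - t ^+ 2 * X| <= e / 2 * t ^+ 2.
  by rewrite /D addrCA; exact: h2 t t0 td2.
rewrite -/X -/Y; move: D A B (f u) X Y H1 H2 => D A B C X Y H1 H2.
have T0 : 0 < t ^+ 2 by rewrite exprn_gt0.
rewrite -(ler_pM2l T0) -{1}(gtr0_norm T0) -normrM.
have -> : t ^+ 2 * (X - Y) = (D - A - B + C - t ^+ 2 * Y) - (D - B - A + C - t ^+ 2 * X) by ring.
apply: le_trans (ler_normB _ _) _; lra.
Unshelve. all: by end_near. Qed.

End MeanValue.

(** * Division by a function with nonzero differential on its zero set *)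

Section Division.
Variables (R : realType) (n : nat).
Notation V := 'rV[R]_n.+1.
Implicit Types (f g s : V -> R) (x p h : V) (U : set V) (a : 'I_n.+1).

Lemma mvt_partial f x a (t : R) :
  (forall r : R, 0 <= r <= 1 -> differentiable f ((r * t) *: delta_mx 0 a + x)) ->
  exists2 r : R, 0 <= r <= 1 &
    f (t *: delta_mx 0 a + x) - f x = t * partial a f ((r * t) *: delta_mx 0 a + x).
Proof.
move=> df; have [|r r01 E] := @mvt_line R n f x (t *: delta_mx 0 a).
  by move=> r r01; rewrite scalerA; exact: df.
exists r => //; rewrite E scalerA (partialE a (df r r01)); exact: diff_scale.
Qed.

Lemma near_dist p (e : R) : 0 < e -> \forall x \near p, `|p - x| < e.
Proof.
by move=> e0; have /cvgrPdist_lt /(_ e e0) := @cvg_id _ (nbhs p).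
Qed.

Lemma near_bounded f p : {for p, continuous f} ->
  exists2 C : R, 0 < C & \forall x \near p, `|f x| <= C.
Proof.
move=> cf; exists (`|f p| + 1); first by rewrite ltr_wpDl.
have /cvgrPdist_le /(_ 1 ltr01) H := cf.
near=> x.
have : `|f p - f x| <= 1 by near: x.
rewrite -lerBlDl; apply: le_trans; rewrite distrC; exact: lerB_dist.
Unshelve. all: by end_near. Qed.

Lemma smooth_continuous U f p : smooth_on U f -> U p -> {for p, continuous f}.
Proof. by move=> sf Up; exact/differentiable_continuous/(smooth_on_diff sf). Qed.

Lemma dist_delta x a (t : R) p : `|p - (t *: delta_mx 0 a + x)| <= `|p - x| + `|t|.
Proof.
rewrite opprD addrCA addrC; apply: le_trans (ler_normB _ _) _.
by rewrite lerD2l norm_scale_delta.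
Qed.

Lemma ler_prod01 (r t : R) : 0 <= r <= 1 -> `|r * t| <= `|t|.
Proof.
move=> /andP[r0 r1]; rewrite normrM ger0_norm//.
by rewrite -[leRHS]mul1r ler_wpM2r.
Qed.

(** Interpolation between a small function and a bounded second derivative: a Taylor step of length
    [t] bounds [partial a g] by a multiple of [sup |g| / t + t], and [t = |s x|^K] balances the two
    terms. Half of the order of decay is lost, which is why approximations are later required to
    every order. *)
Lemma partial_decay U s g p a K (C : R) : open U -> U p -> smooth_on U s ->
  smooth_on U g -> s p = 0 -> (0 < K)%N ->
  (\forall x \near p, `|g x| <= C * `|s x| ^+ (2 * K)) ->
  exists C' : R, \forall x \near p, `|partial a g x| <= C' * `|s x| ^+ K.
Proof.
move=> oU Up ss sg sp K0 gC.
have sg1 := smooth_on_partial a sg.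
have [B B0 hB] := near_bounded (smooth_continuous (smooth_on_partial a sg1) Up).
have [L L0 hL] := near_bounded (smooth_continuous (smooth_on_partial a ss) Up).
have [d d0 hd] : exists2 d : R, 0 < d & forall x, `|p - x| < d ->
    [/\ U x, `|g x| <= C * `|s x| ^+ (2 * K),
      `|partial a (partial a g) x| <= B & `|partial a s x| <= L].
  have : \forall x \near p, [/\ U x, `|g x| <= C * `|s x| ^+ (2 * K),
      `|partial a (partial a g) x| <= B & `|partial a s x| <= L].
    near=> x; split; near: x => //; exact: open_near.
  by move=> /nbhs_normP[d /= d0 hd]; exists d.
have hdU x : `|p - x| < d -> U x by move=> /hd[].
pose C1 : R := `|C|.
have CC1 : C <= C1 by exact: ler_norm.
have C10 : 0 <= C1 by exact: normr_ge0.
(* [M] collects the bounds for [g] at the far and the near end of the step, where [|s|] is at most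
   [(1 + L) tau] and [tau], and the bound for the second derivative. *)
pose M : R := C1 * (1 + L) ^+ (2 * K) + C1 + B.
have L1 : 0 <= 1 + L by rewrite addr_ge0// ltW.
have M0 : 0 < M.
  by rewrite /M ltr_wpDl// addr_ge0// mulr_ge0// exprn_ge0.
(* The two parameters serve two cases: [tau = t] arbitrarily small at zeros of [s], forcing the
   derivative to vanish there, and [tau = |s x|], [t = tau^K] elsewhere. *)
have key x (t tau : R) : `|p - x| < d / 2 -> 0 < t -> t < d / 2 -> `|s x| <= tau -> t <= tau ->
  tau ^+ (2 * K) <= t ^+ 2 -> `|partial a g x| <= M * t.
  move=> xd t0 td sxt ttau tauK.
  have hx (r : R) : 0 <= r <= 1 -> `|p - ((r * t) *: delta_mx 0 a + x)| < d.
    move=> r01; apply: le_lt_trans (dist_delta _ _ _ _) _.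
    by have := ler_prod01 t r01; rewrite (gtr0_norm t0); lra.
  have hx0 : `|p - x| < d by lra.
  have [Ux gx _ _] := hd _ hx0.
  have [r1 r1_01 E1] := @mvt_partial s x a t (fun r r01 =>
    smooth_on_diff ss (hdU _ (hx r r01))).
  have [r2 r2_01 E2] := @mvt_partial g x a t (fun r r01 =>
    smooth_on_diff sg (hdU _ (hx r r01))).
  have hx2 (r : R) : 0 <= r <= 1 -> `|p - ((r * (r2 * t)) *: delta_mx 0 a + x)| < d.
    move=> /andP[ra rb]; rewrite mulrA; apply: hx; case/andP: r2_01 => qa qb.
    by rewrite mulr_ge0//= -[leRHS]mul1r ler_pM.
  have [r3 r3_01 E3] := @mvt_partial (partial a g) x a (r2 * t) (fun r r01 =>
    smooth_on_diff sg1 (hdU _ (hx2 r r01))).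
  have [_ _ _ Ls] := hd _ (hx r1 r1_01).
  have [_ _ B3 _] := hd _ (hx2 r3 r3_01).
  have i11 : 0 <= (1 : R) <= 1 by rewrite lexx ler01.
  have [_ gxt _ _] := hd _ (hx 1 i11).
  rewrite mul1r in gxt.
  have tau0 : 0 < tau by exact: lt_le_trans t0 ttau.
  have S1 : `|s (t *: delta_mx 0 a + x)| <= (1 + L) * tau.
    rewrite -[s (t *: _ + _)](subrK (s x)) E1; apply: le_trans (ler_normD _ _) _.
    rewrite normrM gtr0_norm// mulrDl mul1r addrC; apply: lerD => //.
    by rewrite mulrC; apply: ler_pM => //; exact: ltW.
  have G1 : `|g (t *: delta_mx 0 a + x)| <= C1 * (1 + L) ^+ (2 * K) * t ^+ 2.
    apply: (le_trans gxt); rewrite -mulrA.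
    apply: (@le_trans _ _ (C1 * `|s (t *: delta_mx 0 a + x)| ^+ (2 * K))).
      by rewrite ler_wpM2r// exprn_ge0.
    rewrite ler_wpM2l//; apply: (@le_trans _ _ (((1 + L) * tau) ^+ (2 * K))).
      by rewrite lerXn2r ?nnegrE ?normr_ge0// mulr_ge0// ltW.
    by rewrite exprMn ler_wpM2l// exprn_ge0.
  have G2 : `|g x| <= C1 * t ^+ 2.
    apply: (le_trans gx); apply: (@le_trans _ _ (C1 * `|s x| ^+ (2 * K))).
      by rewrite ler_wpM2r// exprn_ge0.
    rewrite ler_wpM2l//; apply: le_trans tauK.
    by rewrite lerXn2r ?nnegrE ?normr_ge0// ltW.
  set z := partial a (partial a g) ((r3 * (r2 * t)) *: delta_mx 0 a + x) in E3 B3.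
  have G4 : `|t * (r2 * t * z)| <= B * t ^+ 2.
    rewrite (_ : t * (r2 * t * z) = r2 * z * t ^+ 2); last by ring.
    rewrite normrM (gtr0_norm (_ : 0 < t ^+ 2)) ?exprn_gt0//.
    rewrite ler_pM2r ?exprn_gt0//; apply: le_trans B3; exact: ler_prod01.
  have G3 : `|t * partial a g x| <= M * t ^+ 2.
    have -> : t * partial a g x = (g (t *: delta_mx 0 a + x) - g x) - t * (r2 * t * z).
      by rewrite E2 -E3; ring.
    apply: le_trans (ler_normB _ _) _.
    have := ler_normB (g (t *: delta_mx 0 a + x)) (g x).
    rewrite /M !mulrDl; lra.
  rewrite normrM gtr0_norm// in G3.
  by rewrite -(ler_pM2l t0); apply: le_trans G3 _; rewrite expr2 mulrCA.
exists M.
have : {for p, continuous s} by exact: smooth_continuous ss Up.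
move=> /cvgrPdist_lt; rewrite sp => cs.
have m0 : 0 < Num.min (d / 2) 1 by rewrite lt_min ltr01 divr_gt0.
have [m1 m2] : Num.min (d / 2) 1 <= d / 2 /\ Num.min (d / 2) 1 <= 1.
  by rewrite !ge_min !lexx orbT.
near=> x.
have xd : `|p - x| < d / 2.
  by near: x; apply: near_dist; rewrite divr_gt0.
have sx1 : `|s x| < Num.min (d / 2) 1.
  by rewrite -normrN -sub0r; near: x; apply: cs.
have [sx0|sx0] := eqVneq (s x) 0.
  suff -> : partial a g x = 0.
    by rewrite normr0 mulr_ge0 ?exprn_ge0// ltW.
  apply/eqP; rewrite -normr_le0; apply/ler_addgt0Pl => e e0; rewrite addr0.
  pose t : R := Num.min (Num.min (d / 2) 1 / 2) (e / M).
  have t0 : 0 < t by rewrite /t lt_min divr_gt0//= divr_gt0.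
  have t1 : t <= Num.min (d / 2) 1 / 2 by rewrite /t ge_min lexx.
  have te : t <= e / M by rewrite /t ge_min lexx orbT.
  have : `|partial a g x| <= M * t.
    apply: (key x t t) => //; [lra|by rewrite sx0 normr0 ltW|].
    by apply: ler_wiXn2l; [exact: ltW|lra|case: (K) K0 => // k _; rewrite mulnS].
  move/le_trans; apply; by rewrite mulrC -ler_pdivlMr.
have sx00 : 0 < `|s x| by rewrite normr_gt0.
have [sxd sx1'] : `|s x| < d / 2 /\ `|s x| < 1 by move: sx1; rewrite lt_min => /andP.
have tK : `|s x| ^+ K <= `|s x|.
  by rewrite -[leRHS]expr1; apply: ler_wiXn2l => //; exact: ltW.
apply: (key x (`|s x| ^+ K) `|s x|) => //.
- by rewrite exprn_gt0.
- exact: le_lt_trans tK sxd.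
- by rewrite -exprM mulnC.
Unshelve. all: by end_near. Qed.

(* Moving from [x] in the direction transverse to [s = 0] by a distance
   comparable to [|s x|] reaches the zero set, by the intermediate value theorem. *)
Lemma vanishing_growth U s r p a N (C : R) : open U -> U p -> smooth_on U s ->
  smooth_on U r -> s p = 0 -> partial a s p != 0 ->
  (forall x, U x -> s x = 0 -> r x = 0) ->
  (\forall x \near p, `|partial a r x| <= C * `|s x| ^+ N) ->
  exists C' : R, \forall x \near p, `|r x| <= C' * `|s x| ^+ N.+1.
Proof.
move=> oU Up ss sr sp m0 r0 rC; set m := partial a s p in m0.
have m20 : 0 < `|m| / 2 by rewrite divr_gt0// normr_gt0.
have /cvgrPdist_le /(_ _ m20) cs1 := smooth_continuous (smooth_on_partial a ss) Up.
have [d d0 hd] : exists2 d : R, 0 < d & forall x, `|p - x| < d ->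
    [/\ U x, `|partial a r x| <= C * `|s x| ^+ N & `|m - partial a s x| <= `|m| / 2].
  have : \forall x \near p, [/\ U x, `|partial a r x| <= C * `|s x| ^+ N
      & `|m - partial a s x| <= `|m| / 2].
    near=> x; split; near: x => //; exact: open_near.
  by move=> /nbhs_normP[d /= d0 hd]; exists d.
have hdU x : `|p - x| < d -> U x by move=> /hd[].
exists (2 / `|m| * (`|C| * 4 ^+ N)).
have : {for p, continuous s} by exact: smooth_continuous ss Up.
move=> /cvgrPdist_lt; rewrite sp => cs.
near=> x.
have xd : `|p - x| < d / 2.
  by near: x; apply: near_dist; rewrite divr_gt0.
have sx : `|s x| < d / 2 * (`|m| / 2).
  by rewrite -normrN -sub0r; near: x; apply: cs; rewrite mulr_gt0// divr_gt0.
(* Twice the Newton step: the slope of [s] stays within half of [m], so [s] reaches zero or changes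
   sign along a segment of this length. *)
pose T : R := - (s x / (m / 2)).
have nT : `|T| = `|s x| / (`|m| / 2).
  by rewrite /T normrN normrM normfV normrM (gtr0_norm (_ : 0 < 2^-1))// invr_gt0.
have Td : `|T| < d / 2 by rewrite nT ltr_pdivrMr.
have hx (q : R) : 0 <= q <= 1 -> `|p - ((q * T) *: delta_mx 0 a + x)| < d.
  move=> q01; apply: le_lt_trans (dist_delta _ _ _ _) _.
  by have := ler_prod01 T q01; lra.
have ds q : 0 <= q <= 1 -> differentiable s (q *: (T *: delta_mx 0 a) + x).
  by move=> q01; rewrite scalerA; exact/(smooth_on_diff ss)/hdU/hx.
have [c c01 Ec] := @mvt_partial s x a T (fun r r01 =>
    smooth_on_diff ss (hdU _ (hx r r01))).
have [_ _ hc] := hd _ (hx c c01).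
have [q q01 sq] : exists2 q : R, 0 <= q <= 1 & s ((q * T) *: delta_mx 0 a + x) = 0.
  have k0 : s (T *: delta_mx 0 a + x) * s x <= 0.
    set y := partial a s _ in Ec hc.
    have -> : s (T *: delta_mx 0 a + x) = s x * (1 - 2 * (y / m)).
      by rewrite -[LHS](subrK (s x)) Ec /T; field.
    have : 1 / 2 <= y / m.
      have : `|1 - y / m| <= 1 / 2.
        rewrite -(ler_pM2l (_ : 0 < `|m|)) ?normr_gt0// -normrM mulrBr mulr1 mulrC divfK//; lra.
      by rewrite ler_norml; lra.
    rewrite mulrAC -expr2; have := sqr_ge0 (s x); nra.
  have [||q] := @IVT R (fun q => s (q *: (T *: delta_mx 0 a) + x)) 0 1 0 ler01.
  - apply: derivable_within_continuous => q; rewrite in_itv/= => q01.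
    by have [] := is_derive_line (ds q q01).
  - rewrite scale1r scale0r add0r ge_min le_max.
    have [s0|s0] := leP (s x) 0; have [t0|t0] := leP (s (T *: delta_mx 0 a + x)) 0; rewrite ?orbT//=.
    + have : s (T *: delta_mx 0 a + x) * s x = 0.
        by apply/eqP; rewrite eq_le k0 mulr_le0.
      by move/eqP; rewrite mulf_eq0 => /orP[]/eqP->; rewrite lexx ?orbT.
    + by rewrite (ltW t0) orbT.
    + by rewrite (ltW s0).
    + by move: k0; rewrite leNgt mulr_gt0.
  - rewrite in_itv/= => q01; rewrite scalerA => Eq; by exists q.
have hxq (z : R) : 0 <= z <= 1 -> 0 <= z * q <= 1.
  move=> /andP[za zb]; case/andP: q01 => qa qb.
  by rewrite mulr_ge0//= -[leRHS]mul1r ler_pM.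
have [z z01 Ez] := @mvt_partial r x a (q * T) (fun z z01 =>
    smooth_on_diff sr (hdU _ (eq_rect _ (fun y => `|p - (y *: delta_mx 0 a + x)| < d) (hx _ (hxq z z01)) _ (esym (mulrA z q T))))).
rewrite (r0 _ (hdU _ (hx _ q01)) sq) sub0r mulrA in Ez.
have [_ hr _] := hd _ (hx _ (hxq z z01)).
have [c2 c2_01 Ec2] := @mvt_partial s x a (z * q * T) (fun w w01 =>
    smooth_on_diff ss (hdU _ (eq_rect _ (fun y => `|p - (y *: delta_mx 0 a + x)| < d)
      (hx _ (let: conj a b := andP (hxq z z01) in let: conj c e := andP w01 in
        introT andP (conj (mulr_ge0 c a) (mulr_ile1 c a e b)))) _ (esym (mulrA w (z * q) T))))).
(* Along that segment the slope is at most [3 |m| / 2], so [|s|] grows to at most [4 |s x|]. *)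
have s4 : `|s ((z * q * T) *: delta_mx 0 a + x)| <= 4 * `|s x|.
  rewrite -[s (_ *: _ + _)](subrK (s x)) Ec2; apply: le_trans (ler_normD _ _) _.
  have hx3 : `|p - ((c2 * (z * q * T)) *: delta_mx 0 a + x)| < d.
    rewrite mulrA; apply: hx; case/andP: (hxq z z01) => ha hb; case/andP: c2_01 => hc1 hc2.
    by rewrite mulr_ge0//= mulr_ile1.
  have [_ _ hc3] := hd _ hx3; set y := partial a s _ in hc3 *.
  have hy : `|y| <= 3 * (`|m| / 2).
    have -> : y = m - (m - y) by ring.
    apply: le_trans (ler_normB _ _) _; lra.
  rewrite normrM.
  have hT := ler_prod01 T (hxq z z01).
  have : `|z * q * T| * `|y| <= `|T| * (3 * (`|m| / 2)) by apply: ler_pM.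
  by rewrite nT; have -> : `|s x| / (`|m| / 2) * (3 * (`|m| / 2)) = 3 * `|s x|
    by [field; rewrite normr_eq0]; lra.
have -> : r x = - (q * T * partial a r ((z * q * T) *: delta_mx 0 a + x)) by rewrite -Ez opprK.
rewrite normrN normrM exprS mulrACA.
apply: ler_pM => //.
  apply: le_trans (ler_prod01 T q01) _; rewrite nT mulrC.
  by have -> : (`|m| / 2)^-1 = 2 / `|m| by [field; rewrite normr_eq0].
apply: (le_trans hr); apply: (@le_trans _ _ (`|C| * `|s (z * q * T *: 'e_a + x)| ^+ N)).
  by rewrite ler_wpM2r ?exprn_ge0// ler_norm.
by rewrite -[leRHS]mulrA -exprMn ler_wpM2l// lerXn2r ?nnegrE// mulr_ge0.
Unshelve. all: by end_near. Qed.

End Division.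

(** * Smoothness of the quotient *)

Section SmoothQuotient.
Variables (R : realType) (n : nat).
Notation V := 'rV[R]_n.+1.
Implicit Types (f g s : V -> R) (x p h : V) (U : set V) (a : 'I_n.+1).

Lemma partialB f g a p : differentiable f p -> differentiable g p ->
  partial a (fun x => f x - g x) p = partial a f p - partial a g p.
Proof. by move=> df dg; apply: deriveB; exact: diff_derivable. Qed.

Lemma differentiable_expr s k p : differentiable s p ->
  differentiable (fun x => s x ^+ k) p.
Proof.
move=> ds; elim: k => [|k IH]; first exact: differentiable_cst.
have -> : (fun x => s x ^+ k.+1) = s * (fun x => s x ^+ k).
  by apply/funext => x; rewrite exprS.
exact: differentiableM.
Qed.

Lemma partialX s a k p : differentiable s p ->
  partial a (fun x => s x ^+ k) p = k%:R * s p ^+ k.-1 * partial a s p.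
Proof.
move=> ds; elim: k => [|k IH]; first by rewrite !mul0r; exact: partial_cst.
have -> : (fun x => s x ^+ k.+1) = (fun x => s x * s x ^+ k).
  by apply/funext => x; rewrite exprS.
rewrite partialM//; last exact: differentiable_expr.
rewrite IH/=; case: k {IH} => [|k]; first by rewrite !mul0r mulr0 addr0 expr0 mulr1 !mul1r.
rewrite /= exprS -natr1; ring.
Qed.

Lemma open_nonzero U g : open U -> smooth_on U g -> open (U `&` [set x | g x != 0]).
Proof.
move=> oU sg; rewrite openE => x [Ux gx0]; rewrite /interior.
have /cvgrPdist_lt cg := smooth_continuous sg Ux.
have gx : 0 < `|g x| by rewrite normr_gt0.
near=> y; split; first by near: y; exact: open_near.
have : `|g x - g y| < `|g x| by near: y; exact: cg.
by apply: contraTneq => ->; rewrite subr0 ltxx.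
Unshelve. all: by end_near. Qed.

(** Since [s] is differentiable at its zero [p], it is bounded near [p] by a multiple of the
    distance; a bound by [s^2] is then a bound by the squared distance. *)
Lemma flat_partial s (h : V -> R) p (C : R) : s p = 0 -> differentiable s p ->
  (\forall x \near p, `|h x| <= C * `|s x| ^+ 2) ->
  differentiable h p /\ forall a, partial a h p = 0.
Proof.
move=> sp ds hC0.
pose C1 := `|C| + 1.
have C10 : 0 < C1 by rewrite /C1 ltr_wpDl.
have hC : \forall x \near p, `|h x| <= C1 * `|s x| ^+ 2.
  near=> x; apply: (@le_trans _ _ (C * `|s x| ^+ 2)); first by near: x.
  by rewrite ler_wpM2r ?exprn_ge0// /C1; have := ler_norm C; lra.
have hp : h p = 0.
  apply/eqP; rewrite -normr_le0; have := nbhs_singleton hC.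
  by rewrite /= sp normr0 expr0n/= mulr0.
pose B : R := \sum_a `|partial a s p| + 1.
have B0 : 0 < B by rewrite ltr_wpDl// sumr_ge0.
have sB : \forall k \near (0 : V), `|s (k + p)| <= B * `|k|.
  near=> k.
  have : `|s (k + p) - s p - 'd s p k| <= 1 * `|k| by near: k; exact: (diff_epsE ds ltr01).
  rewrite sp subr0 mul1r => H.
  rewrite -[s _](subrK ('d s p k)); apply: le_trans (ler_normD _ _) _.
  rewrite /B mulrDl mul1r addrC; apply: lerD => //.
  rewrite diff_partial// mulr_suml; apply: le_trans (ler_norm_sum _ _ _) _.
  apply: ler_sum => a _; rewrite normrM mulrC ler_wpM2l//; exact: le_mx_coord.
have hC' : \forall k \near (0 : V), `|h (k + p)| <= C1 * `|s (k + p)| ^+ 2.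
  by move: hC; rewrite (near_shift 0 p) subr0.
suff [dh E] : differentiable h p /\ ('d h p : V -> R) = (\0 : {linear V -> R}).
  by split => // a; rewrite partialE// E.
apply: diff_eps; first by move=> x; exact: cst_continuous.
move=> e e0; near=> k.
rewrite hp !subr0.
apply: (@le_trans _ _ (C1 * (B * `|k|) ^+ 2)).
  apply: (@le_trans _ _ (C1 * `|s (k + p)| ^+ 2)); first by near: k.
  rewrite ler_pM2l// lerXn2r ?nnegrE ?normr_ge0 ?mulr_ge0 ?(ltW B0)//.
  by near: k.
have kd : `|k| <= e / (C1 * B ^+ 2).
  rewrite -normrN -sub0r ltW//; near: k; apply: near_dist.
  by rewrite divr_gt0// mulr_gt0// exprn_gt0.
rewrite ler_pdivlMr ?mulr_gt0 ?exprn_gt0// in kd.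
rewrite exprMn (_ : C1 * _ = `|k| * (C1 * B ^+ 2) * `|k|); last by ring.
by rewrite ler_wpM2r.
Unshelve. all: by end_near. Qed.

(** A Taylor expansion transverse to the zero set, obtained by differentiation alone: the remaining
    derivative [s^N c] is removed by adding [s^N c / ((N + 1) partial a s)] to [b], since the
    derivative of [s^(N+1)] is [(N + 1) s^N partial a s]; what is left carries one more power of
    [s]. *)
Lemma hadamard_expansion U s f a N : open U -> smooth_on U s -> smooth_on U f ->
  (forall x, U x -> partial a s x != 0) ->
  exists b c, [/\ smooth_on U b, smooth_on U c &
    forall x, U x -> partial a (fun x => f x - s x * b x) x = s x ^+ N * c x].
Proof.
move=> oU ss sf s0; elim: N => [|N [b [c [sb sc E]]]].
  exists (fun=> 0), (partial a f); split.
  - exact: smooth_on_cst.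
  - exact: smooth_on_partial.
  - move=> x Ux; rewrite expr0 mul1r; congr partial; apply/funext => y.
    by rewrite mulr0 subr0.
pose e x := c x * (N.+1%:R * partial a s x)^-1.
have ss1 := smooth_on_partial a ss.
have N0 : N.+1%:R != 0 :> R by rewrite pnatr_eq0.
have se : smooth_on U e.
  apply: smooth_onM => //; apply: smooth_onV => //.
    by move=> u Uu; rewrite mulf_neq0// s0.
  by apply: smooth_onM => //; exact: smooth_on_cst.
have sX k := smooth_onX k oU ss.
exists (fun x => b x + s x ^+ N * e x), (fun x => - partial a e x); split.
- by apply: smooth_onD => //; exact: smooth_onM.
- by apply: smooth_onN => //; exact: smooth_on_partial.
- move=> x Ux.
  have -> : (fun x => f x - s x * (b x + s x ^+ N * e x)) =
    (fun x => (f x - s x * b x) - s x ^+ N.+1 * e x).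
    by apply/funext => y; rewrite exprS; ring.
  have d1 : differentiable (fun x => f x - s x * b x) x.
    by apply: (smooth_on_diff _ Ux); apply: smooth_onB => //; exact: smooth_onM.
  have d2 := smooth_on_diff (sX N.+1) Ux.
  have d3 := smooth_on_diff se Ux.
  have d4 : differentiable (fun x => s x ^+ N.+1 * e x) x.
    by apply: (smooth_on_diff _ Ux); exact: smooth_onM.
  rewrite partialB// E// partialM// partialX//; last exact: smooth_on_diff ss Ux.
  rewrite /e /= exprS; have := s0 x Ux; set y := partial a s x => y0.
  by rewrite invfM; field; rewrite y0/= addrC natr1.
Qed.

(** If [f] vanishes on the zero set then so does [f - s b], and [vanishing_growth] turns the decay
    of its transverse derivative into decay of the function, gaining one order. *)
Lemma division_approx U s f p K : open U -> U p -> smooth_on U s -> smooth_on U f ->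
  s p = 0 -> (exists a, partial a s p != 0) ->
  (forall x, U x -> s x = 0 -> f x = 0) ->
  exists (W : set V) b (C : R), [/\ open W, W p, W `<=` U, smooth_on W b &
    \forall x \near p, `|f x - s x * b x| <= C * `|s x| ^+ K.+1].
Proof.
move=> oU Up ss sf sp [a sa0] fs.
pose W := U `&` [set x | partial a s x != 0].
have oW : open W by apply: open_nonzero => //; exact: smooth_on_partial.
have Wp : W p by split.
have ssW : smooth_on W s by apply: smooth_on_sub ss => x [].
have sfW : smooth_on W f by apply: smooth_on_sub sf => x [].
have [|b [c [sb sc E]]] := @hadamard_expansion W s f a K oW ssW sfW.
  by move=> x [].
have [B B0 hB] := near_bounded (smooth_continuous sc Wp).
have srW : smooth_on W (fun x => f x - s x * b x).
  by apply: smooth_onB => //; exact: smooth_onM.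
have [||C hC] := @vanishing_growth R n W s (fun x => f x - s x * b x) p a K B oW Wp ssW srW sp sa0.
- by move=> x [Ux _] sx; rewrite fs// sx mul0r subr0.
- near=> x; rewrite E; last by near: x; exact: open_near.
  rewrite normrM normrX mulrC ler_wpM2r ?exprn_ge0//; near: x; exact: hB.
by exists W, b, C; split => // x [].
Unshelve. all: by end_near. Qed.

(** On the zero set the value is the l'Hopital ratio in a direction transverse to it. When [f]
    vanishes together with [s], all transverse directions give the same ratio, so an arbitrary pick
    is harmless. *)
Definition quotient s f x : R :=
  if s x == 0 then
    (if [pick a | partial a s x != 0] is Some a then partial a f x / partial a s x
     else 0)
  else f x / s x.

(* The class of functions with poles cancelled to all orders along [s = 0]:
   it is stable under partial derivatives and contains the quotients f / s. *)
Definition almost_smooth U s (Q : V -> R) :=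
  (exists N, smooth_on U (fun x => s x ^+ N * Q x)) /\
  forall p, U p -> s p = 0 -> forall K, exists (W : set V) b (C : R),
    [/\ open W, W p, smooth_on W b & \forall x \near p, `|Q x - b x| <= C * `|s x| ^+ K].

Lemma near_join_nbhs p (P : V -> Prop) :
  (\forall x \near p, P x) -> \forall x \near p, \forall y \near x, P y.
Proof.
by move=> /nbhs_interior.
Qed.

(** At a zero of [s] the function differs from a smooth one by a quadratically small error, covered
    by [flat_partial]; elsewhere it is a smooth function divided by a power of [s]. *)
Lemma almost_smooth_diff U s Q : open U -> smooth_on U s -> almost_smooth U s Q ->
  forall x, U x -> differentiable Q x.
Proof.
move=> oU ss [[N sN] hQ] x Ux; have [sx|sx] := eqVneq (s x) 0.
  have [W [b [C [oW Wx sb hC]]]] := hQ x Ux sx 2%N.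
  have [dQ _] := flat_partial sx (smooth_on_diff ss Ux) hC.
  have -> : Q = (fun x => Q x - b x) + b by apply/funext => y; rewrite !fctE subrK.
  by apply: differentiableD => //; exact: smooth_on_diff sb Wx.
pose W := U `&` [set x | s x != 0].
have oW : open W by exact: open_nonzero.
apply: (@differentiable_ext R n W (fun x => (s x ^+ N * Q x) * (s x ^+ N)^-1) Q) => //.
  by move=> y; rewrite inE => -[Uy sy] /=; rewrite mulrAC divff ?mul1r// expf_neq0.
apply: (smooth_on_diff (U := W)) => //; apply: smooth_onM => //.
  by apply: smooth_on_sub sN => y [].
apply: smooth_onV => //; first by move=> y [_ /= sy]; rewrite expf_neq0.
by apply: smooth_onX => //; apply: smooth_on_sub ss => y [].
Qed.

(** The pole condition follows from the product rule for [s^N Q]. For the approximations, [Q - b] is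
    not known to be smooth, so the interpolation estimate is applied to [s^N (Q - b)] and divided by
    [s^N] afterwards; at zeros of [s] near [p], where this division fails, [flat_partial] gives
    equality of the derivatives. *)
Lemma almost_smooth_partial U s Q a : open U -> smooth_on U s ->
  almost_smooth U s Q -> almost_smooth U s (partial a Q).
Proof.
move=> oU ss hQ; have dQ := almost_smooth_diff oU ss hQ.
case: hQ => [[N sN] hQ]; split.
  exists N.+1.
  have sh : smooth_on U (fun x => s x * partial a (fun x => s x ^+ N * Q x) x -
     N%:R * (s x ^+ N * Q x) * partial a s x).
    apply: smooth_onB => //; first by apply: smooth_onM => //; exact: smooth_on_partial.
    apply: smooth_onM => //; last exact: smooth_on_partial.
    by apply: smooth_onM => //; exact: smooth_on_cst.
  apply: (smooth_on_ext oU _ sh) => x; rewrite inE => Ux /=.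
  have dsx := smooth_on_diff ss Ux.
  have dXx := differentiable_expr N dsx.
  have dQx := dQ x Ux.
  rewrite partialM// partialX//; case: (N) => [|k]; first by rewrite expr0 expr1; ring.
  by rewrite /= !exprS; ring.
(* Chosen so that [K' + N = 2 (N + K + 1)]: halving the order and dividing by [s^N] leaves at least
   order [K]. *)
move=> p Up sp K; pose K' := (N + K.*2.+2)%N.
have [W [b [C [oW Wp sb hC]]]] := hQ p Up sp K'.
pose U' := U `&` W.
have oU' : open U' by exact: openI.
have ssU' : smooth_on U' s by apply: smooth_on_sub ss => x [].
have sbU' : smooth_on U' b by apply: smooth_on_sub sb => x [].
have sNU' : smooth_on U' (fun x => s x ^+ N * Q x) by apply: smooth_on_sub sN => x [].
pose g x := s x ^+ N * Q x - s x ^+ N * b x.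
have sg : smooth_on U' g.
  by apply: smooth_onB => //; apply: smooth_onM => //; exact: smooth_onX.
have gC : \forall x \near p, `|g x| <= C * `|s x| ^+ (2 * (N + K.+1)).
  near=> x; rewrite /g -mulrBr normrM normrX.
  have -> : (2 * (N + K.+1) = K' + N)%N by rewrite /K' -muln2; lia.
  rewrite exprD mulrA [leRHS]mulrC ler_wpM2l ?exprn_ge0//; near: x; exact: hC.
have [|C' hC'] := @partial_decay R n U' s g p a (N + K.+1)%N C oU' (conj Up Wp) ssU' sg sp _ gC.
  by rewrite addnS.
have [L L0 hL] := near_bounded (smooth_continuous (smooth_on_partial a ss) Up).
exists W, (partial a b), (`|C'| + N%:R * L * `|C|); split => //.
  exact: smooth_on_partial.
have : {for p, continuous s} by exact: smooth_continuous ss Up.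
move=> /cvgrPdist_lt /(_ 1 ltr01); rewrite sp => cs.
have hC2 : \forall x \near p, \forall y \near x, `|Q y - b y| <= `|C| * `|s y| ^+ 2.
  apply: near_join_nbhs; near=> x.
  have sx : `|s x| < 1 by rewrite -normrN -sub0r; near: x.
  apply: (@le_trans _ _ (C * `|s x| ^+ K')); first by near: x.
  apply: (@le_trans _ _ (`|C| * `|s x| ^+ K')).
    by rewrite ler_wpM2r ?exprn_ge0// ler_norm.
  rewrite ler_wpM2l//; apply: ler_wiXn2l => //; first exact: ltW.
  by rewrite /K' addnS addnS.
near=> x.
have [Ux Wx] : U' x by near: x; exact: open_near.
have sx1 : `|s x| < 1 by rewrite -normrN -sub0r; near: x.
have dsx := smooth_on_diff ss Ux.
have dbx := smooth_on_diff sb Wx.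
have dQx := dQ x Ux.
have E0 : partial a (fun x => Q x - b x) x = partial a Q x - partial a b x by rewrite partialB.
have [sx|sx] := eqVneq (s x) 0.
  have [|_ /(_ a)] := @flat_partial s (fun x => Q x - b x) x `|C| sx dsx.
    by near: x; exact: hC2.
  rewrite E0 => ->; rewrite normr0 mulr_ge0 ?exprn_ge0// addr_ge0// mulr_ge0//.
  by rewrite mulr_ge0// ltW.
have E1 : partial a g x = N%:R * s x ^+ N.-1 * partial a s x * (Q x - b x)
    + s x ^+ N * (partial a Q x - partial a b x).
  have -> : g = fun x => s x ^+ N * (Q x - b x) by apply/funext => y; rewrite mulrBr.
  rewrite partialM ?partialX ?E0//; first exact: differentiable_expr.
  exact: differentiableB.
have sx0 : 0 < `|s x| by rewrite normr_gt0.
have g1 : `|partial a g x| <= `|C'| * `|s x| ^+ (N + K).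
  apply: (@le_trans _ _ (C' * `|s x| ^+ (N + K.+1))); first by near: x.
  apply: (@le_trans _ _ (`|C'| * `|s x| ^+ (N + K.+1))).
    by rewrite ler_wpM2r ?exprn_ge0// ler_norm.
  by rewrite ler_wpM2l//; apply: ler_wiXn2l => //; [exact: ltW|rewrite leq_add2l].
have g2 : `|N%:R * s x ^+ N.-1 * partial a s x * (Q x - b x)| <=
    N%:R * L * `|C| * `|s x| ^+ (N + K).
  have h1 : `|Q x - b x| <= C * `|s x| ^+ K' by near: x.
  have h2 : `|partial a s x| <= L by near: x.
  have h3 : `|Q x - b x| <= `|C| * `|s x| ^+ K'.
    by apply: (le_trans h1); rewrite ler_wpM2r ?exprn_ge0// ler_norm.
  rewrite !normrM normr_nat normrX.
  apply: (@le_trans _ _ (N%:R * `|s x| ^+ N.-1 * L * (`|C| * `|s x| ^+ K'))).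
    apply: ler_pM => //.
    by apply: ler_pM => //; rewrite mulr_ge0// exprn_ge0.
  rewrite (_ : N%:R * _ * L * _ = N%:R * L * `|C| * (`|s x| ^+ N.-1 * `|s x| ^+ K')); last by ring.
  rewrite -exprD; apply: ler_wpM2l; first by rewrite !mulr_ge0// ltW.
  apply: ler_wiXn2l => //; first exact: ltW.
  by rewrite /K'; clear; lia.
rewrite -(ler_pM2l (_ : 0 < `|s x| ^+ N)) ?exprn_gt0// -{1}normrX -normrM.
have -> : s x ^+ N * (partial a Q x - partial a b x) =
   partial a g x - N%:R * s x ^+ N.-1 * partial a s x * (Q x - b x) by rewrite E1; ring.
apply: le_trans (ler_normB _ _) _; rewrite mulrCA -exprD mulrDl; exact: lerD.
Unshelve. all: by end_near. Qed.

Lemma almost_smooth_quotient U s f : open U -> smooth_on U s -> smooth_on U f ->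
  (forall x, U x -> s x = 0 -> exists a, partial a s x != 0) ->
  (forall x, U x -> s x = 0 -> f x = 0) ->
  almost_smooth U s (quotient s f).
Proof.
move=> oU ss sf ds fs; split.
  exists 1%N; apply: (smooth_on_ext oU _ sf) => x; rewrite inE => Ux /=.
  rewrite expr1 /quotient; have [sx|sx] := eqVneq (s x) 0.
    by rewrite sx mul0r fs.
  by rewrite mulrC divfK.
move=> p Up sp K.
(* The order [K + 2] is at least two, as [flat_partial] requires at the zeros of [s] near [p]; there
   it identifies the l'Hopital ratio with [b]. *)
have [W [b [C [oW Wp WU sb hC]]]] := division_approx K.+1 oU Up ss sf sp (ds p Up sp) fs.
exists W, b, `|C|; split => //.
have : {for p, continuous s} by exact: smooth_continuous ss Up.
move=> /cvgrPdist_lt /(_ 1 ltr01); rewrite sp => cs.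
have hC2 : \forall x \near p, \forall y \near x, `|f y - s y * b y| <= `|C| * `|s y| ^+ 2.
  apply: near_join_nbhs; near=> x.
  have sx : `|s x| < 1 by rewrite -normrN -sub0r; near: x.
  apply: (@le_trans _ _ (C * `|s x| ^+ K.+2)); first by near: x.
  apply: (@le_trans _ _ (`|C| * `|s x| ^+ K.+2)).
    by rewrite ler_wpM2r ?exprn_ge0// ler_norm.
  by rewrite ler_wpM2l//; apply: ler_wiXn2l => //; exact: ltW.
near=> x.
have Wx : W x by near: x; exact: open_near.
have Ux := WU _ Wx.
have sx1 : `|s x| < 1 by rewrite -normrN -sub0r; near: x.
have dsx := smooth_on_diff ss Ux.
have dfx := smooth_on_diff sf Ux.
have dbx := smooth_on_diff sb Wx.
rewrite /quotient; have [sx|sx] := eqVneq (s x) 0.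
  have [|_ hf] := @flat_partial s (fun x => f x - s x * b x) x `|C| sx dsx.
    by near: x; exact: hC2.
  case: pickP => [a sa|no]; last by have [a] := ds x Ux sx; rewrite no.
  have := hf a; rewrite partialB//; last exact: differentiableM.
  rewrite partialM// sx mul0r addr0 => /eqP; rewrite subr_eq0 => /eqP ->.
  by rewrite mulrAC divff// mul1r subrr normr0 mulr_ge0// exprn_ge0.
have sx0 : 0 < `|s x| by rewrite normr_gt0.
rewrite -(ler_pM2l sx0) -normrM mulrBr mulrCA divff// mulr1 mulrCA -exprS.
apply: (@le_trans _ _ (C * `|s x| ^+ K.+2)); first by near: x.
apply: (@le_trans _ _ (`|C| * `|s x| ^+ K.+2)).
  by rewrite ler_wpM2r ?exprn_ge0// ler_norm.
by rewrite ler_wpM2l//; apply: ler_wiXn2l => //; exact: ltW.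
Unshelve. all: by end_near. Qed.

Lemma smooth_quotient U s f : open U -> smooth_on U s -> smooth_on U f ->
  (forall x, U x -> s x = 0 -> exists a, partial a s x != 0) ->
  (forall x, U x -> s x = 0 -> f x = 0) ->
  smooth_on U (quotient s f) /\ forall x, U x -> f x = s x * quotient s f x.
Proof.
move=> oU ss sf ds fs; split.
  apply: (@smooth_class R n U (almost_smooth U s)) => //.
  - by move=> g hg u Uu; exact: almost_smooth_diff hg u Uu.
  - by move=> g a hg; exists (partial a g) => //; exact: almost_smooth_partial.
  - exact: almost_smooth_quotient.
move=> x Ux; rewrite /quotient; have [sx|sx] := eqVneq (s x) 0.
  by rewrite sx mul0r fs.
by rewrite mulrC divfK.
Qed.

(** Off the zero set one divides; on it the derivative of [s h = 0] in a transverse direction reads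
    [(partial a s) h = 0]. *)
Lemma smooth_cancel U s (h : V -> R) : open U -> smooth_on U s -> smooth_on U h ->
  (forall x, U x -> s x = 0 -> exists a, partial a s x != 0) ->
  (forall x, U x -> s x * h x = 0) -> forall x, U x -> h x = 0.
Proof.
move=> oU ss sh ds E x Ux; have [sx|sx] := eqVneq (s x) 0; last first.
  by have /eqP := E x Ux; rewrite mulf_eq0 (negbTE sx) => /eqP.
have [a sa] := ds x Ux sx.
have H : {in U, (fun x => s x * h x) =1 fun=> 0} by move=> y; rewrite inE => /E.
have := partial_ext a oU H Ux.
rewrite partial_cst partialM; [|exact: smooth_on_diff ss Ux|exact: smooth_on_diff sh Ux].
by rewrite sx mul0r addr0 => /eqP; rewrite mulf_eq0 (negbTE sa) => /eqP.
Qed.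

End SmoothQuotient.

(** * Smooth functions on a manifold *)

Section ManifoldCalculus.
Variables (R : realType) (n : nat) (M : manifold R n).
Notation V := 'rV[R]_n.+1.
Implicit Types (i j : chart M) (p q : M) (F G : M -> R) (a b c : 'I_n.+1).

Lemma mfd_hausdorff : hausdorff_space M. Proof. by case: M. Qed.
Lemma mfd_second_countable : @second_countable M. Proof. by case: M. Qed.
Lemma mfd_cover p : exists i, dom i p. Proof. by move: p; case: M. Qed.
Lemma dom_open i : open (dom i). Proof. by move: i; case: M. Qed.
Lemma range_open i : open (coord i @` dom i). Proof. by move: i; case: M. Qed.
Lemma coordK i p : dom i p -> param i (coord i p) = p.
Proof. by move: i p; case: M => /= ? ? ? ? ? _ _ _ _ _ H _ _ _ i p /mem_set; exact: H. Qed.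
Lemma coord_continuous i p : dom i p -> {for p, continuous (coord i)}.
Proof.
move=> ip.
have : {within dom i, continuous (coord i)} by move: i {ip}; case: M.
by rewrite continuous_open_subspace; [apply; exact: mem_set|exact: dom_open].
Qed.
Lemma param_continuous i u : (coord i @` dom i) u -> {for u, continuous (param i)}.
Proof.
move=> iu.
have : {within coord i @` dom i, continuous (param i)} by move: i {iu}; case: M.
by rewrite continuous_open_subspace; [apply; exact: mem_set|exact: range_open].
Qed.
Lemma transition_smooth i j a : smooth_on (coord i @` (dom i `&` dom j))
        (fun u => coord j (param i u) 0 a).
Proof. by move: i j a; case: M. Qed.

Lemma image_coordP i (W : set M) u : (coord i @` (W `&` dom i)) u ->
  [/\ W (param i u), dom i (param i u) & coord i (param i u) = u].
Proof. by move=> [p [Wp ip] <-]; rewrite coordK. Qed.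

Lemma image_coord_open i (W : set M) : open W -> open (coord i @` (W `&` dom i)).
Proof.
move=> oW; rewrite openE => _ [p [Wp ip] <-]; rewrite /interior.
have iu : (coord i @` dom i) (coord i p) by exists p.
have H : nbhs p (W `&` dom i).
  by apply: open_nbhs_nbhs; split => //; apply: openI => //; exact: dom_open.
have cp : param i @ coord i p --> param i (coord i p) := param_continuous iu.
rewrite coordK// in cp; have H' := cp _ H.
have H2 : nbhs (coord i p) (coord i @` dom i).
  by apply: open_nbhs_nbhs; split => //; exact: range_open.
near=> u.
have [q iq qu] : (coord i @` dom i) u by near: u.
have [Wu iu'] : (W `&` dom i) (param i u) by near: u.
by exists q => //; split => //; move: Wu; rewrite -qu coordK.
Unshelve. all: by end_near. Qed.

Lemma preimage_coord_open i (O : set V) : open O ->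
  open (dom i `&` [set p | O (coord i p)]).
Proof.
move=> oO; rewrite openE => p [ip Op]; rewrite /interior.
have := coord_continuous ip => /(_ _ (open_nbhs_nbhs (conj oO Op))) H.
have H2 : nbhs p (dom i) by apply: open_nbhs_nbhs; split => //; exact: dom_open.
by apply: filterI.
Qed.

(** Smoothness at a point read in one chart, on some coordinate neighbourhood. Unlike [smooth_in] it
    is assembled from hypotheses at the point alone, with a neighbourhood that may shrink at each
    operation. *)
Definition smooth_near i p F := dom i p /\
  exists O : set V, [/\ open O, O (coord i p) & smooth_on O (F \o param i)].

Lemma smooth_near_dom i p F : smooth_near i p F -> dom i p.
Proof. by case. Qed.

Lemma smooth_inP i (W : set M) F : open W ->
  smooth_in i W F <-> forall p, W p -> dom i p -> smooth_near i p F.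
Proof.
move=> oW; split=> [sF p Wp ip|H].
  split => //; exists (coord i @` (W `&` dom i)); split => //; last by exists p.
  exact: image_coord_open.
apply: smooth_on_local => _ [p [Wp ip] <-].
have [_ [ O [oO Op sO]]] := H p Wp ip; by exists O.
Qed.

Lemma smooth_near_diff i p F : smooth_near i p F ->
  differentiable (F \o param i) (coord i p).
Proof. by move=> [_ [ O [oO Op sO]]]; exact: smooth_on_diff sO Op. Qed.

Lemma smooth_near_ext i p F G (W : set M) : open W -> W p ->
  (forall q, W q -> dom i q -> F q = G q) -> smooth_near i p F -> smooth_near i p G.
Proof.
move=> oW Wp FG [ip [ O [oO Op sF]]]; split => //.
pose O' := O `&` coord i @` (W `&` dom i).
have oO' : open O' by apply: openI => //; exact: image_coord_open.
exists O'; split => //; first by split => //; exists p.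
have sF' : smooth_on O' (F \o param i) by apply: smooth_on_sub sF => x [].
apply: (smooth_on_ext oO' _ sF') => u; rewrite inE => -[Ou /image_coordP[Wu iu _]].
exact: FG.
Qed.

Lemma pd_ext i p a F G (W : set M) : open W -> W p -> dom i p ->
  (forall q, W q -> dom i q -> F q = G q) -> pd i a F p = pd i a G p.
Proof.
move=> oW Wp ip FG; apply: (partial_ext (U := coord i @` (W `&` dom i))).
- exact: image_coord_open.
- by move=> u; rewrite inE => /image_coordP[Wu iu _]; exact: FG.
- by exists p.
Qed.

Lemma smooth_near_cst i p k : dom i p -> smooth_near i p (fun=> k).
Proof.
move=> ip; split => //; exists setT; split => //; first exact: openT.
exact/smooth_on_cst/openT.
Qed.

Lemma smooth_near2 (op : (V -> R) -> (V -> R) -> V -> R) (opM : (M -> R) -> (M -> R) -> M -> R) i p F G :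
  (forall U f g, open U -> smooth_on U f -> smooth_on U g -> smooth_on U (op f g)) ->
  opM F G \o param i = op (F \o param i) (G \o param i) ->
  smooth_near i p F -> smooth_near i p G -> smooth_near i p (opM F G).
Proof.
move=> H E [ip [ O [oO Op sF]]] [_ [ O' [oO' Op' sG]]]; split => //.
have oOO : open (O `&` O') by exact: openI.
exists (O `&` O'); split => //; rewrite E; apply: H => //.
- by apply: smooth_on_sub sF => x [].
- by apply: smooth_on_sub sG => x [].
Qed.

Lemma smooth_nearD i p F G : smooth_near i p F -> smooth_near i p G ->
  smooth_near i p (fun x => F x + G x).
Proof. exact: (@smooth_near2 (fun f g x => f x + g x) (fun f g x => f x + g x) _ _ _ _ (@smooth_onD _ _)). Qed.

Lemma smooth_nearM i p F G : smooth_near i p F -> smooth_near i p G ->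
  smooth_near i p (fun x => F x * G x).
Proof. exact: (@smooth_near2 (fun f g x => f x * g x) (fun f g x => f x * g x) _ _ _ _ (@smooth_onM _ _)). Qed.

Lemma smooth_nearB i p F G : smooth_near i p F -> smooth_near i p G ->
  smooth_near i p (fun x => F x - G x).
Proof. exact: (@smooth_near2 (fun f g x => f x - g x) (fun f g x => f x - g x) _ _ _ _ (@smooth_onB _ _)). Qed.

Lemma smooth_nearN i p F : smooth_near i p F -> smooth_near i p (fun x => - F x).
Proof.
move=> [ip [ O [oO Op sF]]]; split => //; exists O; split => //; exact: smooth_onN.
Qed.

Lemma smooth_nearX i p F k : smooth_near i p F -> smooth_near i p (fun x => F x ^+ k).
Proof.
by move=> [ip [ O [oO Op sF]]]; split => //; exists O; split => //; exact: smooth_onX.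
Qed.

Lemma smooth_near_sum i p (I : Type) (r : seq I) (P : pred I) (F : I -> M -> R) :
  dom i p -> (forall k, smooth_near i p (F k)) ->
  smooth_near i p (fun x => \sum_(k <- r | P k) F k x).
Proof.
move=> ip sF; elim: r => [|k r IH].
  apply: (smooth_near_ext openT _ _ (smooth_near_cst 0 ip)) => // q _ _.
  by rewrite big_nil.
case: (boolP (P k)) => Pk.
  apply: (smooth_near_ext openT _ _ (smooth_nearD (sF k) IH)) => // q _ _.
  by rewrite big_cons Pk.
apply: (smooth_near_ext openT _ _ IH) => // q _ _.
by rewrite big_cons (negbTE Pk).
Qed.

Lemma smooth_near_prod i p (I : Type) (r : seq I) (P : pred I) (F : I -> M -> R) :
  dom i p -> (forall k, smooth_near i p (F k)) ->
  smooth_near i p (fun x => \prod_(k <- r | P k) F k x).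
Proof.
move=> ip sF; elim: r => [|k r IH].
  apply: (smooth_near_ext openT _ _ (smooth_near_cst 1 ip)) => // q _ _.
  by rewrite big_nil.
case: (boolP (P k)) => Pk.
  apply: (smooth_near_ext openT _ _ (smooth_nearM (sF k) IH)) => // q _ _.
  by rewrite big_cons Pk.
apply: (smooth_near_ext openT _ _ IH) => // q _ _.
by rewrite big_cons (negbTE Pk).
Qed.

Lemma smooth_near_open i p F (P : R -> Prop) : smooth_near i p F ->
  (forall (U : set V) g, open U -> smooth_on U g -> open (U `&` [set x | P (g x)])) ->
  P (F p) -> exists O : set V, [/\ open O, O (coord i p), smooth_on O (F \o param i) &
    forall u, O u -> P (F (param i u))].
Proof.
move=> [ip [ O [oO Op sF]]] H PF.
exists (O `&` [set x | P ((F \o param i) x)]); split => //.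
- exact: H.
- by split => //=; rewrite coordK.
- by apply: smooth_on_sub sF => x [].
- by move=> u [].
Qed.

Lemma smooth_nearV i p F : smooth_near i p F -> F p != 0 ->
  smooth_near i p (fun x => (F x)^-1).
Proof.
move=> sF Fp; have ip := smooth_near_dom sF.
have [ O [oO Op sO FO]] := smooth_near_open (P := fun x => x != 0) sF (@open_nonzero _ _) Fp.
split => //; exists O; split => //.
exact: (smooth_onV oO FO sO).
Qed.

Lemma smooth_near_powR i p F (w : R) : smooth_near i p F -> (forall x, 0 < F x) ->
  smooth_near i p (fun x => F x `^ w).
Proof.
move=> [ip [ O [oO Op sF]]] F0; split => //; exists O; split => //.
by apply: (smooth_on_powR w oO _ sF) => u _ /=; exact: F0.
Qed.

Lemma smooth_near_pd i p a F : smooth_near i p F -> smooth_near i p (pd i a F).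
Proof.
move=> [ip [ O [oO Op sF]]]; split => //.
pose O' := O `&` coord i @` dom i.
have oO' : open O' by apply: openI => //; exact: range_open.
have ssF : smooth_on O' (partial a (F \o param i)).
  by apply: smooth_on_partial; apply: smooth_on_sub sF => x [].
exists O'; split => //.
apply: (smooth_on_ext oO' _ ssF) => u; rewrite inE => -[Ou [q iq qu]] /=.
by rewrite /pd -qu coordK.
Qed.

Lemma pd_cst i a k p : pd i a (fun=> k) p = 0.
Proof. exact: partial_cst. Qed.

Lemma pdD i a F G p : smooth_near i p F -> smooth_near i p G ->
  pd i a (fun x => F x + G x) p = pd i a F p + pd i a G p.
Proof. by move=> /smooth_near_diff dF /smooth_near_diff dG; exact: (partialD a dF dG). Qed.

Lemma pdM i a F G p : smooth_near i p F -> smooth_near i p G ->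
  pd i a (fun x => F x * G x) p = pd i a F p * G p + F p * pd i a G p.
Proof.
move=> sF sG; have ip := smooth_near_dom sF.
move/smooth_near_diff: sF => dF; move/smooth_near_diff: sG => dG.
by rewrite /pd (partialM a dF dG) /= coordK.
Qed.

Lemma pdB i a F G p : smooth_near i p F -> smooth_near i p G ->
  pd i a (fun x => F x - G x) p = pd i a F p - pd i a G p.
Proof. by move=> /smooth_near_diff dF /smooth_near_diff dG; exact: (partialB a dF dG). Qed.

Lemma pdZ i a k G p : smooth_near i p G ->
  pd i a (fun x => k * G x) p = k * pd i a G p.
Proof.
by move=> sG; rewrite (pdM a (smooth_near_cst k (smooth_near_dom sG)) sG) pd_cst mul0r add0r.
Qed.

Lemma pdN i a F p : smooth_near i p F -> pd i a (fun x => - F x) p = - pd i a F p.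
Proof.
move=> sF; rewrite -[RHS]mulN1r -pdZ//; congr (pd i a _ p); apply/funext => x.
by rewrite mulN1r.
Qed.

Lemma pd_sum i a p (I : Type) (r : seq I) (P : pred I) (F : I -> M -> R) :
  dom i p -> (forall k, smooth_near i p (F k)) ->
  pd i a (fun x => \sum_(k <- r | P k) F k x) p = \sum_(k <- r | P k) pd i a (F k) p.
Proof.
move=> ip sF; elim: r => [|k r IH].
  rewrite big_nil -[RHS](pd_cst i a 0 p); congr (pd i a _ p); apply/funext => x.
  by rewrite big_nil.
rewrite big_cons -IH.
case: (boolP (P k)) => Pk.
  rewrite -pdD//; last exact: smooth_near_sum.
  by congr (pd i a _ p); apply/funext => x; rewrite big_cons Pk.
by congr (pd i a _ p); apply/funext => x; rewrite big_cons (negbTE Pk).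
Qed.

Lemma pdX i a F p k : smooth_near i p F ->
  pd i a (fun x => F x ^+ k) p = k%:R * F p ^+ k.-1 * pd i a F p.
Proof.
move=> sF; have ip := smooth_near_dom sF.
by move/smooth_near_diff: sF => dF; rewrite /pd (partialX a k dF) /= coordK.
Qed.

Lemma pd_powR i a F (w : R) p : smooth_near i p F -> (forall x, 0 < F x) ->
  pd i a (fun x => F x `^ w) p = w * F p `^ (w - 1) * pd i a F p.
Proof.
move=> sF F0; have ip := smooth_near_dom sF.
have dF := smooth_near_diff sF.
have H := @is_derive1_powR R w _ (F0 (param i (coord i p))).
by rewrite /pd (partial_comp1 (f := F \o param i) a dF H) /= coordK.
Qed.

Lemma pdV i a F p : smooth_near i p F -> F p != 0 ->
  pd i a (fun x => (F x)^-1) p = - (F p)^-1 ^+ 2 * pd i a F p.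
Proof.
move=> sF Fp; have sV := smooth_nearV sF Fp; have ip := smooth_near_dom sF.
have := pdM a sF sV.
have -> : pd i a (fun x => F x * (F x)^-1) p = 0.
  have [ O [oO Op sO FO]] := smooth_near_open (P := fun x => x != 0) sF (@open_nonzero _ _) Fp.
  rewrite -(pd_cst i a 1 p).
  have oW := @preimage_coord_open i O oO.
  apply: (pd_ext a oW) => // q [_ Oq] iq.
  by rewrite divff//; have := FO _ Oq; rewrite coordK.
move=> /eqP; rewrite eq_sym addrC addr_eq0 => /eqP H.
by apply: (mulfI Fp); rewrite H; field.
Qed.

Lemma pdC i a b F p : smooth_near i p F -> pd i a (pd i b F) p = pd i b (pd i a F) p.
Proof.
move=> [ip [ O [oO Op sF]]].
have E c d : pd i c (pd i d F) p = partial c (partial d (F \o param i)) (coord i p).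
  apply: (partial_ext (U := coord i @` dom i)); first exact: range_open.
    by move=> u; rewrite inE => -[q iq <-] /=; rewrite /pd coordK.
  by exists p.
by rewrite !E; exact: (partialC a b oO sF Op).
Qed.

Lemma smooth_near_coord i j p c : dom i p -> dom j p ->
  smooth_near i p (fun x => coord j x 0 c).
Proof.
move=> ip jp; split => //; exists (coord i @` (dom i `&` dom j)); split.
- by rewrite setIC; apply: image_coord_open; exact: dom_open.
- by exists p.
- exact: transition_smooth.
Qed.

Lemma smooth_near_chart i j p F : smooth_near i p F -> dom j p -> smooth_near j p F.
Proof.
move=> [ip [ O [oO Op sF]]] jp; split => //.
pose W := dom i `&` [set q | O (coord i q)].
have oW : open W by exact: preimage_coord_open.
pose O' := coord j @` (W `&` dom j).
have oO' : open O' by exact: image_coord_open.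
exists O'; split => //; first by exists p.
have sO' : smooth_on O' ((F \o param i) \o (fun u => coord i (param j u))).
  apply: (smooth_on_comp (W := O)) => //.
    move=> c; apply: (smooth_on_sub _ (@transition_smooth j i c)).
    by move=> _ [q [[iq _] jq] <-]; exists q.
  by move=> _ [_ [q [[iq Oq] jq] <-] <-]; rewrite coordK.
apply: (smooth_on_ext oO' _ sO') => u; rewrite inE => /image_coordP[[iu _] ju _] /=.
by rewrite coordK.
Qed.

Lemma pd_chart i j p F b : smooth_near i p F -> dom j p ->
  pd j b F p = \sum_a jac i j p a b * pd i a F p.
Proof.
move=> sF jp; have ip := smooth_near_dom sF.
pose phi u := coord i (param j u).
have -> : pd j b F p = partial b ((F \o param i) \o phi) (coord j p).
  apply: (partial_ext (U := coord j @` (dom i `&` dom j))).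
  - by apply: image_coord_open; exact: dom_open.
  - by move=> u; rewrite inE => /image_coordP[iu ju _] /=; rewrite /phi coordK.
  - by exists p.
rewrite partial_comp /phi/=; last first.
- by rewrite coordK//; exact: smooth_near_diff.
- by move=> c; exact: (smooth_near_diff (smooth_near_coord c jp ip)).
by apply: eq_bigr => a _; rewrite mulrC coordK.
Qed.

Lemma pd_coord i p a b : dom i p -> pd i b (fun x => coord i x 0 a) p = (a == b)%:R.
Proof.
move=> ip.
have -> : pd i b (fun x => coord i x 0 a) p = partial b (fun u : V => u 0 a) (coord i p).
  apply: (partial_ext (U := coord i @` dom i)); first exact: range_open.
    by move=> u; rewrite inE => -[q iq <-] /=; rewrite coordK.
  by exists p.
exact: partial_coord.
Qed.

End ManifoldCalculus.

(** * Gauge covariance of the tractor derivative *)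

Section TensorAction.
Variables (R : realType) (n m : nat).
Implicit Types (X Y : slot n -> slot n -> R) (Z : 'I_m -> slot n -> slot n -> R)
  (t : tensor R n m) (A B : multi n m) (k l : 'I_m).

Lemma big_slot (I := slot n) (f : slot n -> R) :
  \sum_(A : slot n) f A = f Top + \sum_b f (Mid b) + f Bot.
Proof.
rewrite (bigD1 Top)//= (bigD1 Bot)//= addrA addrAC; congr (_ + _ + _).
rewrite (reindex_onto (@Mid n) (fun A : slot n => if A is Mid b then b else ord0))/=.
  by apply: eq_bigl => b; rewrite eqxx.
by case.
Qed.

Definition slot_mul X Y : slot n -> slot n -> R := fun (C D : slot n) => \sum_(e : slot n) X C e * Y e D.
Definition slot_one : slot n -> slot n -> R := fun (C D : slot n) => (C == D)%:R.

Lemma sum_delta (I : finType) (i : I) (f : I -> R) :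
  \sum_j (i == j)%:R * f j = f i.
Proof.
rewrite (bigD1 i)//= eqxx mul1r big1 ?addr0// => j /negbTE ji.
by rewrite eq_sym ji mul0r.
Qed.

Lemma sum_delta' (I : finType) (i : I) (f : I -> R) :
  \sum_j (j == i)%:R * f j = f i.
Proof. by rewrite -[RHS]sum_delta; apply: eq_bigr => j _; rewrite eq_sym. Qed.

Lemma slot_mul1 X (C D : slot n) : slot_mul slot_one X C D = X C D.
Proof. exact: sum_delta. Qed.

Lemma slot_mulr1 X (C D : slot n) : slot_mul X slot_one C D = X C D.
Proof.
rewrite /slot_mul -[RHS](sum_delta' D (X C)).
by apply: eq_bigr => e _; rewrite mulrC.
Qed.

(** A separate matrix for each index. Frame changes use the same matrix everywhere, while a
    connection form acts at one index and trivially at the others; allowing families puts both under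
    a single composition rule. *)
Definition fam_act Z t : tensor R n m :=
  fun A => \sum_(B : multi n m) (\prod_k Z k (A k) (B k)) * t B.

Definition index_act X k t : tensor R n m :=
  fun A => \sum_(C : slot n) X (A k) C * t (subst_index A k C).

Lemma fam_act_ext Z Z' t A : (forall k (C D : slot n), Z k C D = Z' k C D) ->
  fam_act Z t A = fam_act Z' t A.
Proof.
move=> H; apply: eq_bigr => B _; congr (_ * _); apply: eq_bigr => k _; exact: H.
Qed.

Lemma fam_act_comp Z Z' t A :
  fam_act Z (fam_act Z' t) A = fam_act (fun k => slot_mul (Z k) (Z' k)) t A.
Proof.
rewrite /fam_act.
under eq_bigr => B _ do rewrite mulr_sumr.
rewrite exchange_big /=; apply: eq_bigr => C _.
under eq_bigr => B _ do rewrite mulrA -big_split/=.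
rewrite -mulr_suml; congr (_ * _).
exact/esym/(bigA_distr_bigA (fun k c => Z k (A k) c * Z' k c (C k))).
Qed.

Definition at_index k X X' : 'I_m -> slot n -> slot n -> R :=
  fun l => if l == k then X else X'.

Lemma index_actE X k t A : index_act X k t A = fam_act (at_index k X slot_one) t A.
Proof.
rewrite /index_act /fam_act.
rewrite (partition_big (fun B : multi n m => B k) predT)//=.
apply: eq_bigr => C _.
rewrite (bigD1 (subst_index A k C))/=; last by rewrite ffunE eqxx.
rewrite (bigD1 k)//= /at_index eqxx ffunE eqxx big1; last first.
  by move=> l /negbTE lk; rewrite lk ffunE lk /slot_one eqxx.
rewrite mulr1 [X in _ + X]big1 ?addr0// => B /andP[/eqP Bk nB].
have [l nl] : exists l, B l != subst_index A k C l.
  apply/existsP; apply: contraNT nB; rewrite negb_exists => /forallP H.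
  by apply/eqP/ffunP => l; apply/eqP; have := H l; rewrite negbK.
rewrite (bigD1 l)//= /at_index; move: nl; rewrite ffunE.
case: (l =P k) => [->|_]; first by rewrite Bk eqxx.
by rewrite /slot_one eq_sym => /negbTE ->; rewrite !mul0r.
Qed.

Lemma fam_index X Y k t A :
  fam_act (fun=> X) (index_act Y k t) A = fam_act (at_index k (slot_mul X Y) X) t A.
Proof.
have -> : fam_act (fun=> X) (index_act Y k t) A = fam_act (fun=> X) (fam_act (at_index k Y slot_one) t) A.
  by apply: eq_bigr => B _; rewrite index_actE.
rewrite fam_act_comp; apply: fam_act_ext => l C B.
by rewrite /at_index; case: ifP => // _; rewrite slot_mulr1.
Qed.

Lemma index_fam X Y k t A :
  index_act Y k (fam_act (fun=> X) t) A = fam_act (at_index k (slot_mul Y X) X) t A.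
Proof.
rewrite index_actE fam_act_comp; apply: fam_act_ext => l C B.
by rewrite /at_index; case: ifP => // _; rewrite slot_mul1.
Qed.

Lemma prod_at_index k X X' A B : \prod_l at_index k X X' l (A l) (B l) =
  X (A k) (B k) * \prod_(l | l != k) X' (A l) (B l).
Proof.
rewrite (bigD1 k)//= /at_index eqxx; congr (_ * _).
by apply: eq_bigr => l /negbTE ->.
Qed.

Lemma fam_at_indexD k X Y X' t A :
  fam_act (at_index k (fun C D : slot n => X C D + Y C D) X') t A =
  fam_act (at_index k X X') t A + fam_act (at_index k Y X') t A.
Proof.
rewrite /fam_act -big_split/=; apply: eq_bigr => B _.
by rewrite !prod_at_index !mulrDl.
Qed.

Lemma fam_at_index_sum (I : finType) (c : I -> R) (Xs : I -> slot n -> slot n -> R) k X' t A :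
  fam_act (at_index k (fun C D : slot n => \sum_i c i * Xs i C D) X') t A =
  \sum_i c i * fam_act (at_index k (Xs i) X') t A.
Proof.
rewrite /fam_act.
under [RHS]eq_bigr => i _ do rewrite mulr_sumr.
rewrite exchange_big /=; apply: eq_bigr => B _.
rewrite prod_at_index !mulr_suml; apply: eq_bigr => i _.
by rewrite prod_at_index !mulrA.
Qed.

Lemma fam_actD Z t t' A : fam_act Z (fun B => t B + t' B) A = fam_act Z t A + fam_act Z t' A.
Proof. by rewrite /fam_act -big_split/=; apply: eq_bigr => B _; rewrite mulrDr. Qed.

Lemma fam_actZ Z (c : R) t A : fam_act Z (fun B => c * t B) A = c * fam_act Z t A.
Proof. by rewrite /fam_act mulr_sumr; apply: eq_bigr => B _; rewrite mulrCA. Qed.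

Lemma fam_act_sum (I : finType) Z (ts : I -> tensor R n m) A :
  fam_act Z (fun B => \sum_i ts i B) A = \sum_i fam_act Z (ts i) A.
Proof.
rewrite /fam_act [RHS]exchange_big/=; apply: eq_bigr => B _.
by rewrite mulr_sumr.
Qed.

Lemma fam_act_eq Z t t' A : (forall B, t B = t' B) -> fam_act Z t A = fam_act Z t' A.
Proof. by move=> H; apply: eq_bigr => B _; rewrite H. Qed.

End TensorAction.

Section GaugeChange.
Variables (R : realType) (n : nat) (M : manifold R n) (m : nat).
Implicit Types (i j : chart M) (p q : M) (F G : M -> tensor R n m).

Lemma pd_prod i a p (F : 'I_m -> M -> R) : dom i p -> (forall k, smooth_near i p (F k)) ->
  pd i a (fun x => \prod_k F k x) p =
  \sum_k pd i a (F k) p * \prod_(l | l != k) F l p.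
Proof.
move=> ip sF.
suff H (r : seq 'I_m) : uniq r -> pd i a (fun x => \prod_(k <- r) F k x) p =
    \sum_(k <- r) pd i a (F k) p * \prod_(l <- r | l != k) F l p.
  by rewrite H//; rewrite /index_enum -enumT enum_uniq.
elim: r => [_|k r IH] /=.
  rewrite big_nil -[RHS](pd_cst i a 1 p); congr (pd i a _ p); apply/funext => x.
  by rewrite big_nil.
move=> /andP[kr ur]; rewrite big_cons big_cons eqxx/=.
have -> : (fun x => \prod_(l <- k :: r) F l x) = (fun x => F k x * \prod_(l <- r) F l x).
  by apply/funext => x; rewrite big_cons.
rewrite pdM//; last exact: smooth_near_prod.
congr (_ + _).
  congr (_ * _); rewrite big_seq [RHS]big_seq_cond; apply: eq_bigl => l.
  by case: eqP => [->|]; rewrite ?(negbTE kr) ?andbT.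
rewrite IH// mulr_sumr big_seq [RHS]big_seq; apply: eq_bigr => l lr.
rewrite big_cons ifT; last by apply: contraNneq kr => ->.
by rewrite mulrCA.
Qed.

Lemma smooth_tens_act i p (T : M -> slot n -> slot n -> R) F A : dom i p ->
  (forall C B, smooth_near i p (fun x => T x C B)) ->
  (forall B, smooth_near i p (fun x => F x B)) ->
  smooth_near i p (fun x => tens_act (T x) (F x) A).
Proof.
move=> ip sT sF; apply: smooth_near_sum => // B; apply: smooth_nearM => //.
exact: smooth_near_prod.
Qed.

Lemma nablaE g i a F p A : nabla g i a F p A =
  pd i a (fun x => F x A) p + \sum_k index_act (tractor_form g i p a) k (F p) A.
Proof. by []. Qed.

(** The law assumed for the matrices [T] concerns a single index; the product rule spreads it over
    all indices, because differentiating [tens_act] differentiates one factor at a time. The factor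
    [lam], with logarithmic derivative [v], accounts for weights, and [E] for a change of coordinate
    directions, so that changes of scale and of chart are both instances. *)
Lemma nabla_gauge g gh i j p b (T : M -> slot n -> slot n -> R)
    (lam : M -> R) (v : R) (E : 'I_n.+1 -> R) F A :
  dom i p -> dom j p ->
  (forall C B, smooth_near j p (fun x => T x C B)) ->
  (forall B, smooth_near i p (fun x => F x B)) -> smooth_near j p lam ->
  (forall G : M -> R, smooth_near i p G -> pd j b G p = \sum_a E a * pd i a G p) ->
  (forall C B, pd j b (fun x => T x C B) p + slot_mul (tractor_form gh j p b) (T p) C B =
     \sum_a E a * slot_mul (T p) (tractor_form g i p a) C B) ->
  pd j b lam p = lam p * v ->
  nabla gh j b (fun x B => lam x * tens_act (T x) (F x) B) p A =
  lam p * tens_act (T p)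
    (fun B => \sum_a E a * nabla g i a F p B + v * F p B) A.
Proof.
move=> ip jp sT sF slam hE law hlam.
have sFj B : smooth_near j p (fun x => F x B) by exact: smooth_near_chart (sF B) jp.
have sTF B : smooth_near j p (fun x => tens_act (T x) (F x) B) by exact: smooth_tens_act.
rewrite nablaE pdM// hlam.
have -> : \sum_k index_act (tractor_form gh j p b) k
    (fun B => lam p * tens_act (T p) (F p) B) A = lam p *
    \sum_k fam_act (at_index k (slot_mul (tractor_form gh j p b) (T p)) (T p)) (F p) A.
  rewrite mulr_sumr; apply: eq_bigr => k _.
  by rewrite index_actE fam_actZ -index_actE index_fam.
have -> : pd j b (fun x => tens_act (T x) (F x) A) p =
    \sum_k fam_act (at_index k (fun C B => pd j b (fun x => T x C B) p) (T p)) (F p) A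
    + fam_act (fun=> T p) (fun B => \sum_a E a * pd i a (fun x => F x B) p) A.
  rewrite /tens_act pd_sum//; last first.
    by move=> B; apply: smooth_nearM => //; exact: smooth_near_prod.
  rewrite exchange_big /= -big_split/=; apply: eq_bigr => B _.
  rewrite pdM//; last exact: smooth_near_prod.
  have Ep := @pd_prod j b p (fun k x => T x (A k) (B k)) jp (fun k => sT _ _).
  cbv beta in Ep; congr (_ + _); last by rewrite hE.
  rewrite Ep mulr_suml; apply: eq_bigr => k _.
  by rewrite prod_at_index.
have -> : tens_act (T p) (fun B => \sum_a E a * nabla g i a F p B + v * F p B) A =
   fam_act (fun=> T p) (fun B => \sum_a E a * pd i a (fun x => F x B) p) A +
   \sum_k \sum_a E a * fam_act (at_index k (slot_mul (T p) (tractor_form g i p a)) (T p)) (F p) A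
   + v * tens_act (T p) (F p) A.
  rewrite -[LHS]/(fam_act (fun=> T p) _ A) fam_actD fam_actZ; congr (_ + _).
  rewrite exchange_big/= !fam_act_sum -big_split/=; apply: eq_bigr => a _.
  rewrite !fam_actZ -mulr_sumr -mulrDr; congr (_ * _).
  under fam_act_eq => B do rewrite nablaE.
  rewrite fam_actD; congr (_ + _).
  by rewrite fam_act_sum; apply: eq_bigr => k _; rewrite fam_index.
have -> : \sum_k \sum_a E a * fam_act (at_index k (slot_mul (T p) (tractor_form g i p a)) (T p)) (F p) A
  = \sum_k fam_act (at_index k (fun C B => pd j b (fun x => T x C B) p) (T p)) (F p) A +
    \sum_k fam_act (at_index k (slot_mul (tractor_form gh j p b) (T p)) (T p)) (F p) A.
  rewrite -big_split/=; apply: eq_bigr => k _.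
  rewrite -fam_at_index_sum -fam_at_indexD; apply: fam_act_ext => l C B.
  by rewrite /at_index; case: ifP.
ring.
Qed.

End GaugeChange.

(** * Conformal change of the Schouten tensor *)

Section ConformalAlgebra.
Variables (R : realFieldType) (n : nat).
Notation I := 'I_n.+1.
Notation d := (n.+1%:R : R).
Variables (g G : I -> I -> R) (U : I -> R).
Hypothesis g_sym : forall a b, g a b = g b a.
Hypothesis G_sym : forall a b, G a b = G b a.
Hypothesis gG : forall a b, \sum_e g a e * G e b = (a == b)%:R.

Definition raised c := \sum_e G c e * U e.
Definition sqnorm := \sum_a \sum_b G a b * U a * U b.
(** The tensor by which the Levi-Civita symbols of [Omega^2 g] exceed those of [g], with [U] in the
    role of [d log Omega]. *)
Definition conf_diff c a b := (c == a)%:R * U b + (c == b)%:R * U a - raised c * g a b.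

Lemma sum_dl (i : I) (f : I -> R) : \sum_j (i == j)%:R * f j = f i.
Proof.
rewrite (bigD1 i)//= eqxx mul1r big1 ?addr0// => j /negbTE ji.
by rewrite eq_sym ji mul0r.
Qed.

Lemma sum_dr (i : I) (f : I -> R) : \sum_j (j == i)%:R * f j = f i.
Proof. by rewrite -[RHS]sum_dl; apply: eq_bigr => j _; rewrite eq_sym. Qed.

Lemma Gg a b : \sum_e G a e * g e b = (a == b)%:R.
Proof.
rewrite eq_sym -gG; apply: eq_bigr => e _.
by rewrite mulrC G_sym g_sym.
Qed.

Lemma lower_raised b : \sum_e raised e * g e b = U b.
Proof.
rewrite /raised; under eq_bigr => e _ do rewrite mulr_suml.
rewrite exchange_big/= -[RHS](sum_dr b U); apply: eq_bigr => f _.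
by rewrite -Gg mulr_suml; apply: eq_bigr => e _; rewrite [G e f]G_sym mulrAC.
Qed.

Lemma raised_sqnorm : \sum_e raised e * U e = sqnorm.
Proof.
rewrite /raised /sqnorm; apply: eq_bigr => a _; rewrite mulr_suml.
by apply: eq_bigr => b _; rewrite mulrAC.
Qed.

Lemma conf_diff_up (X : I -> R) a b : \sum_e X e * conf_diff e a b =
  X a * U b + X b * U a - (\sum_e X e * raised e) * g a b.
Proof.
rewrite /conf_diff -[X a * _](sum_dr a (fun e => X e * U b)).
rewrite -[X b * _](sum_dr b (fun e => X e * U a)) mulr_suml -sumrN -!big_split/=.
by apply: eq_bigr => e _; ring.
Qed.

Lemma conf_diff_low (Y : I -> I -> R) c : \sum_a \sum_e conf_diff a c e * Y a e =
  \sum_e U e * Y c e + U c * (\sum_a Y a a) - \sum_a \sum_e raised a * g c e * Y a e.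
Proof.
have -> : \sum_e U e * Y c e = \sum_a \sum_e (a == c)%:R * (U e * Y a e).
  rewrite -(sum_dr c (fun a => \sum_e U e * Y a e)); apply: eq_bigr => a _.
  by rewrite mulr_sumr.
have -> : U c * (\sum_a Y a a) = \sum_a \sum_e (a == e)%:R * (U c * Y a e).
  rewrite mulr_sumr; apply: eq_bigr => a _.
  by rewrite (sum_dl a (fun e => U c * Y a e)).
rewrite -sumrN -!big_split/=; apply: eq_bigr => a _.
rewrite -sumrN -!big_split/=; apply: eq_bigr => e _.
by rewrite /conf_diff; ring.
Qed.

Lemma conf_diff_trace e : \sum_a conf_diff a a e = d * U e.
Proof.
rewrite /conf_diff !big_split/= sumrN lower_raised.
under eq_bigr => a _ do rewrite eqxx mul1r.
by rewrite sumr_const card_ord (sum_dr e U) addrK mulr_natl.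
Qed.

Lemma conf_diff_lower c a b : \sum_e g c e * conf_diff e a b = g c a * U b + g c b * U a - U c * g a b.
Proof.
rewrite conf_diff_up; congr (_ - _ * _); rewrite -lower_raised.
by apply: eq_bigr => e _; rewrite mulrC g_sym.
Qed.

Variables (Gam : I -> I -> I -> R) (dg : I -> I -> I -> R)
  (H : I -> I -> R) (dr : I -> I -> R).
(* [dg a b c], [H a b] and [dr a b] are the derivatives in direction [a] of
   [g b c], [U b] and [raised b]. *)
Hypothesis Gam_sym : forall c a b, Gam c a b = Gam c b a.
Hypothesis Gam_met : forall a b c,
  dg a b c = \sum_e Gam e a b * g e c + \sum_e Gam e a c * g e b.
Hypothesis H_sym : forall a b, H a b = H b a.
Hypothesis dr_eq : forall a b, \sum_e (dr a e * g e b + raised e * dg a e b) = H a b.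

(** The covariant derivative of the one-form [U]. *)
Definition hess a b := H a b - \sum_e Gam e a b * U e.
Definition trhess := \sum_a \sum_b G a b * hess a b.

Lemma contract_inv (X : I -> R) c : \sum_b G c b * (\sum_e X e * g e b) = X c.
Proof.
under eq_bigr => b _ do rewrite mulr_sumr.
rewrite exchange_big/= -[RHS](sum_dr c X); apply: eq_bigr => e _.
rewrite [e == c]eq_sym -Gg mulr_suml; apply: eq_bigr => b _.
by rewrite [g e b]g_sym mulrAC -mulrA mulrCA mulrC.
Qed.

Lemma hess_lower a b : hess a b = \sum_e (dr a e + \sum_f Gam e a f * raised f) * g e b.
Proof.
rewrite /hess -dr_eq.
have -> : \sum_e (dr a e * g e b + raised e * dg a e b) =
  \sum_e dr a e * g e b + (\sum_e (\sum_f Gam e a f * raised f) * g e b +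
     \sum_e Gam e a b * U e).
  rewrite big_split/=; congr (_ + _).
  under eq_bigr => e _ do rewrite Gam_met mulrDr.
  rewrite big_split/=; congr (_ + _).
    under eq_bigr => e _ do rewrite mulr_sumr.
    rewrite exchange_big/=; apply: eq_bigr => f _; rewrite mulr_suml.
    by apply: eq_bigr => e _; rewrite mulrA; congr (_ * _); rewrite mulrC.
  under eq_bigr => e _ do rewrite mulr_sumr.
  rewrite exchange_big/=; apply: eq_bigr => f _; rewrite -lower_raised mulr_sumr.
  by apply: eq_bigr => e _; rewrite mulrCA [g f e]g_sym.
rewrite addrA addrK -big_split/=.
by apply: eq_bigr => e _; rewrite mulrDl.
Qed.

(** The divergence of the vector field [raised], computed as a trace of the covariant derivative of
    [U]: by metric compatibility the index may be raised inside the derivative. *)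
Lemma raised_div : \sum_a dr a a + \sum_e (\sum_a Gam a a e) * raised e = trhess.
Proof.
rewrite /trhess.
have E a : \sum_b G a b * hess a b = dr a a + \sum_f Gam a a f * raised f.
  under eq_bigr => b _ do rewrite hess_lower.
  exact: contract_inv.
under [RHS]eq_bigr => a _ do rewrite E.
rewrite big_split/=; congr (_ + _); rewrite exchange_big/=.
by apply: eq_bigr => f _; rewrite mulr_suml.
Qed.

(** Ricci curvature contains first derivatives of the symbols and products of two of them. Here the
    derivatives of the difference tensor are combined with its products with the old symbols into
    covariant derivatives; the products of two difference tensors are left to
    [ricci_conf_quadratic]. *)
Lemma ricci_conf_linear b c :
  \sum_a ((a == b)%:R * H a c + (a == c)%:R * H a b - (dr a a * g b c + raised a * dg a b c))
  - d * H c b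
  + \sum_a \sum_e (Gam a a e * conf_diff e b c + conf_diff a a e * Gam e b c
      - Gam a c e * conf_diff e a b - conf_diff a c e * Gam e a b)
  = - (d - 2) * hess b c - trhess * g b c.
Proof.
have e1 : \sum_a ((a == b)%:R * H a c + (a == c)%:R * H a b - (dr a a * g b c + raised a * dg a b c))
   = H b c + H c b - (\sum_a dr a a) * g b c - \sum_a raised a * dg a b c.
  rewrite big_split/= sumrN !big_split/= (sum_dr b (fun a => H a c)) (sum_dr c (fun a => H a b)).
  by rewrite -mulr_suml opprD !addrA.
have e2 : \sum_a \sum_e Gam a a e * conf_diff e b c =
   (\sum_a Gam a a b) * U c + (\sum_a Gam a a c) * U b - (\sum_e (\sum_a Gam a a e) * raised e) * g b c.
  rewrite exchange_big/= -conf_diff_up; apply: eq_bigr => e _.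
  by rewrite mulr_suml.
have e3 : \sum_a \sum_e conf_diff a a e * Gam e b c = d * \sum_e Gam e b c * U e.
  rewrite exchange_big/= mulr_sumr; apply: eq_bigr => e _.
  by rewrite -mulr_suml conf_diff_trace; ring.
have e4 : \sum_a \sum_e Gam a c e * conf_diff e a b =
    \sum_a (Gam a c a * U b + Gam a c b * U a - (\sum_e Gam a c e * raised e) * g a b).
  by apply: eq_bigr => a _; rewrite conf_diff_up.
have e5 : \sum_a \sum_e conf_diff a c e * Gam e a b =
  \sum_e U e * Gam e c b + U c * (\sum_a Gam a a b) - \sum_a \sum_e raised a * g c e * Gam e a b.
  exact: (conf_diff_low (fun a e => Gam e a b)).
have e6 : \sum_a raised a * dg a b c = \sum_a \sum_e raised a * g c e * Gam e a b
   + \sum_a (\sum_e Gam a c e * raised e) * g a b.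
  under eq_bigr => a _ do rewrite Gam_met mulrDr.
  rewrite big_split/=; congr (_ + _).
    apply: eq_bigr => a _; rewrite mulr_sumr; apply: eq_bigr => e _.
    by rewrite [g e c]g_sym; ring.
  under eq_bigr => a _ do rewrite mulr_sumr.
  rewrite exchange_big/=; apply: eq_bigr => a _; rewrite mulr_suml.
  by apply: eq_bigr => e _; rewrite [Gam a e c]Gam_sym; ring.
have e7 : \sum_a (Gam a c a * U b + Gam a c b * U a - (\sum_e Gam a c e * raised e) * g a b) =
   (\sum_a Gam a a c) * U b + \sum_a Gam a c b * U a - \sum_a (\sum_e Gam a c e * raised e) * g a b.
  rewrite !big_split/= sumrN -mulr_suml; congr (_ * _ + _ + _).
  by apply: eq_bigr => a _; rewrite Gam_sym.
have e8 : \sum_a \sum_e (Gam a a e * conf_diff e b c + conf_diff a a e * Gam e b c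
      - Gam a c e * conf_diff e a b - conf_diff a c e * Gam e a b) =
   \sum_a \sum_e Gam a a e * conf_diff e b c + \sum_a \sum_e conf_diff a a e * Gam e b c
   - \sum_a \sum_e Gam a c e * conf_diff e a b - \sum_a \sum_e conf_diff a c e * Gam e a b.
  rewrite -!sumrN -!big_split/=; apply: eq_bigr => a _.
  by rewrite -!sumrN -!big_split/=.
have e9 : \sum_a Gam a c b * U a = \sum_e Gam e b c * U e.
  by apply: eq_bigr => e _; rewrite Gam_sym.
have e10 : \sum_e U e * Gam e c b = \sum_e Gam e b c * U e.
  by apply: eq_bigr => e _; rewrite Gam_sym mulrC.
rewrite e8 e1 e2 e3 e4 e5 e7 e6 e9 e10 -raised_div /hess (H_sym c b).
move: (\sum_a dr a a) (\sum_a \sum_e _) (\sum_a _ * g a b) (\sum_a Gam a a b)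
  (\sum_a Gam a a c) (\sum_e Gam e b c * U e) (\sum_e _ * raised e) => *.
ring.
Qed.

Lemma ricci_conf_quadratic b c :
  \sum_a \sum_e (conf_diff a a e * conf_diff e b c - conf_diff a c e * conf_diff e a b)
  = (d - 2) * (U b * U c - sqnorm * g b c).
Proof.
have e0 x y : \sum_e U e * conf_diff e x y = 2 * U x * U y - sqnorm * g x y.
  rewrite conf_diff_up -raised_sqnorm; congr (_ - _ * _); first by ring.
  by apply: eq_bigr => e _; rewrite mulrC.
have e1 : \sum_a \sum_e conf_diff a a e * conf_diff e b c = d * (2 * U b * U c - sqnorm * g b c).
  rewrite exchange_big/= -e0 mulr_sumr; apply: eq_bigr => e _.
  by rewrite -mulr_suml conf_diff_trace mulrA.
have e2 : \sum_a \sum_e conf_diff a c e * conf_diff e a b =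
   2 * U c * U b - sqnorm * g c b + U c * (d * U b) - sqnorm * g c b.
  rewrite (conf_diff_low (fun a e => conf_diff e a b)) e0 conf_diff_trace; congr (_ - _).
  under eq_bigr => a _ do under eq_bigr => e _ do rewrite -mulrA.
  under eq_bigr => a _ do rewrite -mulr_sumr conf_diff_lower.
  transitivity (\sum_a (raised a * g a c * U b + raised a * U a * g c b - raised a * g a b * U c)).
    by apply: eq_bigr => a _; rewrite [g c a]g_sym; ring.
  rewrite !big_split/= sumrN -!mulr_suml !lower_raised raised_sqnorm; ring.
under eq_bigr => a _ do rewrite sumrB.
by rewrite sumrB e1 e2 [g c b]g_sym; ring.
Qed.

End ConformalAlgebra.

(** * Levi-Civita connection and curvature of one metric *)

Section SmoothInverse.
Variables (R : realType) (n : nat) (M : manifold R n) (i : chart M) (p : M).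

Lemma smooth_near_det k (X : M -> 'M[R]_k) : dom i p ->
  (forall a b, smooth_near i p (fun x => X x a b)) ->
  smooth_near i p (fun x => \det (X x)).
Proof.
move=> ip sX; apply: smooth_near_sum => // s; apply: smooth_nearM.
  exact: smooth_near_cst.
by apply: smooth_near_prod.
Qed.

Lemma smooth_near_inv k (X : M -> 'M[R]_k) a b :
  (forall a b, smooth_near i p (fun x => X x a b)) -> X p \in unitmx ->
  smooth_near i p (fun x => invmx (X x) a b).
Proof.
move=> sX uX; have ip : dom i p by exact: smooth_near_dom (sX a b).
have sdet : smooth_near i p (fun x => \det (X x)) by exact: smooth_near_det.
have d0 : \det (X p) != 0 by move: uX; rewrite unitmxE unitfE.
have [ O [oO Op sO FO]] := smooth_near_open (P := fun x => x != 0) sdet (@open_nonzero _ _) d0.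
have oW := preimage_coord_open i oO.
have sA : smooth_near i p (fun x => (\det (X x))^-1 * \adj (X x) a b).
  apply: smooth_nearM; first exact: smooth_nearV.
  have -> : (fun x => \adj (X x) a b) = fun x => cofactor (X x) b a.
    by apply/funext => x; rewrite mxE.
  apply: smooth_nearM; first exact: smooth_near_cst.
  apply: smooth_near_det => // c e.
  have -> : (fun x => row' b (col' a (X x)) c e) = fun x => X x (lift b c) (lift a e).
    by apply/funext => x; rewrite !mxE.
  exact: sX.
apply: (smooth_near_ext oW _ _ sA) => // q [iq Oq] _.
rewrite /invmx unitmxE unitfE ifT ?mxE//.
by have := FO _ Oq; rewrite coordK.
Qed.

End SmoothInverse.

Section MetricGeometry.
Variables (R : realType) (n : nat) (M : manifold R n).
Notation I := 'I_n.+1.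
Implicit Types (i : chart M) (p : M) (g : metric_field M).

(** What the calculus in one chart uses of a metric; the signature enters only through
    nondegeneracy. *)
Definition regular_metric g i := forall p, dom i p ->
  [/\ forall a b, smooth_near i p (fun x => g i x a b),
      forall a b, g i p a b = g i p b a & g i p \in unitmx].

Lemma has_signature_regular q (A : 'M[R]_n.+1) : has_signature q A ->
  A^T = A /\ A \in unitmx.
Proof.
move=> [C uC E].
set D := diag_mx _ in E.
have uD : D \in unitmx.
  rewrite unitmxE det_diag unitfE; apply/prodf_neq0 => a _; rewrite mxE.
  by rewrite expf_neq0// oppr_eq0 oner_eq0.
have AE : A = invmx (C^T) *m D *m invmx C.
  by rewrite -E mulmxA mulKmx ?unitmx_tr// mulmxK.
split; last by rewrite AE !unitmx_mul !unitmx_inv unitmx_tr uC uD.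
by rewrite AE !trmx_mul !trmx_inv trmxK tr_diag_mx mulmxA.
Qed.

Lemma is_metric_regular q g i : is_metric q g -> regular_metric g i.
Proof.
move=> [sg hg _] p ip; have [sy un] := has_signature_regular (hg i p ip).
split => //.
- by move=> a b; apply: (iffLR (smooth_inP i _ openT) (sg i a b)).
- by move=> a b; rewrite -[in LHS]sy mxE.
Qed.

Section OneMetric.
Variables (g : metric_field M) (i : chart M).
Hypothesis hg : regular_metric g i.

Lemma metric_smooth p a b : dom i p -> smooth_near i p (fun x => g i x a b).
Proof. by move=> /hg[]. Qed.

Lemma metric_tensor_sym p a b : dom i p -> g i p a b = g i p b a.
Proof. by move=> /hg[]. Qed.

Lemma ginv_smooth p a b : dom i p -> smooth_near i p (fun x => ginv g i x a b).
Proof. by move=> ip; have [sg _ ug] := hg ip; exact: smooth_near_inv. Qed.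

Lemma ginv_sym p a b : dom i p -> ginv g i p a b = ginv g i p b a.
Proof.
move=> ip; have [_ sy _] := hg ip; rewrite /ginv.
suff E : (g i p)^T = g i p by rewrite -[in LHS]E -trmx_inv mxE.
by apply/matrixP => c e; rewrite mxE sy.
Qed.

Lemma metric_ginv p a b : dom i p ->
  \sum_e g i p a e * ginv g i p e b = (a == b)%:R.
Proof.
move=> ip; have [_ _ ug] := hg ip.
by have /matrixP/(_ a b) := mulmxV ug; rewrite !mxE.
Qed.

Lemma christoffel_sym c a b p : dom i p ->
  christoffel g i c a b p = christoffel g i c b a p.
Proof.
move=> ip; rewrite /christoffel; congr (_ * _); apply: eq_bigr => e _; congr (_ * (_ - _)).
  by rewrite addrC.
by apply: (pd_ext e (dom_open i)) => // q _; exact: metric_tensor_sym.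
Qed.

Lemma christoffel_lower a b c p : dom i p ->
  \sum_e g i p c e * christoffel g i e a b p =
  2^-1 * (pd i a (fun x => g i x c b) p + pd i b (fun x => g i x c a) p
     - pd i c (fun x => g i x a b) p).
Proof.
move=> ip; rewrite /christoffel.
under eq_bigr => e _ do rewrite mulrCA.
rewrite -mulr_sumr; congr (_ * _).
under eq_bigr => e _ do rewrite mulr_sumr.
rewrite exchange_big/= -[RHS](sum_dl c (fun f => (pd i a (fun x => g i x f b) p + pd i b (fun x => g i x f a) p
     - pd i f (fun x => g i x a b) p))); apply: eq_bigr => f _.
by rewrite -(@metric_ginv p c f ip) mulr_suml; apply: eq_bigr => e _; rewrite mulrA.
Qed.

Lemma christoffel_metric a b c p : dom i p ->
  pd i a (fun x => g i x b c) p =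
    \sum_e christoffel g i e a b p * g i p e c + \sum_e christoffel g i e a c p * g i p e b.
Proof.
move=> ip.
have E x y z : \sum_e christoffel g i e x y p * g i p e z =
  2^-1 * (pd i x (fun q => g i q z y) p + pd i y (fun q => g i q z x) p
     - pd i z (fun q => g i q x y) p).
  by rewrite -christoffel_lower//; apply: eq_bigr => e _; rewrite mulrC metric_tensor_sym.
have S x y z : pd i x (fun q => g i q y z) p = pd i x (fun q => g i q z y) p.
  by apply: (pd_ext x (dom_open i)) => // q _; exact: metric_tensor_sym.
by rewrite !E (S a c b) (S c b a) (S b c a); field.
Qed.

Lemma christoffel_smooth c a b p : dom i p -> smooth_near i p (christoffel g i c a b).
Proof.
move=> ip; apply: smooth_nearM; first exact: smooth_near_cst.
apply: smooth_near_sum => // e; apply: smooth_nearM; first exact: ginv_smooth.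
by apply: smooth_nearB; [apply: smooth_nearD|]; apply: smooth_near_pd; exact: metric_smooth.
Qed.

Lemma ricci_smooth b c p : dom i p -> smooth_near i p (ricci g i b c).
Proof.
move=> ip; apply: smooth_near_sum => // a.
apply: smooth_nearD; first by apply: smooth_nearB; apply: smooth_near_pd; exact: christoffel_smooth.
apply: smooth_near_sum => // e.
by apply: smooth_nearB; apply: smooth_nearM; exact: christoffel_smooth.
Qed.

Lemma schoutenJ_smooth p : dom i p -> smooth_near i p (schoutenJ g i).
Proof.
move=> ip; apply: smooth_nearM; last exact: smooth_near_cst.
apply: smooth_near_sum => // a; apply: smooth_near_sum => // b.
by apply: smooth_nearM; [exact: ginv_smooth|exact: ricci_smooth].
Qed.

Lemma schouten_smooth a b p : dom i p -> smooth_near i p (schouten g i a b).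
Proof.
move=> ip; apply: smooth_nearM; last exact: smooth_near_cst.
apply: smooth_nearB; first exact: ricci_smooth.
by apply: smooth_nearM; [exact: schoutenJ_smooth|exact: metric_smooth].
Qed.

End OneMetric.

(** Uniqueness of the torsion-free metric connection: the cyclic instances of compatibility
    determine the symbols with lowered index. It spares substitution in the Christoffel formula,
    since rescaled or transported symbols are readily seen to be torsion-free and metric. *)
Lemma christoffel_unique g i p (Y : I -> I -> I -> R) : regular_metric g i -> dom i p ->
  (forall c a b, Y c a b = Y c b a) ->
  (forall a b c, pd i a (fun x => g i x b c) p =
     \sum_e Y e a b * g i p e c + \sum_e Y e a c * g i p e b) ->
  forall c a b, christoffel g i c a b p = Y c a b.
Proof.
move=> hg ip Ys Ym c a b.
have E x y z : \sum_e Y e x y * g i p e z =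
  \sum_e christoffel g i e x y p * g i p e z.
  have -> : \sum_e Y e x y * g i p e z =
    2^-1 * (pd i x (fun q => g i q z y) p + pd i y (fun q => g i q z x) p
     - pd i z (fun q => g i q x y) p).
    rewrite !Ym.
    have S u v w : \sum_e Y e u v * g i p e w = \sum_e Y e v u * g i p e w.
      by apply: eq_bigr => e _; rewrite Ys.
    by rewrite (S x z) (S y z) (S y x); field.
  by rewrite -christoffel_lower//; apply: eq_bigr => e _; rewrite mulrC (metric_tensor_sym hg).
have C (X : I -> R) := @contract_inv _ n (fun x y => g i p x y) (ginv g i p)
  (fun x y => metric_tensor_sym hg x y ip) (fun x y => ginv_sym hg x y ip)
  (fun x y => metric_ginv hg x y ip) X c.
rewrite -(C (fun e => Y e a b)) -(C (fun e => christoffel g i e a b p)).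
by apply: eq_bigr => e _; rewrite E.
Qed.

End MetricGeometry.

(** * Connection and curvature of a rescaled metric *)

Section ConformalChange.
Variables (R : realType) (n : nat) (M : manifold R n) (i : chart M).
Notation I := 'I_n.+1.
Notation d := (n.+1%:R : R).
Implicit Types (p : M) (a b c e : I).
Variables (g gh : metric_field M) (Om : M -> R).
Hypothesis hg : regular_metric g i.
Hypothesis hgh : regular_metric gh i.
Hypothesis sOm : forall p, dom i p -> smooth_near i p Om.
Hypothesis Om_gt0 : forall p, 0 < Om p.
Hypothesis ghE : forall p, dom i p -> gh i p = Om p ^+ 2 *: g i p.

Lemma Om_neq0 p : Om p != 0. Proof. by rewrite gt_eqF. Qed.

Lemma ghE' p a b : dom i p -> gh i p a b = Om p ^+ 2 * g i p a b.
Proof. by move=> ip; rewrite ghE// mxE. Qed.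

Lemma ginv_conf p a b : dom i p -> ginv gh i p a b = (Om p)^-1 ^+ 2 * ginv g i p a b.
Proof.
move=> ip; rewrite /ginv ghE// invmxZ ?mxE ?exprVn//.
by have [_ _ ug] := hg ip; rewrite -ghE//; have [] := hgh ip.
Qed.

Local Notation U := (upsilon Om i).
Local Notation gp p := (fun a b => g i p a b).
Local Notation Gp p := (ginv g i p).
Local Notation Gam p := (fun c a b => christoffel g i c a b p).
Local Notation H p := (fun a b => pd i a (fun q => U q b) p).

Lemma upsilon_smooth p a : dom i p -> smooth_near i p (fun q => U q a).
Proof.
move=> ip; apply: smooth_nearM; first by apply: smooth_nearV; [exact: sOm|exact: Om_neq0].
by apply: smooth_near_pd; exact: sOm.
Qed.

Lemma pd_Om p a : pd i a Om p = Om p * U p a.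
Proof. by rewrite /upsilon mulrA divff ?mul1r// Om_neq0. Qed.

Lemma pd_upsilon_sym p a b : dom i p -> H p a b = H p b a.
Proof.
move=> ip.
have E x y : H p x y = - (Om p)^-1 ^+ 2 * pd i x Om p * pd i y Om p + (Om p)^-1 * pd i x (pd i y Om) p.
  rewrite pdM; [|by apply: smooth_nearV; [exact: sOm|exact: Om_neq0]|by apply: smooth_near_pd; exact: sOm].
  by rewrite pdV//; [exact: sOm|exact: Om_neq0].
by rewrite !E (pdC b a (sOm ip)); ring.
Qed.

Lemma raised_smooth p a : dom i p -> smooth_near i p (fun q => raised (Gp q) (U q) a).
Proof.
move=> ip; apply: smooth_near_sum => // e; apply: smooth_nearM.
  exact: ginv_smooth.
exact: upsilon_smooth.
Qed.

Lemma christoffel_conf p c a b : dom i p ->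
  christoffel gh i c a b p = christoffel g i c a b p + conf_diff (gp p) (Gp p) (U p) c a b.
Proof.
move=> ip; pose Y c a b := christoffel g i c a b p + conf_diff (gp p) (Gp p) (U p) c a b.
have sy x y : g i p x y = g i p y x by exact: (metric_tensor_sym hg x y ip).
have Gsy x y : ginv g i p x y = ginv g i p y x by exact: (ginv_sym hg x y ip).
have gG x y : \sum_e g i p x e * ginv g i p e y = (x == y)%:R by exact: (metric_ginv hg x y ip).
apply: (christoffel_unique (Y := Y) hgh ip) => {a b c}.
  move=> c a b; rewrite /Y (christoffel_sym hg)//; congr (_ + _).
  by rewrite /conf_diff (sy a b); ring.
move=> a b c.
have -> : pd i a (fun x => gh i x b c) p = pd i a (fun x => Om x ^+ 2 * g i x b c) p.
  by apply: (pd_ext a (dom_open i)) => // q _ iq; exact: ghE'.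
have sg := metric_smooth hg b c ip.
rewrite pdM//; last by apply: smooth_nearX; exact: sOm.
rewrite (pdX a 2 (sOm ip)) pd_Om (christoffel_metric hg)// /=.
have E x y z : \sum_e Y e x y * gh i p e z = Om p ^+ 2 * (\sum_e christoffel g i e x y p * g i p e z +
   (g i p z x * U p y + g i p z y * U p x - U p z * g i p x y)).
  rewrite -(conf_diff_lower (U p) sy Gsy gG z x y).
  rewrite -big_split mulr_sumr/=; apply: eq_bigr => e _.
  by rewrite ghE'// /Y (sy z e); ring.
by rewrite !E (sy c b) (sy c a) (sy b a); ring.
Qed.

Lemma raised_deriv p a b : dom i p ->
  \sum_e (pd i a (fun q => raised (Gp q) (U q) e) p * g i p e b
          + raised (Gp p) (U p) e * pd i a (fun x => g i x e b) p) = H p a b.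
Proof.
move=> ip.
have -> : H p a b = pd i a (fun q => \sum_e raised (Gp q) (U q) e * g i q e b) p.
  apply: (pd_ext a (dom_open i)) => // q _ iq.
  by rewrite (lower_raised (U q) (fun x y => metric_tensor_sym hg x y iq) (fun x y => ginv_sym hg x y iq) (fun x y => metric_ginv hg x y iq)).
rewrite pd_sum//; last first.
  by move=> e; apply: smooth_nearM; [exact: raised_smooth|exact: metric_smooth].
by apply: eq_bigr => e _; rewrite pdM//; [exact: raised_smooth|exact: metric_smooth].
Qed.

Lemma conf_diff_smooth p c a b : dom i p ->
  smooth_near i p (fun q => conf_diff (gp q) (Gp q) (U q) c a b).
Proof.
move=> ip; apply: smooth_nearB; first apply: smooth_nearD.
- by apply: smooth_nearM; [exact: smooth_near_cst|exact: upsilon_smooth].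
- by apply: smooth_nearM; [exact: smooth_near_cst|exact: upsilon_smooth].
- by apply: smooth_nearM; [exact: raised_smooth|exact: metric_smooth].
Qed.

Lemma pd_conf_diff p x c a b : dom i p ->
  pd i x (fun q => conf_diff (gp q) (Gp q) (U q) c a b) p =
  (c == a)%:R * H p x b + (c == b)%:R * H p x a
  - (pd i x (fun q => raised (Gp q) (U q) c) p * g i p a b
     + raised (Gp p) (U p) c * pd i x (fun q => g i q a b) p).
Proof.
move=> ip; have sU e := upsilon_smooth e ip.
have sZ k e : smooth_near i p (fun q => k * U q e).
  by apply: smooth_nearM => //; exact: smooth_near_cst.
have sr := raised_smooth c ip; have sg := metric_smooth hg a b ip.
rewrite pdB; [|by apply: smooth_nearD; exact: sZ|by apply: smooth_nearM].
by rewrite (pdD x (sZ _ _) (sZ _ _)) (pdZ x _ (sU b)) (pdZ x _ (sU a)) (pdM x sr sg).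
Qed.

Lemma pd_christoffel_conf p x c a b : dom i p ->
  pd i x (christoffel gh i c a b) p = pd i x (christoffel g i c a b) p +
  ((c == a)%:R * H p x b + (c == b)%:R * H p x a
  - (pd i x (fun q => raised (Gp q) (U q) c) p * g i p a b
     + raised (Gp p) (U p) c * pd i x (fun q => g i q a b) p)).
Proof.
move=> ip; rewrite -pd_conf_diff//.
rewrite -pdD; [|exact: christoffel_smooth|exact: conf_diff_smooth].
by apply: (pd_ext x (dom_open i)) => // q _ iq; exact: christoffel_conf.
Qed.

Local Notation hessp p := (hess (U p) (Gam p) (H p)).
Local Notation trp p := (trhess (Gp p) (U p) (Gam p) (H p)).
Local Notation N p := (sqnorm (Gp p) (U p)).

Lemma ricci_conf p b c : dom i p ->
  ricci gh i b c p = ricci g i b c p - (d - 2) * hessp p b c - trp p * g i p b c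
    + (d - 2) * (U p b * U p c - N p * g i p b c).
Proof.
move=> ip.
have sy x y : g i p x y = g i p y x by exact: (metric_tensor_sym hg x y ip).
have Gsy x y : ginv g i p x y = ginv g i p y x by exact: (ginv_sym hg x y ip).
have gG x y : \sum_e g i p x e * ginv g i p e y = (x == y)%:R by exact: (metric_ginv hg x y ip).
pose S := conf_diff (gp p) (Gp p) (U p).
pose r x c := pd i x (fun q => raised (Gp q) (U q) c) p.
pose dg x y z := pd i x (fun q => g i q y z) p.
pose X := \sum_a ((a == b)%:R * H p a c + (a == c)%:R * H p a b - (r a a * g i p b c + raised (Gp p) (U p) a * dg a b c)).
pose Y := \sum_a \sum_e (Gam p a a e * S e b c + S a a e * Gam p e b c
      - Gam p a c e * S e a b - S a c e * Gam p e a b).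
pose Z := \sum_a \sum_e (S a a e * S e b c - S a c e * S e a b).
have L : X - d * H p c b + Y = - (d - 2) * hessp p b c - trp p * g i p b c :=
  @ricci_conf_linear R n (gp p) (Gp p) (U p) sy Gsy gG (Gam p) dg (H p) r
  (fun c a b => christoffel_sym hg c a b ip) (fun a b c => christoffel_metric hg a b c ip)
  (fun a b => pd_upsilon_sym a b ip) (fun a b => raised_deriv a b ip) b c.
have Q : Z = (d - 2) * (U p b * U p c - N p * g i p b c) :=
  @ricci_conf_quadratic R n (gp p) (Gp p) (U p) sy Gsy gG b c.
(* The trace of the symbols is simplified before it is differentiated: it changes by [d U_b], so no
   derivative of [raised] arises here. *)
have tr : \sum_a pd i c (christoffel gh i a a b) p =
    \sum_a pd i c (christoffel g i a a b) p + d * H p c b.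
  have ps g' : regular_metric g' i -> pd i c (fun x => \sum_a christoffel g' i a a b x) p =
      \sum_a pd i c (christoffel g' i a a b) p.
    by move=> h; apply: pd_sum => // a; exact: christoffel_smooth.
  apply: etrans (esym (ps gh hgh)) (etrans _ (congr1 (+%R^~ (d * H p c b)) (ps g hg))).
  have E : pd i c (fun x => \sum_a christoffel gh i a a b x) p =
      pd i c (fun x => \sum_a christoffel g i a a b x + d * U x b) p.
    apply: (pd_ext c (dom_open i)) => // q _ iq.
    rewrite -(conf_diff_trace (U q) (fun x y => metric_tensor_sym hg x y iq) (fun x y => ginv_sym hg x y iq) (fun x y => metric_ginv hg x y iq) b).
    by rewrite -big_split/=; apply: eq_bigr => a _; exact: christoffel_conf.
  rewrite E pdD; [|by apply: smooth_near_sum => // a; exact: christoffel_smooth|].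
    by rewrite pdZ//; exact: upsilon_smooth.
  by apply: smooth_nearM; [exact: smooth_near_cst|exact: upsilon_smooth].
have split_ricci g' : ricci g' i b c p = \sum_a pd i a (christoffel g' i a b c) p
   - \sum_a pd i c (christoffel g' i a a b) p +
   \sum_a \sum_e (christoffel g' i a a e p * christoffel g' i e b c p
              - christoffel g' i a c e p * christoffel g' i e a b p).
  by rewrite /ricci -sumrB -big_split.
have e3 : \sum_a pd i a (christoffel gh i a b c) p = \sum_a pd i a (christoffel g i a b c) p + X.
  by rewrite -big_split/=; apply: eq_bigr => a _; rewrite pd_christoffel_conf.
have e4 : \sum_a \sum_e (christoffel gh i a a e p * christoffel gh i e b c p
              - christoffel gh i a c e p * christoffel gh i e a b p) =
   \sum_a \sum_e (christoffel g i a a e p * christoffel g i e b c p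
              - christoffel g i a c e p * christoffel g i e a b p) + Y + Z.
  have Ec c0 a0 b0 : christoffel gh i c0 a0 b0 p = Gam p c0 a0 b0 + S c0 a0 b0.
    exact: christoffel_conf.
  rewrite -!big_split/=; apply: eq_bigr => a _; rewrite -!big_split/=; apply: eq_bigr => e _.
  rewrite !Ec.
  move: (S a a e) (S e b c) (S a c e) (S e a b) (Gam p a a e) (Gam p e b c) (Gam p a c e) (Gam p e a b).
  by move=> *; ring.
(* Linear arithmetic on abstract reals, so that [ring] does not have to compare the large sums. *)
have combine (Rh Rr B C A Bh Ch Ah X1 Y1 Z1 D1 k1 h1 k q : R) : Rh = Bh - Ch + Ah ->
    Rr = B - C + A -> Bh = B + X1 -> Ah = A + Y1 + Z1 -> Ch = C + D1 ->
    X1 - D1 + Y1 = - k1 * h1 - k -> Z1 = q -> Rh = Rr - k1 * h1 - k + q.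
  move=> -> -> -> -> -> L1 ->; have -> : X1 = - k1 * h1 - k - Y1 + D1 by rewrite -L1; ring.
  by ring.
exact: (combine _ _ _ _ _ _ _ _ _ _ _ _ _ _ _ _ (split_ricci gh) (split_ricci g) e3 e4 tr L Q).
Qed.

Hypothesis n2 : (2 <= n)%N.

Lemma d_neq1 : d - 1 != 0.
Proof. by rewrite -natr1 addrK pnatr_eq0; case: n n2. Qed.

Lemma d_neq2 : d - 2 != 0.
Proof.
have -> : d - 2 = n.-1%:R by case: n n2 => // k _; rewrite -!natr1; ring.
by rewrite pnatr_eq0; case: n n2 => // -[].
Qed.

Lemma schoutenJ_conf p : dom i p -> schoutenJ gh i p =
  (Om p)^-1 ^+ 2 * (schoutenJ g i p - trp p - (d - 2) / 2 * N p).
Proof.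
move=> ip.
have sy x y : g i p x y = g i p y x by exact: (metric_tensor_sym hg x y ip).
have E : scal gh i p = (Om p)^-1 ^+ 2 * (scal g i p - (d - 2) * trp p - trp p * d + (d - 2) * (N p - N p * d)).
  have gd : \sum_a \sum_b ginv g i p a b * g i p a b = d.
    transitivity (\sum_(a : I) (1 : R)); last by rewrite sumr_const card_ord.
    apply: eq_bigr => a _; have e1 : (1 : R) = (a == a)%:R by rewrite eqxx.
    rewrite e1 -(metric_ginv hg a a ip).
    by apply: eq_bigr => e _; rewrite mulrC (ginv_sym hg a e ip) (metric_tensor_sym hg a e ip) (ginv_sym hg e a ip) (metric_tensor_sym hg e a ip).
  have hess_tr : \sum_a \sum_b ginv g i p a b * hessp p a b = trp p by [].
  have UU : \sum_a \sum_b ginv g i p a b * (U p a * U p b) = N p.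
    by apply: eq_bigr => a _; apply: eq_bigr => b _; rewrite mulrA.
  pose k1 := - (d - 2); pose k2 := - trp p - (d - 2) * N p.
  have Es a b : ricci gh i a b p = ricci g i a b p + k1 * hessp p a b + (d - 2) * (U p a * U p b) + k2 * g i p a b.
    by rewrite ricci_conf// /k1 /k2; ring.
  have sumG (f : I -> I -> R) k : \sum_a \sum_b ginv g i p a b * (k * f a b) = k * \sum_a \sum_b ginv g i p a b * f a b.
    rewrite mulr_sumr; apply: eq_bigr => a _; rewrite mulr_sumr; apply: eq_bigr => b _.
    by rewrite mulrCA.
  transitivity ((Om p)^-1 ^+ 2 * (\sum_a \sum_b ginv g i p a b * ricci g i a b p
     + \sum_a \sum_b ginv g i p a b * (k1 * hessp p a b)
     + \sum_a \sum_b ginv g i p a b * ((d - 2) * (U p a * U p b))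
     + \sum_a \sum_b ginv g i p a b * (k2 * g i p a b))).
    rewrite -!big_split mulr_sumr/=; apply: eq_bigr => a _.
    rewrite -!big_split mulr_sumr/=; apply: eq_bigr => b _.
    rewrite ginv_conf// Es; move: (ricci g i a b p) (hessp p a b) => *; ring.
  rewrite (sumG (fun a b => hessp p a b) k1) (sumG (fun a b => U p a * U p b)) (sumG (fun a b => g i p a b)) gd hess_tr UU /k1 /k2 -/(scal g i p).
  by ring.
rewrite /schoutenJ E; move: (scal g i p) (trp p) (N p) => s t u.
have := d_neq1; move: (n.+1%:R : R) (Om_neq0 p) => D O0 d1; field.
by rewrite d1.
Qed.

(** The trace of the Hessian in the law of the Ricci tensor cancels against the one in the law of
    [J]; what survives of the change is proportional to [d - 2], which is divided out. *)
Lemma schouten_conf p a b : dom i p -> schouten gh i a b p =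
  schouten g i a b p - hessp p a b + U p a * U p b - 2^-1 * N p * g i p a b.
Proof.
move=> ip; rewrite /schouten ricci_conf// schoutenJ_conf// ghE'//.
move: (ricci g i a b p) (schoutenJ g i p) (trp p) (N p) (hessp p a b) => r j t u h.
have := d_neq2; move: (n.+1%:R : R) (Om_neq0 p) => D O0 d2; field.
by rewrite d2.
Qed.

End ConformalChange.

(** * Coordinate change of the Schouten tensor *)

Section MatrixDerivative.
Variables (R : realType) (n : nat) (M : manifold R n).
Implicit Types (i : chart M) (p : M) (X Y : M -> 'M[R]_n.+1).

(** Matrix-valued derivatives turn the coordinate law of the connection into the noncommutative
    identity [E G = A E + dE], from which the law of the curvature follows formally. *)
Definition pd_mx i a X p : 'M[R]_n.+1 := \matrix_(r, s) pd i a (fun q => X q r s) p.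
Definition smooth_mx i p X := forall r s, smooth_near i p (fun q => X q r s).

Lemma smooth_mxM i p X Y : smooth_mx i p X -> smooth_mx i p Y ->
  smooth_mx i p (fun q => X q *m Y q).
Proof.
move=> sX sY r s; have ip := smooth_near_dom (sX r s).
have -> : (fun q => (X q *m Y q) r s) = fun q => \sum_k X q r k * Y q k s.
  by apply/funext => q; rewrite mxE.
by apply: smooth_near_sum => // k; apply: smooth_nearM.
Qed.

Lemma smooth_mxZ i p (k : M -> R) X : smooth_near i p k -> smooth_mx i p X ->
  smooth_mx i p (fun q => k q *: X q).
Proof.
move=> sk sX r s.
have -> : (fun q => (k q *: X q) r s) = fun q => k q * X q r s.
  by apply/funext => q; rewrite mxE.
exact: smooth_nearM.
Qed.

Lemma smooth_mxT i p X : smooth_mx i p X -> smooth_mx i p (fun q => (X q)^T).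
Proof.
move=> sX r s; have -> : (fun q => (X q)^T r s) = fun q => X q s r.
  by apply/funext => q; rewrite mxE.
exact: sX.
Qed.

Lemma smooth_mx_sum i p (I : finType) (X : I -> M -> 'M[R]_n.+1) : dom i p ->
  (forall k, smooth_mx i p (X k)) -> smooth_mx i p (fun q => \sum_k X k q).
Proof.
move=> ip sX r s.
have -> : (fun q => (\sum_k X k q) r s) = fun q => \sum_k X k q r s.
  by apply/funext => q; rewrite summxE.
by apply: smooth_near_sum => // k; apply: sX.
Qed.

Lemma smooth_mx_pd i p a X : smooth_mx i p X -> smooth_mx i p (pd_mx i a X).
Proof.
move=> sX r s.
have -> : (fun q => pd_mx i a X q r s) = pd i a (fun q => X q r s).
  by apply/funext => q; rewrite mxE.
exact: smooth_near_pd.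
Qed.

Lemma pd_mxM i p a X Y : smooth_mx i p X -> smooth_mx i p Y ->
  pd_mx i a (fun q => X q *m Y q) p = pd_mx i a X p *m Y p + X p *m pd_mx i a Y p.
Proof.
move=> sX sY; apply/matrixP => r s; have ip := smooth_near_dom (sX r s).
rewrite !mxE.
have -> : (fun q => (X q *m Y q) r s) = fun q => \sum_k X q r k * Y q k s.
  by apply/funext => q; rewrite mxE.
rewrite pd_sum//; last by move=> k; apply: smooth_nearM.
by rewrite -big_split/=; apply: eq_bigr => k _; rewrite pdM// !mxE.
Qed.

Lemma pd_mxD i p a X Y : smooth_mx i p X -> smooth_mx i p Y ->
  pd_mx i a (fun q => X q + Y q) p = pd_mx i a X p + pd_mx i a Y p.
Proof.
move=> sX sY; apply/matrixP => r s; rewrite !mxE.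
have -> : (fun q => (X q + Y q) r s) = fun q => X q r s + Y q r s.
  by apply/funext => q; rewrite mxE.
exact: pdD.
Qed.

Lemma pd_mxZ i p a (k : M -> R) X : smooth_near i p k -> smooth_mx i p X ->
  pd_mx i a (fun q => k q *: X q) p = pd i a k p *: X p + k p *: pd_mx i a X p.
Proof.
move=> sk sX; apply/matrixP => r s; rewrite !mxE.
have -> : (fun q => (k q *: X q) r s) = fun q => k q * X q r s.
  by apply/funext => q; rewrite mxE.
exact: pdM.
Qed.

Lemma pd_mxT i p a X : pd_mx i a (fun q => (X q)^T) p = (pd_mx i a X p)^T.
Proof.
apply/matrixP => r s; rewrite !mxE; congr (pd i a _ p).
by apply/funext => q; rewrite mxE.
Qed.

Lemma pd_mx_sum i p a (I : finType) (X : I -> M -> 'M[R]_n.+1) : dom i p ->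
  (forall k, smooth_mx i p (X k)) ->
  pd_mx i a (fun q => \sum_k X k q) p = \sum_k pd_mx i a (X k) p.
Proof.
move=> ip sX; apply/matrixP => r s; rewrite summxE !mxE.
have -> : (fun q => (\sum_k X k q) r s) = fun q => \sum_k X k q r s.
  by apply/funext => q; rewrite summxE.
rewrite pd_sum//; last by move=> k; exact: sX.
by apply: eq_bigr => k _; rewrite mxE.
Qed.

Lemma pd_mx_ext i p a X Y (W : set M) : open W -> W p -> dom i p ->
  (forall q, W q -> dom i q -> X q = Y q) -> pd_mx i a X p = pd_mx i a Y p.
Proof.
move=> oW Wp ip XY; apply/matrixP => r s; rewrite !mxE.
by apply: (pd_ext a oW) => // q Wq iq; rewrite XY.
Qed.

Lemma pd_mxC i p a b X : smooth_mx i p X -> pd_mx i a (pd_mx i b X) p = pd_mx i b (pd_mx i a X) p.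
Proof.
move=> sX; apply/matrixP => r s; rewrite [LHS]mxE [RHS]mxE.
have E c : (fun q => pd_mx i c X q r s) = pd i c (fun q => X q r s).
  by apply/funext => q; rewrite mxE.
apply: etrans (congr1 (fun F => pd i a F p) (E b)) _.
exact: etrans (pdC a b (sX r s)) (congr1 (fun F => pd i b F p) (esym (E a))).
Qed.

Lemma smooth_mx_chart i j p X : smooth_mx i p X -> dom j p -> smooth_mx j p X.
Proof. by move=> sX jp r s; exact: smooth_near_chart (sX r s) jp. Qed.

Lemma pd_mx_chart i j p b X : smooth_mx i p X -> dom j p ->
  pd_mx j b X p = \sum_a jac i j p a b *: pd_mx i a X p.
Proof.
move=> sX jp; apply/matrixP => r s; rewrite summxE !mxE (pd_chart b (sX r s) jp).
by apply: eq_bigr => a _; rewrite !mxE.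
Qed.

End MatrixDerivative.

Lemma add_mxE (R : realType) k l (A B : 'M[R]_(k, l)) r s : (A + B) r s = A r s + B r s.
Proof. by rewrite mxE. Qed.

Lemma sub_mxE (R : realType) k l (A B : 'M[R]_(k, l)) r s : (A - B) r s = A r s - B r s.
Proof. by rewrite !mxE. Qed.

Section ChartChange.
Variables (R : realType) (n : nat) (M : manifold R n) (i j : chart M).
Notation I := 'I_n.+1.
Implicit Types (p : M) (a b c e : I).

Definition jac_mx i j p : 'M[R]_n.+1 := \matrix_(c, b) @jac R n M i j p c b.

Lemma jac_smooth p c b : dom i p -> dom j p -> smooth_near j p (fun q => jac i j q c b).
Proof. by move=> ip jp; apply: smooth_near_pd; exact: smooth_near_coord. Qed.

Lemma jac_mx_smooth p : dom i p -> dom j p -> smooth_mx j p (jac_mx i j).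
Proof.
move=> ip jp r s.
have -> : (fun q => jac_mx i j q r s) = fun q => jac i j q r s by apply/funext => q; rewrite mxE.
exact: jac_smooth.
Qed.

Lemma pd_jac_sym p c a b : dom i p -> dom j p ->
  pd j a (fun q => jac i j q c b) p = pd j b (fun q => jac i j q c a) p.
Proof. by move=> ip jp; exact: (pdC a b (smooth_near_coord c jp ip)). Qed.

Lemma overlap_open : open (dom i `&` dom j).
Proof. by apply: openI; exact: dom_open. Qed.

End ChartChange.

Lemma jac_mxK (R : realType) (n : nat) (M : manifold R n) (i j : chart M) p :
  dom i p -> dom j p -> jac_mx i j p *m jac_mx j i p = 1%:M.
Proof.
move=> ip jp; apply/matrixP => f h; rewrite !mxE.
rewrite -(pd_coord f h ip) (pd_chart h (smooth_near_coord f jp ip) ip).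
by apply: eq_bigr => e _; rewrite !mxE mulrC.
Qed.

Section ChartAlgebra.
Variables (R : realFieldType) (n : nat).
Notation I := 'I_n.+1.
Implicit Types (J : I -> I -> R) (dJ : I -> I -> I -> R) (C : I -> 'M[R]_n.+1)
  (dC : I -> I -> 'M[R]_n.+1).

(** A matrix-valued one-form with components [C], evaluated on the coordinate vector of index [x] of
    the other chart; [dir_mx_deriv] is the derivative of such a value along a coordinate vector. *)
Definition dir_mx J C x := \sum_d J d x *: C d.
Definition dir_mx2 J (K : I -> I -> 'M[R]_n.+1) x y := \sum_c \sum_d (J c x * J d y) *: K c d.
Definition dir_mx_deriv J dJ C dC x y :=
  \sum_d (dJ x d y *: C d + J d y *: \sum_c J c x *: dC c d).

Lemma dir_mx2C J K x y : dir_mx2 J K x y = dir_mx2 J (fun c d => K d c) y x.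
Proof.
rewrite /dir_mx2 exchange_big/=; apply: eq_bigr => c _; apply: eq_bigr => d _.
by rewrite [J d x * _]mulrC.
Qed.

Lemma dir_mxM J C x y : dir_mx J C x *m dir_mx J C y = dir_mx2 J (fun c d => C c *m C d) x y.
Proof.
rewrite mulmx_suml; apply: eq_bigr => c _; rewrite mulmx_sumr; apply: eq_bigr => d _.
by rewrite -scalemxAl -scalemxAr scalerA.
Qed.

Lemma dir_mx2D J K L x y :
  dir_mx2 J (fun c d => K c d + L c d) x y = dir_mx2 J K x y + dir_mx2 J L x y.
Proof.
rewrite /dir_mx2 -big_split; apply: eq_bigr => c _; rewrite -big_split.
by apply: eq_bigr => d _; exact: scalerDr.
Qed.

Lemma dir_mx2N J K x y : dir_mx2 J (fun c d => - K c d) x y = - dir_mx2 J K x y.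
Proof.
rewrite /dir_mx2 -sumrN; apply: eq_bigr => c _; rewrite -sumrN.
by apply: eq_bigr => d _; exact: scalerN.
Qed.

Lemma dir_mx_derivE J dJ C dC x y : dir_mx_deriv J dJ C dC x y =
  \sum_d dJ x d y *: C d + dir_mx2 J dC x y.
Proof.
rewrite /dir_mx_deriv big_split /= /dir_mx2; congr (_ + _); rewrite exchange_big/=.
apply: eq_bigr => d _; rewrite scaler_sumr; apply: eq_bigr => c _.
by rewrite scalerA mulrC.
Qed.

(** Curvature is a two-form: the second derivatives of the chart change are symmetric and drop out
    of the antisymmetrised derivative. *)
Lemma dir_curvature J dJ C dC a b : (forall d x y, dJ x d y = dJ y d x) ->
  dir_mx_deriv J dJ C dC a b - dir_mx_deriv J dJ C dC b a
    + dir_mx J C a *m dir_mx J C b - dir_mx J C b *m dir_mx J C a =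
  dir_mx2 J (fun c d => dC c d - dC d c + C c *m C d - C d *m C c) a b.
Proof.
move=> sJ; rewrite !dir_mx_derivE !dir_mxM.
have -> : \sum_d dJ b d a *: C d = \sum_d dJ a d b *: C d.
  by apply: eq_bigr => d _; rewrite sJ.
rewrite opprD addrACA subrr add0r (dir_mx2C J dC b a) (dir_mx2C J (fun c d => C c *m C d) b a).
by rewrite -!dir_mx2N -!dir_mx2D.
Qed.

(** Curvatures of gauge-equivalent connections are conjugate. The last hypothesis is the derivative
    of [E G = A E + dE]; antisymmetrising it removes [ddE], and the first one rewrites the
    products. *)
Lemma gauge_curvature (E : 'M[R]_n.+1) (dE A G : I -> 'M[R]_n.+1)
    (ddE dA dG : I -> I -> 'M[R]_n.+1) a b :
  (forall x, E *m G x = A x *m E + dE x) -> (forall x y, ddE x y = ddE y x) ->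
  (forall x y, dE x *m G y + E *m dG x y = dA x y *m E + A y *m dE x + ddE x y) ->
  E *m (dG a b - dG b a + G a *m G b - G b *m G a) =
  (dA a b - dA b a + A a *m A b - A b *m A a) *m E.
Proof.
move=> EG dd D.
have Q x y : E *m (G x *m G y) = A x *m A y *m E + A x *m dE y + dE x *m G y.
  by rewrite mulmxA EG mulmxDl -mulmxA EG mulmxDr mulmxA.
have D' x y : E *m dG x y = dA x y *m E + A y *m dE x + ddE x y - dE x *m G y.
  by rewrite -D addrC addKr.
rewrite !mulmxDr !mulmxN !D' !Q (dd b a) !mulmxDl !mulNmx.
move: (_ *m E) (_ *m E) (A b *m _) (A a *m _) (dE a *m _) (dE b *m _) (ddE a b)
  (_ *m E) (_ *m E) => x1 x2 x3 x4 x5 x6 x7 x8 x9.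
by apply/matrixP => r s; rewrite !mxE; ring.
Qed.

(* Change of the contraction [Ric b c = \sum_a (R a c) a b] of the curvature. *)
Lemma gauge_ricci (E iE : 'M[R]_n.+1) (K K' : I -> I -> 'M[R]_n.+1) b c :
  E *m iE = 1%:M -> iE *m E = 1%:M ->
  (forall x y, E *m K' x y = dir_mx2 E K x y *m E) ->
  \sum_a K' a c a b = \sum_e \sum_f E e b * E f c * (\sum_a K a f a e).
Proof.
move=> EiE iEE H.
have KE a : K' a c a b = \sum_x \sum_f \sum_h \sum_e iE a h * E x a * E f c * K x f h e * E e b.
  have -> : K' a c = iE *m (dir_mx2 E K a c *m E) by rewrite -H mulmxA iEE mul1mx.
  rewrite mxE.
  under eq_bigr => h _ do rewrite mxE mulr_sumr.
  transitivity (\sum_h \sum_e \sum_x \sum_f iE a h * E x a * E f c * K x f h e * E e b).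
    apply: eq_bigr => h _; apply: eq_bigr => e _.
    rewrite summxE mulr_suml mulr_sumr; apply: eq_bigr => x _.
    rewrite summxE mulr_suml mulr_sumr; apply: eq_bigr => f _.
    by rewrite mxE; ring.
  under eq_bigr => h _ do rewrite exchange_big/=.
  rewrite exchange_big/=; apply: eq_bigr => x _.
  under eq_bigr => h _ do rewrite exchange_big/=.
  by rewrite exchange_big.
under eq_bigr => a _ do rewrite KE.
transitivity (\sum_x \sum_f \sum_h \sum_e (\sum_a E x a * iE a h) * (E f c * K x f h e * E e b)).
  rewrite exchange_big/=; apply: eq_bigr => x _.
  rewrite exchange_big/=; apply: eq_bigr => f _.
  rewrite exchange_big/=; apply: eq_bigr => h _.
  rewrite exchange_big/=; apply: eq_bigr => e _.
  by rewrite mulr_suml; apply: eq_bigr => a _; ring.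
have S x h : \sum_a E x a * iE a h = (x == h)%:R.
  by move/matrixP/(_ x h): EiE; rewrite !mxE.
transitivity (\sum_x \sum_f \sum_e E f c * K x f x e * E e b).
  apply: eq_bigr => x _; apply: eq_bigr => f _; rewrite exchange_big/=.
  apply: eq_bigr => e _; under eq_bigr => h _ do rewrite S.
  exact: (sum_dl x (fun h => E f c * K x f h e * E e b)).
rewrite exchange_big/=; under eq_bigr => f _ do rewrite exchange_big/=.
rewrite exchange_big/=; apply: eq_bigr => e _; apply: eq_bigr => f _.
by rewrite mulr_sumr; apply: eq_bigr => x _; ring.
Qed.

End ChartAlgebra.

Section LeviCivitaChart.
Variables (R : realType) (n : nat) (M : manifold R n) (i j : chart M).
Notation I := 'I_n.+1.
Variable g : metric_field M.
Hypothesis hgi : regular_metric g i.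
Hypothesis hgj : regular_metric g j.
Hypothesis g_chart : forall p, dom i p -> dom j p -> forall a b,
  g j p a b = \sum_c \sum_e jac i j p c a * jac i j p e b * g i p c e.

Local Notation E := (jac_mx i j).
Local Notation iE := (jac_mx j i).

Lemma metric_chart p : dom i p -> dom j p -> g j p = (E p)^T *m g i p *m E p.
Proof.
move=> ip jp; apply/matrixP => a b; rewrite g_chart// !mxE.
rewrite exchange_big/=; apply: eq_bigr => e _; rewrite !mxE mulr_suml.
by apply: eq_bigr => c _; rewrite !mxE; ring.
Qed.

Definition chris_mx k a p : 'M[R]_n.+1 := \matrix_(c, e) christoffel g k c a e p.
Definition chris_dir b p := \sum_a jac i j p a b *: chris_mx i a p.

Lemma chris_mx_smooth k p a : regular_metric g k -> dom k p -> smooth_mx k p (chris_mx k a).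
Proof.
move=> hk kp r s.
have -> : (fun q => chris_mx k a q r s) = christoffel g k r a s by apply/funext => q; rewrite mxE.
exact: christoffel_smooth.
Qed.

Lemma metric_mx_sym p k : regular_metric g k -> dom k p -> (g k p)^T = g k p.
Proof. by move=> hk kp; apply/matrixP => a b; rewrite mxE (metric_tensor_sym hk). Qed.

Lemma pd_metric_mx k p a : regular_metric g k -> dom k p ->
  pd_mx k a (g k) p = (chris_mx k a p)^T *m g k p + g k p *m chris_mx k a p.
Proof.
move=> hk kp; apply/matrixP => b c; rewrite !mxE (christoffel_metric hk)//.
congr (_ + _); apply: eq_bigr => e _; rewrite !mxE// mulrC.
by rewrite (metric_tensor_sym hk _ _ kp).
Qed.

(** The matrices [E^(-1) (A E + dE)] are symmetric in their lower indices and compatible with the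
    transported metric, so [christoffel_unique] identifies them with the symbols in the chart
    [j]. *)
Lemma christoffel_chart p b : dom i p -> dom j p ->
  E p *m chris_mx j b p = chris_dir b p *m E p + pd_mx j b E p.
Proof.
move=> ip jp.
(* [T] is introduced together with its defining equation but opaque, so that rewriting does not
   unfold it. *)
have [T TE] : exists T : I -> 'M[R]_n.+1,
  forall a, T a = chris_dir a p *m E p + pd_mx j a E p by eexists.
rewrite -TE; pose Y c a b := (iE p *m T a) c b.
have EiE := jac_mxK ip jp; have iEE := jac_mxK jp ip.
suff YE : chris_mx j b p = iE p *m T b by rewrite YE mulmxA EiE mul1mx.
apply/matrixP => c e; rewrite mxE.
apply: (christoffel_unique (Y := Y) hgj jp) => {b c e}.
  have Ts f a b : T a f b = T b f a.
    have A0 x y : (chris_dir x p *m E p) f y =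
        \sum_d \sum_e jac i j p d x * jac i j p e y * christoffel g i f d e p.
      rewrite mxE exchange_big/=; apply: eq_bigr => e _.
      rewrite summxE mulr_suml; apply: eq_bigr => d _; rewrite !mxE; ring.
    have P0 x y : pd_mx j x E p f y = pd j x (fun q => jac i j q f y) p.
      by rewrite mxE; congr (pd j x _ p); apply/funext => q; rewrite mxE.
    have Te x y : T x f y = (chris_dir x p *m E p) f y + pd_mx j x E p f y.
      by rewrite TE; exact: add_mxE.
    apply: etrans (Te a b) (etrans _ (esym (Te b a))); congr (_ + _); last first.
      by apply: etrans (P0 a b) (etrans _ (esym (P0 b a))); exact: pd_jac_sym.
    apply: etrans (A0 a b) (etrans _ (esym (A0 b a))).
    rewrite exchange_big/=; apply: eq_bigr => e _; apply: eq_bigr => d _.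
    by rewrite (christoffel_sym hgi f d e ip); ring.
  by move=> c a b; rewrite /Y [LHS]mxE [RHS]mxE; apply: eq_bigr => f _; rewrite Ts.
move=> a b c.
have -> : \sum_e Y e a b * g j p e c + \sum_e Y e a c * g j p e b =
    ((iE p *m T a)^T *m g j p + g j p *m (iE p *m T a)) b c.
  rewrite !mxE; congr (_ + _); apply: eq_bigr => e _; first by rewrite mxE.
  by rewrite mulrC (metric_tensor_sym hgj _ _ jp).
have -> : pd j a (fun x => g j x b c) p = pd_mx j a (g j) p b c by rewrite mxE.
congr (fun_of_matrix _ b c).
have GY : g j p *m (iE p *m T a) = (E p)^T *m g i p *m T a.
  by rewrite metric_chart// -!mulmxA (mulmxA (E p)) EiE mul1mx.
have -> : (iE p *m T a)^T *m g j p = (g j p *m (iE p *m T a))^T.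
  by rewrite [RHS]trmx_mul metric_mx_sym.
rewrite GY.
have sE := jac_mx_smooth ip jp.
have sgi : smooth_mx i p (g i) by move=> r s; exact: metric_smooth.
have sgj : smooth_mx j p (g i) by exact: smooth_mx_chart sgi jp.
rewrite (pd_mx_ext a (overlap_open i j) (Y := fun q => (E q)^T *m g i q *m E q))//; last first.
  by move=> q [iq jq] _; exact: metric_chart.
rewrite pd_mxM//; last by apply: smooth_mxM => //; exact: smooth_mxT.
rewrite pd_mxM//; last by exact: smooth_mxT.
rewrite pd_mxT (pd_mx_chart a sgi jp).
have -> : \sum_d jac i j p d a *: pd_mx i d (g i) p =
   (chris_dir a p)^T *m g i p + g i p *m chris_dir a p.
  rewrite /chris_dir raddf_sum mulmx_suml mulmx_sumr -big_split/=; apply: eq_bigr => d _.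
  by rewrite pd_metric_mx// scalerDr linearZ/= -scalemxAl -scalemxAr.
have GT : (g i p)^T = g i p by exact: metric_mx_sym.
have TT : (T a)^T = (E p)^T *m (chris_dir a p)^T + (pd_mx j a E p)^T.
  by rewrite TE [LHS]linearD/= trmx_mul.
have -> : ((E p)^T *m g i p *m T a)^T = (T a)^T *m g i p *m E p.
  by rewrite !trmx_mul trmxK GT mulmxA.
rewrite TT TE.
move: (E p) (g i p) (chris_dir a p) (pd_mx j a E p) => e h x y.
rewrite !(mulmxDl, mulmxDr) !mulmxA.
by rewrite [X in _ = X + _]addrC !addrA.
Qed.

Definition curvature_mx k a b p := pd_mx k a (chris_mx k b) p - pd_mx k b (chris_mx k a) p
  + chris_mx k a p *m chris_mx k b p - chris_mx k b p *m chris_mx k a p.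

(** Two of the four terms use the symmetry of the symbols, since matrix multiplication dictates the
    order of the lower indices. *)
Lemma ricciE k b c p : regular_metric g k -> dom k p ->
  ricci g k b c p = \sum_a curvature_mx k a c p a b.
Proof.
move=> hk kp; apply: eq_bigr => a _.
have P0 x y f h : pd_mx k x (chris_mx k y) p f h = pd k x (christoffel g k f y h) p.
  by rewrite mxE; congr (pd k x _ p); apply/funext => q; rewrite mxE.
have M0 x y f h : (chris_mx k x p *m chris_mx k y p) f h =
    \sum_e christoffel g k f x e p * christoffel g k e y h p.
  by rewrite mxE; apply: eq_bigr => e _; rewrite !mxE.
have -> : curvature_mx k a c p a b = pd_mx k a (chris_mx k c) p a b - pd_mx k c (chris_mx k a) p a b
   + (chris_mx k a p *m chris_mx k c p) a b - (chris_mx k c p *m chris_mx k a p) a b.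
  by rewrite /curvature_mx sub_mxE add_mxE sub_mxE.
rewrite sumrB addrA; congr (_ - _ + _ - _).
- apply: etrans _ (esym (P0 a c a b)).
  by apply: (pd_ext a (dom_open k)) => // q _ kq; exact: christoffel_sym.
- exact: esym (P0 c a a b).
- apply: etrans _ (esym (M0 a c a b)).
  by apply: eq_bigr => e _; congr (_ * _); exact: christoffel_sym.
- exact: esym (M0 c a a b).
Qed.

Lemma chris_dir_smooth p b : dom i p -> dom j p -> smooth_mx j p (chris_dir b).
Proof.
move=> ip jp; apply: smooth_mx_sum => // a; apply: smooth_mxZ; first exact: jac_smooth.
by apply: smooth_mx_chart jp; exact: chris_mx_smooth.
Qed.

Lemma pd_chris_dir p a b : dom i p -> dom j p -> pd_mx j a (chris_dir b) p =
  \sum_d (pd j a (fun q => jac i j q d b) p *: chris_mx i d p +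
     jac i j p d b *: \sum_c jac i j p c a *: pd_mx i c (chris_mx i d) p).
Proof.
move=> ip jp.
have sc d : smooth_mx i p (chris_mx i d) by exact: chris_mx_smooth.
rewrite pd_mx_sum//; last first.
  move=> d; apply: smooth_mxZ; first exact: jac_smooth.
  exact: smooth_mx_chart (sc d) jp.
apply: eq_bigr => d _; rewrite pd_mxZ; [|exact: jac_smooth|exact: smooth_mx_chart (sc d) jp].
by rewrite -pd_mx_chart.
Qed.

(** [gauge_curvature] conjugates the curvature by the Jacobian, [dir_curvature] identifies the
    conjugated matrices with the old curvature evaluated on the new coordinate vectors, and
    [gauge_ricci] takes the trace. *)
Lemma ricci_chart p b c : dom i p -> dom j p -> ricci g j b c p =
  \sum_e \sum_f jac i j p e b * jac i j p f c * ricci g i e f p.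
Proof.
move=> ip jp.
have sE := jac_mx_smooth ip jp.
have sj x : smooth_mx j p (chris_mx j x) by exact: chris_mx_smooth.
have sA x : smooth_mx j p (chris_dir x) by exact: chris_dir_smooth.
have D x y : pd_mx j x E p *m chris_mx j y p + E p *m pd_mx j x (chris_mx j y) p =
    pd_mx j x (chris_dir y) p *m E p + chris_dir y p *m pd_mx j x E p + pd_mx j x (pd_mx j y E) p.
  apply: etrans (esym (pd_mxM x sE (sj y))) _.
  transitivity (pd_mx j x (fun q => chris_dir y q *m E q + pd_mx j y E q) p).
    apply: (pd_mx_ext x (overlap_open i j)) => // q [iq jq] _; exact: (christoffel_chart y iq jq).
  apply: etrans (pd_mxD x (smooth_mxM (sA y) sE) (smooth_mx_pd y sE)) _.
  by congr (_ + _); exact: pd_mxM.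
have K x y : E p *m curvature_mx j x y p = dir_mx2 (E p) (fun c d => curvature_mx i c d p) x y *m E p.
  have := @gauge_curvature R n (E p) (fun b => pd_mx j b E p) (fun b => chris_dir b p)
    (fun b => chris_mx j b p) (fun a b => pd_mx j a (pd_mx j b E) p)
    (fun a b => pd_mx j a (chris_dir b) p) (fun a b => pd_mx j a (chris_mx j b) p) x y
    (fun b => christoffel_chart b ip jp) (fun a b => pd_mxC a b sE) D.
  move=> H; apply: (etrans H); congr (_ *m _).
  have := @dir_curvature R n (E p) (fun a d b => pd j a (fun q => jac i j q d b) p)
    (fun d => chris_mx i d p) (fun c d => pd_mx i c (chris_mx i d) p) x y
    (fun d x y => pd_jac_sym d x y ip jp).
  apply: etrans.
  have dE x0 : chris_dir x0 p = dir_mx (E p) (fun d => chris_mx i d p) x0.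
    by apply: eq_bigr => d _; rewrite mxE.
  have ddE x0 y0 : pd_mx j x0 (chris_dir y0) p = dir_mx_deriv (E p)
      (fun a d b => pd j a (fun q => jac i j q d b) p) (fun d => chris_mx i d p)
      (fun c d => pd_mx i c (chris_mx i d) p) x0 y0.
    apply: etrans (pd_chris_dir x0 y0 ip jp) _; apply: eq_bigr => d _.
    congr (_ + _); congr (_ *: _); first by rewrite mxE.
    by apply: eq_bigr => e _; rewrite mxE.
  by rewrite (dE x) (dE y) (ddE x y) (ddE y x).
rewrite ricciE//.
have := @gauge_ricci R n (E p) (iE p) (fun x y => curvature_mx i x y p)
  (fun x y => curvature_mx j x y p) b c (jac_mxK ip jp) (jac_mxK jp ip) K.
move=> H; apply: (etrans H).
apply: eq_bigr => e _; apply: eq_bigr => f _.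
congr (_ * _); first by rewrite !mxE.
by rewrite ricciE.
Qed.

Lemma ginv_chart p : dom i p -> dom j p ->
  invmx (g j p) = iE p *m invmx (g i p) *m (iE p)^T.
Proof.
move=> ip jp; have EiE := jac_mxK ip jp; have iEE := jac_mxK jp ip.
have [_ _ ui] := hgi ip; have [_ _ uj] := hgj jp.
suff H : g j p *m (iE p *m invmx (g i p) *m (iE p)^T) = 1%:M.
  by rewrite -[RHS](mulKmx uj) H mulmx1.
rewrite metric_chart//; move: (E p) (iE p) (g i p) EiE iEE ui => e ie G EiE iEE ui.
rewrite -!mulmxA (mulmxA e) EiE mul1mx (mulmxA G) mulmxV// mul1mx.
by rewrite -trmx_mul iEE trmx1.
Qed.

Lemma scal_chart p : dom i p -> dom j p -> scal g j p = scal g i p.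
Proof.
move=> ip jp; have EiE := jac_mxK ip jp; have iEE := jac_mxK jp ip.
pose ric k : 'M[R]_n.+1 := \matrix_(a, b) ricci g k a b p.
have tr k : scal g k p = \tr (invmx (g k p) *m (ric k)^T).
  rewrite /scal /mxtrace; apply: eq_bigr => a _; rewrite mxE.
  by apply: eq_bigr => b _; rewrite !mxE.
have ricE : ric j = (E p)^T *m ric i *m E p.
  apply/matrixP => b c; rewrite mxE ricci_chart// exchange_big/= mxE.
  apply: eq_bigr => f _; rewrite mxE mulr_suml; apply: eq_bigr => e _.
  by rewrite !mxE; ring.
rewrite !tr ricE ginv_chart//.
move: (E p) (iE p) (invmx (g i p)) (ric i) EiE iEE => e ie G r EiE iEE.
rewrite !trmx_mul trmxK -!mulmxA (mulmxA _ e^T) -trmx_mul EiE trmx1 mul1mx.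
by rewrite mxtrace_mulC -!mulmxA EiE mulmx1.
Qed.

Lemma schoutenJ_chart p : dom i p -> dom j p -> schoutenJ g j p = schoutenJ g i p.
Proof. by move=> ip jp; rewrite /schoutenJ scal_chart. Qed.

Lemma schouten_chart p b c : dom i p -> dom j p -> schouten g j b c p =
  \sum_e \sum_f jac i j p e b * jac i j p f c * schouten g i e f p.
Proof.
move=> ip jp; rewrite /schouten schoutenJ_chart// ricci_chart// g_chart//.
rewrite mulr_sumr -sumrB mulr_suml; apply: eq_bigr => e _.
rewrite mulr_sumr -sumrB mulr_suml; apply: eq_bigr => f _; ring.
Qed.

End LeviCivitaChart.

(** * Covariance of I.D *)

Section NablaRules.
Variables (R : realType) (n : nat) (M : manifold R n) (m : nat).
Notation I := 'I_n.+1.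
Variables (g : metric_field M) (i : chart M).
Implicit Types (p : M) (F G : M -> tensor R n m) (A B : multi n m).

Definition smooth_tensor i p F := forall B, smooth_near i p (fun x => F x B).

Lemma nabla_ext a p F G (W : set M) A : open W -> W p -> dom i p ->
  (forall q, W q -> dom i q -> forall B, F q B = G q B) ->
  nabla g i a F p A = nabla g i a G p A.
Proof.
move=> oW Wp ip FG; rewrite /nabla; congr (_ + _).
  by apply: (pd_ext a oW) => // q Wq iq; exact: FG.
by apply: eq_bigr => k _; apply: eq_bigr => C _; congr (_ * _); exact: FG.
Qed.

Lemma nablaD a p F G A : smooth_tensor i p F -> smooth_tensor i p G ->
  nabla g i a (fun x B => F x B + G x B) p A = nabla g i a F p A + nabla g i a G p A.
Proof.
move=> sF sG; rewrite /nabla (pdD a (sF A) (sG A)).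
rewrite addrACA -big_split/=; congr (_ + _); apply: eq_bigr => k _.
by rewrite -big_split/=; apply: eq_bigr => C _; rewrite mulrDr.
Qed.

Lemma nablaM a p (f : M -> R) F A : smooth_near i p f -> smooth_tensor i p F ->
  nabla g i a (fun x B => f x * F x B) p A = pd i a f p * F p A + f p * nabla g i a F p A.
Proof.
move=> sf sF; rewrite /nabla (pdM a sf (sF A)) mulrDr -addrA; congr (_ + (_ + _)).
rewrite mulr_sumr; apply: eq_bigr => k _; rewrite mulr_sumr; apply: eq_bigr => C _.
by rewrite mulrCA.
Qed.

Lemma nabla_sum a p (J : finType) (F : J -> M -> tensor R n m) A : dom i p ->
  (forall k, smooth_tensor i p (F k)) ->
  nabla g i a (fun x B => \sum_k F k x B) p A = \sum_k nabla g i a (F k) p A.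
Proof.
move=> ip sF; rewrite /nabla big_split/=; congr (_ + _).
  by apply: (@pd_sum _ _ _ i a p J _ _ (fun k x => F k x A)) => // k; exact: sF.
rewrite [RHS]exchange_big/=; apply: eq_bigr => k _.
rewrite [RHS]exchange_big/=; apply: eq_bigr => C _.
by rewrite mulr_sumr.
Qed.

Hypothesis hg : regular_metric g i.

Lemma tractor_form_smooth p a C D : dom i p -> smooth_near i p (fun x => tractor_form g i x a C D).
Proof.
move=> ip; have sc k : smooth_near i p (fun=> k : R) by exact: smooth_near_cst.
case: C => [|b|]; case: D => [|e|] //=.
- exact: schouten_smooth.
- by apply: smooth_nearN; exact: christoffel_smooth.
- exact: metric_smooth.
- apply: smooth_nearN; apply: smooth_near_sum => // b; apply: smooth_nearM.
    exact: schouten_smooth.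
  exact: ginv_smooth.
Qed.

Lemma nabla_smooth a p F : smooth_tensor i p F -> smooth_tensor i p (nabla g i a F).
Proof.
move=> sF B; have ip := smooth_near_dom (sF B).
apply: smooth_nearD; first by apply: smooth_near_pd; exact: sF.
apply: smooth_near_sum => // k; apply: smooth_near_sum => // C; apply: smooth_nearM.
  exact: tractor_form_smooth.
exact: sF.
Qed.

Lemma lap_smooth p F : smooth_tensor i p F -> smooth_tensor i p (lap g i F).
Proof.
move=> sF B; have ip := smooth_near_dom (sF B).
apply: smooth_near_sum => // a; apply: smooth_near_sum => // b; apply: smooth_nearM.
  exact: ginv_smooth.
apply: smooth_nearB; first by do 2!apply: nabla_smooth.
apply: smooth_near_sum => // c; apply: smooth_nearM; first exact: christoffel_smooth.
exact: nabla_smooth.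
Qed.

End NablaRules.

(** * The tractor connection under a change of scale *)

Section ScaleLawAlgebra.
Variables (R : realType) (n : nat).
Notation I := 'I_n.+1.
Variables (O : R) (u : I -> R) (g G P H dr : I -> I -> R) (Gam : I -> I -> I -> R).
Hypothesis O0 : O != 0.
Hypothesis g_sym : forall a b, g a b = g b a.
Hypothesis G_sym : forall a b, G a b = G b a.
Hypothesis gG : forall a b, \sum_e g a e * G e b = (a == b)%:R.

Let r := raised G u.
Let N := sqnorm G u.
Let hss := hess u Gam H.
(* [dr a c] is the derivative of [raised G u c] in direction [a]. *)
Hypothesis hss_lower : forall a b, hss a b = \sum_e (dr a e + \sum_f Gam e a f * r f) * g e b.

(** With [scale_alg] and [scale_deriv], a copy of the connection form, of the transition matrix and
    of its derivative in which the metric, the Schouten tensor and all derivatives are free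
    variables: the gauge law becomes an identity between finite sums at one point. *)
Definition form_alg (g' G' P' : I -> I -> R) (Gam' : I -> I -> I -> R) (a : I) (A B : slot n) : R :=
  match A, B with
  | Top, Mid b => - (a == b)%:R
  | Mid b, Top => P' a b
  | Mid b, Mid e => - Gam' e a b
  | Mid b, Bot => g' a b
  | Bot, Mid e => - \sum_b P' a b * G' b e
  | _, _ => 0
  end.

Definition scale_alg (A B : slot n) : R :=
  match A, B with
  | Top, Top => O
  | Mid b, Top => O * u b
  | Mid b, Mid e => O * (b == e)%:R
  | Bot, Top => - O^-1 * (2^-1 * N)
  | Bot, Mid e => - O^-1 * r e
  | Bot, Bot => O^-1
  | _, _ => 0
  end.

Definition scale_deriv (dN : I -> R) (a : I) (A B : slot n) : R :=
  match A, B with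
  | Top, Top => O * u a
  | Mid b, Top => O * u a * u b + O * H a b
  | Mid b, Mid e => O * u a * (b == e)%:R
  | Bot, Top => O^-1 * u a * (2^-1 * N) - O^-1 * (2^-1 * dN a)
  | Bot, Mid e => O^-1 * u a * r e - O^-1 * dr a e
  | Bot, Bot => - O^-1 * u a
  | _, _ => 0
  end.

Lemma raise_hess b c : \sum_e hss b e * G e c = dr b c + \sum_f Gam c b f * r f.
Proof.
rewrite -(contract_inv g_sym G_sym gG (fun c => dr b c + \sum_f Gam c b f * r f)).
by apply: eq_bigr => e _; rewrite -hss_lower mulrC [G e c]G_sym.
Qed.

Lemma raised_sum (X : I -> R) : \sum_e (\sum_f X f * G f e) * u e = \sum_f X f * r f.
Proof.
under eq_bigr => e _ do rewrite mulr_suml.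
rewrite exchange_big/=; apply: eq_bigr => f _; rewrite /r /raised mulr_sumr.
by apply: eq_bigr => e _; rewrite mulrA.
Qed.

Variables (dN : I -> R).
Hypothesis dN_eq : forall a, dN a = \sum_e (dr a e * u e + r e * H a e).

(** Both contractions in the derivative of [|U|^2] are rewritten covariantly; the Christoffel terms
    they produce are equal and opposite. *)
Lemma sqnorm_deriv a : dN a = 2 * \sum_e r e * hss a e.
Proof.
have e1 : \sum_e (\sum_f hss a f * G f e) * u e =
    \sum_e dr a e * u e + \sum_e (\sum_f Gam e a f * r f) * u e.
  by rewrite -big_split/=; apply: eq_bigr => e _; rewrite raise_hess mulrDl.
have e2 : \sum_e (\sum_f hss a f * G f e) * u e = \sum_e r e * hss a e.
  by rewrite raised_sum; apply: eq_bigr => e _; rewrite mulrC.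
have e3 : \sum_e r e * hss a e = \sum_e r e * H a e - \sum_e (\sum_f Gam e a f * r f) * u e.
  transitivity (\sum_e (r e * H a e - \sum_f Gam f a e * u f * r e)).
    by apply: eq_bigr => e _; rewrite /hss /hess mulrBr mulr_sumr; congr (_ - _); apply: eq_bigr => f _; ring.
  rewrite sumrB; congr (_ - _); rewrite exchange_big/=; apply: eq_bigr => e _.
  by rewrite mulr_suml; apply: eq_bigr => f _; ring.
rewrite dN_eq big_split/=.
have -> : \sum_e dr a e * u e = \sum_e r e * hss a e - \sum_e (\sum_f Gam e a f * r f) * u e.
  by rewrite -e2 e1 addrK.
by rewrite [in LHS]e3 [in RHS]e3; ring.
Qed.

(** The gauge law of the standard tractor connection, one identity for each pair of slots. The pairs
    [Mid]-[Top], [Bot]-[Top] and [Bot]-[Mid] use the law of the Schouten tensor, whose Hessian term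
    cancels the derivatives of [U] in the transition matrix. *)
Lemma scale_law_alg b A B :
  scale_deriv dN b A B + slot_mul (form_alg (fun x y => O ^+ 2 * g x y)
     (fun x y => O^-1 ^+ 2 * G x y)
     (fun x y => P x y - hss x y + u x * u y - 2^-1 * N * g x y)
     (fun z x y => Gam z x y + conf_diff g G u z x y) b) scale_alg A B =
  slot_mul scale_alg (form_alg g G P Gam b) A B.
Proof.
have uS x y : \sum_e conf_diff g G u e x y * u e = 2 * u x * u y - N * g x y.
  transitivity (\sum_e u e * conf_diff g G u e x y); first by apply: eq_bigr => e _; rewrite mulrC.
  rewrite conf_diff_up; congr (_ - _ * _); first by ring.
  by rewrite /N -raised_sqnorm; apply: eq_bigr => e _; rewrite mulrC.
have PG e : \sum_f (P b f - hss b f + u b * u f - 2^-1 * N * g b f) * (O^-1 ^+ 2 * G f e) =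
   O^-1 ^+ 2 * (\sum_f P b f * G f e - (dr b e + \sum_f Gam e b f * r f) + u b * r e - 2^-1 * N * (b == e)%:R).
  rewrite -raise_hess -gG /r /raised !mulr_sumr -!sumrB -big_split -sumrB mulr_sumr/=.
  by apply: eq_bigr => f _; rewrite [G e f]G_sym; ring.
rewrite /slot_mul !big_slot; case: A => [|c|]; case: B => [|e|]; rewrite /= ?(mul0r, mulr0, addr0, add0r).
- under eq_bigr => f _ do rewrite mulNr.
  by rewrite sumrN (sum_dl b (fun f => O * u f)) big1 ?addr0 ?subrr// => f _; rewrite mul0r.
- under eq_bigr => f _ do rewrite mulNr.
  rewrite sumrN (sum_dl b (fun f => O * (f == e)%:R)) [X in _ = _ + X]big1 ?addr0 ?mulrN// => f _.
  by rewrite mul0r.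
- by rewrite !big1 ?addr0// => f _; rewrite ?mul0r ?mulr0.
- have -> : \sum_f (- (Gam f b c + conf_diff g G u f b c) * (O * u f)) =
     - O * \sum_f Gam f b c * u f - O * (2 * u b * u c - N * g b c).
    by rewrite -uS !mulr_sumr -sumrB; apply: eq_bigr => f _; ring.
  have -> : \sum_f (O * (c == f)%:R * P b f) = O * P b c.
    rewrite -(sum_dl c (P b)) mulr_sumr; apply: eq_bigr => f _; ring.
  rewrite /hss /hess; move: (\sum_f Gam f b c * u f) => X; field; exact: O0.
- have -> : \sum_f (- (Gam f b c + conf_diff g G u f b c) * (O * (f == e)%:R)) =
     - (Gam e b c + conf_diff g G u e b c) * O.
    rewrite -(sum_dr e (fun f => - (Gam f b c + conf_diff g G u f b c) * O)).
    by apply: eq_bigr => f _; ring.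
  have -> : \sum_f (O * (c == f)%:R * - Gam e b f) = - O * Gam e b c.
    rewrite -(sum_dl c (fun f => - O * Gam e b f)); apply: eq_bigr => f _; ring.
  by rewrite /conf_diff -/r [(e == c)]eq_sym [e == b]eq_sym; field; exact: O0.
- rewrite big1 ?add0r; last by move=> f _; rewrite mulr0.
  rewrite -(sum_dl c (g b)) !mulr_sumr mulr_suml; apply: eq_bigr => f _; field; exact: O0.
- under eq_bigr => f _ do rewrite PG.
  have -> : \sum_f - (O^-1 ^+ 2 * (\sum_h P b h * G h f - (dr b f + \sum_h Gam f b h * r h)
      + u b * r f - 2^-1 * N * (b == f)%:R)) * (O * u f) =
    - O^-1 * (\sum_h P b h * r h - \sum_h r h * hss b h + u b * N - 2^-1 * N * u b).
    rewrite -raised_sum.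
    have -> : \sum_h r h * hss b h = \sum_f (\sum_h hss b h * G h f) * u f.
      by rewrite raised_sum; apply: eq_bigr => h _; rewrite mulrC.
    have rN : N = \sum_e r e * u e by rewrite /N -raised_sqnorm.
    rewrite [in u b * N]rN -[X in _ - 2^-1 * N * X](sum_dl b u).
    rewrite !mulr_sumr -!sumrB -big_split/= -sumrB mulr_sumr; apply: eq_bigr => f _.
    rewrite raise_hess; move: (\sum_h _) (\sum_h _) => X Y; field; exact: O0.
  have -> : \sum_f - O^-1 * r f * P b f = - O^-1 * \sum_f P b f * r f.
    by rewrite mulr_sumr; apply: eq_bigr => f _; ring.
  rewrite sqnorm_deriv; move: (\sum_h _ * r h) (\sum_h r h * _) => X Y.
  by field; exact: O0.
- under eq_bigr => f _ do rewrite PG.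
  have -> : \sum_f - (O^-1 ^+ 2 * (\sum_h P b h * G h f - (dr b f + \sum_h Gam f b h * r h)
      + u b * r f - 2^-1 * N * (b == f)%:R)) * (O * (f == e)%:R) =
    - (O^-1 ^+ 2 * (\sum_h P b h * G h e - (dr b e + \sum_h Gam e b h * r h)
      + u b * r e - 2^-1 * N * (b == e)%:R)) * O.
    rewrite -(sum_dr e (fun f => - (O^-1 ^+ 2 * (\sum_h P b h * G h f - (dr b f + \sum_h Gam f b h * r h)
      + u b * r f - 2^-1 * N * (b == f)%:R)) * O)).
    by apply: eq_bigr => f _; ring.
  have -> : \sum_f - O^-1 * r f * - Gam e b f = O^-1 * \sum_f Gam e b f * r f.
    by rewrite mulr_sumr; apply: eq_bigr => f _; ring.
  move: (\sum_h P b h * _) (\sum_h _ * r h) => X Y.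
  by field; exact: O0.
- rewrite big1 ?addr0; last by move=> f _; rewrite mulr0.
  have -> : \sum_f - O^-1 * r f * g b f = - O^-1 * u b.
    rewrite -(lower_raised u g_sym G_sym gG b) mulr_sumr; apply: eq_bigr => f _.
    by rewrite [g b f]g_sym mulrA.
  by [].
Qed.

End ScaleLawAlgebra.

Section ScaleLaw.
Variables (R : realType) (n : nat) (M : manifold R n) (i : chart M).
Notation I := 'I_n.+1.
Notation d := (n.+1%:R : R).
Implicit Types (p : M) (a b c e : I).
Variables (g gh : metric_field M) (Om : M -> R).
Hypothesis hg : regular_metric g i.
Hypothesis hgh : regular_metric gh i.
Hypothesis sOm : forall p, dom i p -> smooth_near i p Om.
Hypothesis Om_gt0 : forall p, 0 < Om p.
Hypothesis ghE : forall p, dom i p -> gh i p = Om p ^+ 2 *: g i p.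
Hypothesis n2 : (2 <= n)%N.

Local Notation U := (upsilon Om i).
Local Notation T := (scale_change Om g i).

Lemma scale_change_smooth p C D : dom i p -> smooth_near i p (fun x => T x C D).
Proof.
move=> ip; have sc k : smooth_near i p (fun=> k : R) by exact: smooth_near_cst.
have sV : smooth_near i p (fun x => (Om x)^-1).
  by apply: smooth_nearV; [exact: sOm|rewrite gt_eqF].
have sU a : smooth_near i p (fun x => U x a) by exact: upsilon_smooth.
have sG a b : smooth_near i p (fun x => ginv g i x a b) by exact: ginv_smooth.
have sO := sOm ip.
case: C => [|b|]; case: D => [|e|] //=.
- exact: smooth_nearM.
- exact: smooth_nearM.
- apply: smooth_nearM; first exact: smooth_nearN.
  apply: smooth_nearM => //; apply: smooth_near_sum => // a; apply: smooth_near_sum => // b.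
  by apply: smooth_nearM => //; exact: smooth_nearM.
- apply: smooth_nearM; first exact: smooth_nearN.
  by apply: smooth_near_sum => // a; apply: smooth_nearM.
Qed.

End ScaleLaw.

Section ScaleCovariance.
Variables (R : realType) (n : nat) (M : manifold R n) (i : chart M).
Notation I := 'I_n.+1.
Notation d := (n.+1%:R : R).
Implicit Types (p : M) (a b c e : I).
Variables (g gh : metric_field M) (Om : M -> R).
Hypothesis hg : regular_metric g i.
Hypothesis hgh : regular_metric gh i.
Hypothesis sOm : forall p, dom i p -> smooth_near i p Om.
Hypothesis Om_gt0 : forall p, 0 < Om p.
Hypothesis ghE : forall p, dom i p -> gh i p = Om p ^+ 2 *: g i p.
Hypothesis n2 : (2 <= n)%N.

Local Notation U := (upsilon Om i).
Local Notation T := (scale_change Om g i).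
Local Notation gp p := (fun a b => g i p a b).
Local Notation Gp p := (ginv g i p).
Local Notation Gam p := (fun c a b => christoffel g i c a b p).
Local Notation H p := (fun a b => pd i a (fun q => U q b) p).
Local Notation hessp p := (hess (U p) (Gam p) (H p)).
Local Notation trp p := (trhess (Gp p) (U p) (Gam p) (H p)).
Local Notation N p := (sqnorm (Gp p) (U p)).
Local Notation r p := (raised (Gp p) (U p)).
Local Notation dr p := (fun x c => pd i x (fun q => raised (Gp q) (U q) c) p).

Lemma scale_changeE p C D : dom i p -> T p C D = scale_alg (Om p) (U p) (Gp p) C D.
Proof.
move=> ip; case: C => [|c|]; case: D => [|e|] //=.
by congr (_ * _); apply: eq_bigr => b _; rewrite (ginv_sym hg).
Qed.

Lemma hess_lower_at p a b : dom i p ->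
  hessp p a b = \sum_e (dr p a e + \sum_f christoffel g i e a f p * r p f) * g i p e b.
Proof.
move=> ip.
exact: (@hess_lower R n (gp p) (Gp p) (U p) (fun x y => metric_tensor_sym hg x y ip)
  (fun x y => ginv_sym hg x y ip) (fun x y => metric_ginv hg x y ip) (Gam p)
  (fun a b c => pd i a (fun q => g i q b c) p) (H p) (dr p)
  (fun a b c => christoffel_metric hg a b c ip) (fun a b => raised_deriv hg sOm Om_gt0 a b ip)).
Qed.

Lemma sqnorm_smooth p : dom i p -> smooth_near i p (fun q => N q).
Proof.
move=> ip; apply: smooth_near_sum => // a; apply: smooth_near_sum => // b.
apply: smooth_nearM; last exact: upsilon_smooth.
by apply: smooth_nearM; [exact: ginv_smooth|exact: upsilon_smooth].
Qed.

Lemma pd_sqnorm p a : dom i p ->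
  pd i a (fun q => N q) p = \sum_e (dr p a e * U p e + r p e * H p a e).
Proof.
move=> ip.
have -> : (fun q => N q) = fun q => \sum_e r q e * U q e.
  by apply/funext => q; rewrite raised_sqnorm.
have sr e : smooth_near i p (fun q => r q e) by exact: raised_smooth.
have sU e : smooth_near i p (fun q => U q e) by exact: upsilon_smooth.
apply: etrans (@pd_sum _ _ _ i a p I _ _ (fun e q => r q e * U q e) ip _) _.
  by move=> e; exact: smooth_nearM.
by apply: eq_bigr => e _; exact: pdM.
Qed.

Lemma pd_scale_change p b C D : dom i p -> pd i b (fun x => T x C D) p =
  scale_deriv (Om p) (U p) (Gp p) (H p) (dr p) (fun a => pd i a (fun q => N q) p) b C D.
Proof.
move=> ip.
have O0 : Om p != 0 by rewrite gt_eqF.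
have sU e : smooth_near i p (fun q => U q e) by exact: upsilon_smooth.
have sr e : smooth_near i p (fun q => r q e) by exact: raised_smooth.
have sO := sOm ip.
have sV : smooth_near i p (fun x => (Om x)^-1) by exact: smooth_nearV.
have sN := sqnorm_smooth ip.
have pO : pd i b Om p = Om p * U p b by exact: pd_Om.
have pV : pd i b (fun x => (Om x)^-1) p = - (Om p)^-1 * U p b.
  by rewrite (pdV b sO O0) pO; field; exact: O0.
have pNV : pd i b (fun x => - (Om x)^-1) p = (Om p)^-1 * U p b.
  by rewrite (pdN b sV) pV mulNr opprK.
have sc k : smooth_near i p (fun=> k : R) by exact: smooth_near_cst.
case: C => [|c|]; case: D => [|e|] /=.
- exact: pO.
- exact: pd_cst.
- exact: pd_cst.
- by rewrite (pdM b sO (sU c)) pO.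
- by rewrite (pdM b sO (sc _)) pO pd_cst mulr0 addr0.
- exact: pd_cst.
- have -> : pd i b (fun x => - (Om x)^-1 * (2^-1 * \sum_a \sum_b0 ginv g i x a b0 * U x a * U x b0)) p
     = pd i b (fun x => - (Om x)^-1 * (2^-1 * N x)) p by [].
  rewrite (pdM b (smooth_nearN sV) (smooth_nearM (sc _) sN)) pNV (pdZ b _ sN).
  by rewrite mulNr.
- transitivity (pd i b (fun x => - (Om x)^-1 * r x e) p).
    apply: (pd_ext b (dom_open i)) => // q _ iq; congr (_ * _).
    by apply: eq_bigr => f _; rewrite (ginv_sym hg).
  by rewrite (pdM b (smooth_nearN sV) (sr e)) pNV mulNr.
- exact: pV.
Qed.

Lemma form_conf p b C D : dom i p -> tractor_form gh i p b C D =
  form_alg (fun x y => Om p ^+ 2 * g i p x y) (fun x y => (Om p)^-1 ^+ 2 * ginv g i p x y)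
     (fun x y => schouten g i x y p - hessp p x y + U p x * U p y - 2^-1 * N p * g i p x y)
     (fun z x y => christoffel g i z x y p + conf_diff (gp p) (Gp p) (U p) z x y) b C D.
Proof.
move=> ip; case: C => [|c|]; case: D => [|e|] //=.
- exact: schouten_conf.
- by congr (- _); exact: christoffel_conf.
- exact: ghE'.
- congr (- _); apply: eq_bigr => f _; congr (_ * _); first exact: schouten_conf.
  exact: ginv_conf.
Qed.

Lemma scale_law p b C D : dom i p ->
  pd i b (fun x => T x C D) p + slot_mul (tractor_form gh i p b) (T p) C D =
  slot_mul (T p) (tractor_form g i p b) C D.
Proof.
move=> ip.
have O0 : Om p != 0 by rewrite gt_eqF.
have := @scale_law_alg R n (Om p) (U p) (gp p) (Gp p) (fun x y => schouten g i x y p) (H p) (dr p)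
  (Gam p) O0 (fun x y => metric_tensor_sym hg x y ip)
  (fun x y => ginv_sym hg x y ip) (fun x y => metric_ginv hg x y ip)
  (fun a b => hess_lower_at a b ip) (fun a => pd i a (fun q => N q) p)
  (fun a => pd_sqnorm a ip) b C D.
move=> E.
have e1 : slot_mul (scale_alg (Om p) (U p) (Gp p))
    (form_alg (gp p) (Gp p) (fun x y => schouten g i x y p) (Gam p) b) C D =
    slot_mul (T p) (tractor_form g i p b) C D.
  by apply: eq_bigr => k _; congr (_ * _); exact/esym/scale_changeE.
apply: etrans (etrans E e1); congr (_ + _); first exact: pd_scale_change.
by apply: eq_bigr => k _; congr (_ * _); [exact: form_conf|exact: scale_changeE].
Qed.

Variable m : nat.
Implicit Types (F : M -> tensor R n m) (A B : multi n m).

Definition rescaled (w : R) F : M -> tensor R n m :=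
  fun x B => Om x `^ w * tens_act (T x) (F x) B.

Lemma pd_Om_powR (w : R) p b : dom i p -> pd i b (fun x => Om x `^ w) p = Om p `^ w * (w * U p b).
Proof.
move=> ip; rewrite (pd_powR b w (sOm ip) Om_gt0) pd_Om//.
have -> : Om p `^ w = Om p `^ (w - 1) * Om p.
  have := @powRD _ (Om p) (w - 1) 1; rewrite subrK powRr1 ?(ltW (Om_gt0 p))// => -> //.
  by rewrite (gt_eqF (Om_gt0 p)) implybT.
ring.
Qed.

Lemma nabla_rescaled w F p b A : dom i p -> smooth_tensor i p F ->
  nabla gh i b (rescaled w F) p A =
  rescaled w (fun x B => nabla g i b F x B + w * U x b * F x B) p A.
Proof.
move=> ip sF.
have := @nabla_gauge R n M m g gh i i p b T (fun x => Om x `^ w) (w * U p b) (fun a => (a == b)%:R) F A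
  ip ip (fun C D => scale_change_smooth hg sOm Om_gt0 C D ip) sF (smooth_near_powR w (sOm ip) Om_gt0).
rewrite /rescaled => ->.
- congr (_ * _); apply: eq_bigr => B _; congr (_ * (_ + _)).
  exact: (sum_dr b (fun a => nabla g i a F p B)).
- by move=> G _; rewrite (sum_dr b (fun a => pd i a G p)).
- move=> C D; rewrite scale_law// (sum_dr b (fun a => slot_mul (T p) (tractor_form g i p a) C D)).
  by [].
- exact: pd_Om_powR.
Qed.

End ScaleCovariance.

Section TensorActionLinear.
Variables (R : realType) (n m : nat).
Notation I := 'I_n.+1.
Implicit Types (T : slot n -> slot n -> R) (A B : multi n m).

Lemma tens_act_eq T (t t' : tensor R n m) A : (forall B, t B = t' B) ->
  tens_act T t A = tens_act T t' A.
Proof. by move=> H; apply: eq_bigr => B _; rewrite H. Qed.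

Lemma tens_actD T (t t' : tensor R n m) A :
  tens_act T (fun B => t B + t' B) A = tens_act T t A + tens_act T t' A.
Proof. exact: (@fam_actD R n m (fun=> T) t t' A). Qed.

Lemma tens_actZ T (c : R) (t : tensor R n m) A :
  tens_act T (fun B => c * t B) A = c * tens_act T t A.
Proof. exact: (@fam_actZ R n m (fun=> T) c t A). Qed.

Lemma tens_actB T (t t' : tensor R n m) A :
  tens_act T (fun B => t B - t' B) A = tens_act T t A - tens_act T t' A.
Proof.
rewrite -[- tens_act T t' A]mulN1r -tens_actZ -tens_actD.
by apply: tens_act_eq => B; rewrite mulN1r.
Qed.

Lemma tens_act_sum T (J : finType) (ts : J -> tensor R n m) A :
  tens_act T (fun B => \sum_k ts k B) A = \sum_k tens_act T (ts k) A.
Proof. exact: (@fam_act_sum R n m J (fun=> T) ts A). Qed.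

Lemma tens_act_lap T (G : I -> I -> R) (Gam : I -> I -> I -> R)
    (X : I -> I -> tensor R n m) (Y : I -> tensor R n m) A :
  tens_act T (fun B => \sum_a \sum_b G a b * (X a b B - \sum_c Gam c a b * Y c B)) A =
  \sum_a \sum_b G a b * (tens_act T (X a b) A - \sum_c Gam c a b * tens_act T (Y c) A).
Proof.
rewrite tens_act_sum; apply: eq_bigr => a _.
rewrite tens_act_sum; apply: eq_bigr => b _.
rewrite tens_actZ tens_actB tens_act_sum; congr (_ * (_ - _)).
by apply: eq_bigr => c _; rewrite tens_actZ.
Qed.

End TensorActionLinear.

Lemma tens_act0 (R : realType) (n : nat) (T : slot n -> slot n -> R) (t : tensor R n 0)
  (A : multi n 0) : tens_act T t A = t A.
Proof.
rewrite /tens_act (bigD1 A)//= big_ord0 mul1r big1 ?addr0// => B /eqP BA.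
by case: BA; apply/ffunP => -[].
Qed.

(** * The Laplacian and I.D under a change of scale *)

Section LaplacianAlgebra.
Variables (R : realFieldType) (n : nat).
Notation I := 'I_n.+1.
Notation d := (n.+1%:R : R).
Variables (O w J f : R) (U : I -> R) (g G : I -> I -> R) (Gam : I -> I -> I -> R)
  (H : I -> I -> R) (t : I -> I -> R) (k : I -> R).
Hypothesis g_sym : forall a b, g a b = g b a.
Hypothesis G_sym : forall a b, G a b = G b a.
Hypothesis gG : forall a b, \sum_e g a e * G e b = (a == b)%:R.

Lemma trace_conf_diff c : \sum_a \sum_b G a b * conf_diff g G U c a b = (2 - d) * raised G U c.
Proof.
have gd : \sum_a \sum_b G a b * g a b = d.
  transitivity (\sum_(a : I) (1 : R)); last by rewrite sumr_const card_ord.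
  apply: eq_bigr => a _; have e1 : (1 : R) = (a == a)%:R by rewrite eqxx.
  by rewrite e1 -gG; apply: eq_bigr => e _; rewrite mulrC G_sym.
have e1 : \sum_a \sum_b G a b * ((c == a)%:R * U b) = raised G U c.
  rewrite -(sum_dl c (raised G U)); apply: eq_bigr => a _; rewrite /raised mulr_sumr.
  by apply: eq_bigr => b _; ring.
have e2 : \sum_a \sum_b G a b * ((c == b)%:R * U a) = raised G U c.
  rewrite exchange_big/= -e1; apply: eq_bigr => a _; apply: eq_bigr => b _.
  by rewrite G_sym.
have e3 : \sum_a \sum_b G a b * (raised G U c * g a b) = raised G U c * d.
  rewrite -gd mulr_sumr; apply: eq_bigr => a _; rewrite mulr_sumr.
  by apply: eq_bigr => b _; rewrite mulrCA.
transitivity (raised G U c + raised G U c - raised G U c * d); last by ring.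
rewrite -e3 -[X in _ = X + _ - _]e1 -[X in _ = _ + X - _]e2 -big_split/= -sumrB; apply: eq_bigr => a _.
rewrite -big_split/= -sumrB; apply: eq_bigr => b _.
by rewrite /conf_diff; ring.
Qed.

(** Here [t] and [k] stand for the second and first tractor derivatives of a component [f]. All
    second derivatives of [Omega] are absorbed by the law of [J], and the remaining defect is of
    first order with the factor [d + 2 w - 2], zero at the weight of the conformally invariant
    Yamabe operator. *)
Lemma laplacian_alg :
  \sum_a \sum_b (O^-1 ^+ 2 * G a b) * (t a b + (w * H a b * f + w * U b * k a) +
      w * U a * (k b + w * U b * f)
    - \sum_c (Gam c a b + conf_diff g G U c a b) * (k c + w * U c * f))
  + w * (O^-1 ^+ 2 * (J - trhess G U Gam H - (d - 2) / 2 * sqnorm G U)) * f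
  = O^-1 ^+ 2 * (\sum_a \sum_b G a b * (t a b - \sum_c Gam c a b * k c) + w * J * f
     + (d + 2 * w - 2) * (\sum_a \sum_b G a b * U a * k b + w / 2 * sqnorm G U * f)).
Proof.
pose X := \sum_a \sum_b G a b * U a * k b.
have X' : \sum_a \sum_b G a b * U b * k a = X.
  rewrite exchange_big/=; apply: eq_bigr => a _; apply: eq_bigr => b _.
  by rewrite G_sym.
have rk : \sum_c raised G U c * k c = X.
  rewrite -X'; apply: eq_bigr => c _; rewrite /raised mulr_suml.
  by apply: eq_bigr => b _.
have cS : \sum_a \sum_b G a b * (\sum_c conf_diff g G U c a b * (k c + w * U c * f))
   = (2 - d) * (X + w * sqnorm G U * f).
  transitivity (\sum_c (\sum_a \sum_b G a b * conf_diff g G U c a b) * (k c + w * U c * f)).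
    under eq_bigr => a _ do under eq_bigr => b _ do rewrite mulr_sumr.
    under eq_bigr => a _ do rewrite exchange_big/=.
    rewrite exchange_big/=; apply: eq_bigr => c _; rewrite mulr_suml; apply: eq_bigr => a _.
    by rewrite mulr_suml; apply: eq_bigr => b _; rewrite mulrA.
  under eq_bigr => c _ do rewrite trace_conf_diff.
  rewrite -rk -raised_sqnorm mulr_sumr !mulr_suml -big_split mulr_sumr/=.
  by apply: eq_bigr => c _; ring.
have cG : \sum_a \sum_b G a b * (\sum_c Gam c a b * (w * U c * f)) =
   w * f * \sum_a \sum_b G a b * \sum_c Gam c a b * U c.
  rewrite mulr_sumr; apply: eq_bigr => a _; rewrite mulr_sumr; apply: eq_bigr => b _.
  rewrite mulrCA; congr (_ * _); rewrite mulr_sumr; apply: eq_bigr => c _; ring.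
have tr : trhess G U Gam H = \sum_a \sum_b G a b * H a b - \sum_a \sum_b G a b * \sum_c Gam c a b * U c.
  rewrite -sumrB; apply: eq_bigr => a _; rewrite -sumrB; apply: eq_bigr => b _.
  by rewrite /hess mulrBr.
pose S1 := \sum_a \sum_b G a b * (t a b - \sum_c Gam c a b * k c).
pose S2 := \sum_a \sum_b G a b * H a b.
have E : \sum_a \sum_b (O^-1 ^+ 2 * G a b) * (t a b + (w * H a b * f + w * U b * k a) +
      w * U a * (k b + w * U b * f)
    - \sum_c (Gam c a b + conf_diff g G U c a b) * (k c + w * U c * f)) =
  O^-1 ^+ 2 * (S1 + w * f * S2 + w * X + w * X + w ^+ 2 * f * sqnorm G U
     - w * f * \sum_a \sum_b G a b * (\sum_c Gam c a b * U c) - (2 - d) * (X + w * sqnorm G U * f)).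
  rewrite -cG -cS -{1}X' /S1 /S2 /X /sqnorm !mulr_sumr -!big_split/= -!sumrB mulr_sumr.
  apply: eq_bigr => a _; rewrite !mulr_sumr -!big_split/= -!sumrB mulr_sumr.
  apply: eq_bigr => b _.
  have -> : \sum_c (Gam c a b + conf_diff g G U c a b) * (k c + w * U c * f) =
    \sum_c Gam c a b * k c + \sum_c Gam c a b * (w * U c * f) + \sum_c conf_diff g G U c a b * (k c + w * U c * f).
    by rewrite -!big_split/=; apply: eq_bigr => c _; ring.
  move: (\sum_c _) (\sum_c _) (\sum_c _) => x y z; ring.
rewrite E tr -/S2; move: (\sum_a \sum_b _ * \sum_c Gam c a b * U c) (sqnorm G U) => Y N.
rewrite -/S1 -/X.
clear; clearbody S1 S2 X; move: (O^-1 ^+ 2) => o.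
by field.
Qed.

End LaplacianAlgebra.

Section ScaleLaplacian.
Variables (R : realType) (n : nat) (M : manifold R n) (i : chart M).
Notation I := 'I_n.+1.
Notation d := (n.+1%:R : R).
Implicit Types (p : M) (a b c e : I).
Variables (g gh : metric_field M) (Om : M -> R).
Hypothesis hg : regular_metric g i.
Hypothesis hgh : regular_metric gh i.
Hypothesis sOm : forall p, dom i p -> smooth_near i p Om.
Hypothesis Om_gt0 : forall p, 0 < Om p.
Hypothesis ghE : forall p, dom i p -> gh i p = Om p ^+ 2 *: g i p.
Hypothesis n2 : (2 <= n)%N.
Local Notation U := (upsilon Om i).
Local Notation T := (scale_change Om g i).

Definition yamabe m (g' : metric_field M) (w : R) (F : M -> tensor R n m) p : tensor R n m :=
  fun B => lap g' i F p B + w * schoutenJ g' i p * F p B.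

(** The law of the tractor derivative is applied twice: after the first time the result is again a
    rescaled field of weight [w], its coordinate index being a mere label. The Christoffel symbols
    correct that index afterwards, in [laplacian_alg]. *)
Lemma yamabe_rescaled m (w : R) (F : M -> tensor R n m) p A : dom i p ->
  (forall q, dom i q -> smooth_tensor i q F) ->
  yamabe gh w (rescaled i g Om w F) p A = (Om p)^-1 ^+ 2 *
  rescaled i g Om w (fun x B => yamabe g w F x B + (d + 2 * w - 2) *
     (\sum_a \sum_b ginv g i x a b * U x a * nabla g i b F x B
       + w / 2 * sqnorm (ginv g i x) (U x) * F x B)) p A.
Proof.
move=> ip sF.
pose Gb b x B := nabla g i b F x B + w * U x b * F x B.
have sU q b : dom i q -> smooth_near i q (fun x => w * U x b).
  by move=> iq; apply: smooth_nearM; [exact: smooth_near_cst|exact: upsilon_smooth].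
have sGb q b : dom i q -> smooth_tensor i q (Gb b).
  move=> iq B; apply: smooth_nearD; first exact: (nabla_smooth hg b (sF q iq) B).
  by apply: smooth_nearM; [exact: sU|exact: sF].
pose X a b B := nabla g i a (nabla g i b F) p B + (w * pd i a (fun q => U q b) p * F p B
   + w * U p b * nabla g i a F p B) + w * U p a * (nabla g i b F p B + w * U p b * F p B).
have e1 a b : nabla gh i a (nabla gh i b (rescaled i g Om w F)) p A =
    Om p `^ w * tens_act (T p) (X a b) A.
  transitivity (nabla gh i a (rescaled i g Om w (Gb b)) p A).
    apply: (nabla_ext gh a A (dom_open i)) => // q iq _ B.
    exact: (nabla_rescaled hg hgh sOm Om_gt0 ghE n2 w b B iq (sF q iq)).
  rewrite (nabla_rescaled hg hgh sOm Om_gt0 ghE n2 w a A ip (sGb p b ip)).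
  congr (_ * _); apply: tens_act_eq => B; rewrite /X /Gb; congr (_ + _).
  rewrite (nablaD g a B (nabla_smooth hg b (sF p ip))); last first.
    by move=> C; apply: smooth_nearM; [exact: sU|exact: sF].
  congr (_ + _); rewrite (nablaM g a B (sU p b ip) (sF p ip)); congr (_ * _ + _).
  exact: (pdZ a w (upsilon_smooth sOm Om_gt0 b ip)).
have e2 c : nabla gh i c (rescaled i g Om w F) p A = Om p `^ w * tens_act (T p) (Gb c p) A.
  exact: (nabla_rescaled hg hgh sOm Om_gt0 ghE n2 w c A ip (sF p ip)).
have e3 : lap gh i (rescaled i g Om w F) p A = Om p `^ w * tens_act (T p)
   (fun B => \sum_a \sum_b ginv gh i p a b * (X a b B - \sum_c christoffel gh i c a b p * Gb c p B)) A.
  rewrite tens_act_lap mulr_sumr; apply: eq_bigr => a _; rewrite mulr_sumr; apply: eq_bigr => b _.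
  rewrite e1 mulrCA; congr (_ * _); rewrite mulrBr; congr (_ - _).
  by rewrite mulr_sumr; apply: eq_bigr => c _; rewrite e2 mulrCA.
have e4 : w * schoutenJ gh i p * rescaled i g Om w F p A = Om p `^ w * tens_act (T p)
   (fun B => w * schoutenJ gh i p * F p B) A.
  by apply: etrans (mulrCA _ _ _) _; congr (_ * _); exact/esym/tens_actZ.
rewrite /yamabe; apply: etrans (congr2 +%R e3 e4) _.
rewrite -mulrDr -tens_actD; apply: etrans _ (mulrCA (Om p `^ w) ((Om p)^-1 ^+ 2) _).
congr (_ * _); apply: etrans _ (tens_actZ _ _ _ _).
apply: tens_act_eq => B.
have := @laplacian_alg R n (Om p) w (schoutenJ g i p) (F p B) (U p) (fun a b => g i p a b) (ginv g i p)
  (fun c a b => christoffel g i c a b p) (fun a b => pd i a (fun q => U q b) p)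
  (fun a b => nabla g i a (nabla g i b F) p B) (fun a => nabla g i a F p B)
  (fun x y => ginv_sym hg x y ip) (fun x y => metric_ginv hg x y ip).
move=> E; apply: etrans E; congr (_ + _).
  apply: eq_bigr => a _; apply: eq_bigr => b _; congr (_ * (_ - _)).
    exact: ginv_conf.
  by apply: eq_bigr => c _; congr (_ * _); exact: christoffel_conf.
by congr (_ * _ * _); exact: schoutenJ_conf.
Qed.

End ScaleLaplacian.

Section IdotOperator.
Variables (R : realType) (n : nat) (M : manifold R n).
Notation I := 'I_n.+1.
Notation d := (n.+1%:R : R).
Implicit Types (g : metric_field M) (i : chart M) (p : M) (f : M -> R).

(** Functions as tensors without indices, which lets [lap_density] and [I^2] inherit the results on
    tensors. *)
Definition scalar_tensor f : M -> tensor R n 0 := fun x _ => f x.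

Lemma nabla_scalar g i a f p A : nabla g i a (scalar_tensor f) p A = pd i a f p.
Proof. by rewrite /nabla big_ord0 addr0. Qed.

Lemma lap_scalar g i f p A : lap g i (scalar_tensor f) p A = lap_density g i f p.
Proof.
apply: eq_bigr => a _; apply: eq_bigr => b _; congr (_ * (_ - _)).
  rewrite /nabla big_ord0 addr0; congr (pd i a _ p); apply/funext => x.
  by rewrite big_ord0 addr0.
by apply: eq_bigr => c _; rewrite nabla_scalar.
Qed.

Definition grad_pair m g i f (F : M -> tensor R n m) p A :=
  \sum_a \sum_b ginv g i p a b * pd i a f p * nabla g i b F p A.

(* [I.D F] in a scale: the density [f] of weight 1 has scale tractor
   (f, df, - (Delta f + J f) / d). *)
Definition idot m g i f (w : R) (F : M -> tensor R n m) p A :=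
  - f p * yamabe i g w F p A
  - d^-1 * (lap_density g i f p + schoutenJ g i p * f p) * ((d + 2 * w - 2) * w) * F p A
  + (d + 2 * w - 2) * grad_pair g i f F p A.

Lemma IdotDE m (sigma : density M) w (F : tractor_field M m) g i p A :
  IdotD sigma w F g i p A = idot g i (sigma g) w (F g i) p A.
Proof.
rewrite /IdotD /tractor_metric /scale_tractor /thomasD /idot /yamabe /grad_pair.
congr (_ + _).
  by rewrite mulNr mulrN !mulNr !mulrA.
rewrite mulr_sumr; apply: eq_bigr => a _; rewrite mulr_sumr; apply: eq_bigr => b _.
by rewrite mulrCA.
Qed.

End IdotOperator.

Section ScaleIdot.
Variables (R : realType) (n : nat) (M : manifold R n) (i : chart M).
Notation I := 'I_n.+1.
Notation d := (n.+1%:R : R).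
Implicit Types (p : M) (a b c e : I).
Variables (g gh : metric_field M) (Om : M -> R).
Hypothesis hg : regular_metric g i.
Hypothesis hgh : regular_metric gh i.
Hypothesis sOm : forall p, dom i p -> smooth_near i p Om.
Hypothesis Om_gt0 : forall p, 0 < Om p.
Hypothesis ghE : forall p, dom i p -> gh i p = Om p ^+ 2 *: g i p.
Hypothesis n2 : (2 <= n)%N.
Local Notation U := (upsilon Om i).
Local Notation T := (scale_change Om g i).
Variables (f fh : M -> R).
Hypothesis sf : forall p, dom i p -> smooth_near i p f.
Hypothesis fhE : forall p, fh p = Om p `^ 1 * f p.

Lemma fhE' : fh = fun p => Om p * f p.
Proof. by apply/funext => p; rewrite fhE powRr1// ltW. Qed.

Lemma pd_fh p a : dom i p -> pd i a fh p = Om p * (pd i a f p + U p a * f p).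
Proof.
move=> ip; rewrite fhE' (pdM a (sOm ip) (sf ip)) pd_Om//; ring.
Qed.

(** At weight one the factor [d + 2 w - 2] is [d], which the normalisation of the scale tractor
    divides out: this is the transformation of its last slot. *)
Lemma yamabe_fh p : dom i p -> lap_density gh i fh p + schoutenJ gh i p * fh p =
  (Om p)^-1 * (lap_density g i f p + schoutenJ g i p * f p +
    d * (\sum_a \sum_b ginv g i p a b * U p a * pd i b f p + 2^-1 * sqnorm (ginv g i p) (U p) * f p)).
Proof.
move=> ip; pose A0 : multi n 0 := [ffun=> Top].
have := @yamabe_rescaled R n M i g gh Om hg hgh sOm Om_gt0 ghE n2 0 1 (scalar_tensor f) p A0 ip
  (fun q iq B => sf iq).
have -> : rescaled i g Om 1 (scalar_tensor f) = scalar_tensor fh.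
  by apply/funext => x; apply/funext => B; rewrite /rescaled tens_act0 /scalar_tensor fhE.
rewrite /yamabe lap_scalar mul1r => ->.
rewrite /rescaled tens_act0 lap_scalar powRr1 ?ltW// /scalar_tensor.
have -> : \sum_a \sum_b ginv g i p a b * U p a * nabla g i b (fun x _ => f x) p A0
   = \sum_a \sum_b ginv g i p a b * U p a * pd i b f p.
  by apply: eq_bigr => a _; apply: eq_bigr => b _; rewrite (@nabla_scalar _ _ _ g i b f p A0).
have O0 : Om p != 0 by rewrite gt_eqF.
move: (\sum_a _) (lap_density g i f p) (schoutenJ g i p) (sqnorm _ _) (f p) (Om p) O0 => X L J N y O O0.
by field; rewrite O0.
Qed.

(** Three defects meet: those of the Laplacian, of the last slot of the scale tractor and of the
    pairing of gradients. In I.D all are multiples of [d + 2 w - 2], and their sum is zero; this is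
    the invariance of the tractor pairing of [I] with the Thomas operator. *)
Lemma idot_rescaled m (w : R) (F : M -> tensor R n m) p A : dom i p ->
  (forall q, dom i q -> smooth_tensor i q F) ->
  idot gh i fh w (rescaled i g Om w F) p A =
  Om p `^ (w - 1) * tens_act (T p) (idot g i f w F p) A.
Proof.
move=> ip sF.
have O0 : Om p != 0 by rewrite gt_eqF.
pose K := d + 2 * w - 2.
pose W := \sum_a \sum_b ginv g i p a b * U p a * pd i b f p.
pose N := sqnorm (ginv g i p) (U p).
pose X B := \sum_a \sum_b ginv g i p a b * U p a * nabla g i b F p B.
pose L := lap_density g i f p + schoutenJ g i p * f p.
have e1 : yamabe i gh w (rescaled i g Om w F) p A = (Om p)^-1 ^+ 2 * (Om p `^ w * tens_act (T p)
    (fun B => yamabe i g w F p B + K * (X B + w / 2 * N * F p B)) A).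
  exact: (yamabe_rescaled hg hgh sOm Om_gt0 ghE n2 w A ip sF).
have e2 : grad_pair gh i fh (rescaled i g Om w F) p A = Om p `^ w * tens_act (T p) (fun B =>
   \sum_a \sum_b ((Om p)^-1 * ginv g i p a b * (pd i a f p + U p a * f p)) * (nabla g i b F p B + w * U p b * F p B)) A.
  rewrite tens_act_sum mulr_sumr; apply: eq_bigr => a _.
  rewrite tens_act_sum mulr_sumr; apply: eq_bigr => b _.
  rewrite tens_actZ (nabla_rescaled hg hgh sOm Om_gt0 ghE n2 w b A ip (sF p ip)).
  rewrite /rescaled; apply: etrans (mulrCA _ _ _) _; congr (_ * _); congr (_ * _).
  rewrite (ginv_conf hg hgh ghE _ _ ip) (pd_fh a ip).
  by move: (ginv g i p a b) (_ + _) => x y; field.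
have e3 : rescaled i g Om w F p A = Om p `^ w * tens_act (T p) (F p) A by [].
have e4 := yamabe_fh ip.
rewrite /idot e1 e2 e3 e4 fhE' -/L -/W -/N -/K.
transitivity (Om p `^ w * tens_act (T p) (fun B =>
  (- (Om p * f p) * (Om p)^-1 ^+ 2) * (yamabe i g w F p B + K * (X B + w / 2 * N * F p B))
  + (- d^-1 * ((Om p)^-1 * (L + d * (W + 2^-1 * N * f p))) * (K * w)) * F p B
  + K * (\sum_a \sum_b ((Om p)^-1 * ginv g i p a b * (pd i a f p + U p a * f p)) * (nabla g i b F p B + w * U p b * F p B))) A).
  rewrite [X in _ = _ * X]tens_actD [X in _ = _ * (X + _)]tens_actD !tens_actZ.
  move: (tens_act _ _ _) (tens_act _ _ _) (tens_act _ _ _) => t1 t2 t3; ring.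
have -> : Om p `^ (w - 1) = Om p `^ w * (Om p)^-1.
  have := @powRD _ (Om p) (w - 1) 1; rewrite subrK powRr1 ?(ltW (Om_gt0 p))// => -> //.
    by rewrite mulfK.
  by rewrite (gt_eqF (Om_gt0 p)) implybT.
rewrite -[RHS]mulrA; congr (_ * _); apply: etrans _ (tens_actZ _ _ _ _).
apply: tens_act_eq => B.
have e5 : \sum_a \sum_b ((Om p)^-1 * ginv g i p a b * (pd i a f p + U p a * f p)) * (nabla g i b F p B + w * U p b * F p B)
   = (Om p)^-1 * (grad_pair g i f F p B + w * W * F p B + f p * X B + w * f p * N * F p B).
  have W' : W = \sum_a \sum_b ginv g i p a b * pd i a f p * U p b.
    rewrite /W exchange_big/=; apply: eq_bigr => a _; apply: eq_bigr => b _.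
    by rewrite (ginv_sym hg _ _ ip) mulrAC.
  rewrite W' /grad_pair /X /N /sqnorm !mulr_sumr !mulr_suml -!big_split mulr_sumr/=.
  apply: eq_bigr => a _; rewrite !mulr_sumr !mulr_suml -!big_split mulr_sumr/=.
  apply: eq_bigr => b _.
  by move: (pd i a f p) (nabla g i b F p B) (ginv g i p a b) => x y z; ring.
rewrite e5 /idot -/K -/L.
have d0 : d != 0 by rewrite pnatr_eq0.
move: (grad_pair _ _ _ _ _ _) (yamabe _ _ _ _ _ _) (X B) (F p B) (f p) d d0 => x y z t u dd d0.
clear e1 e2 e3 e4 e5 sf hg hgh sOm ghE fhE; clearbody W N L K.
move: (Om p) O0 => O O0.
by field; rewrite O0 d0.
Qed.

End ScaleIdot.

(** * I.D under a change of chart *)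

Section ChartLawAlgebra.
Variables (R : realType) (n : nat).
Notation I := 'I_n.+1.
Variables (E : I -> I -> R) (dE : I -> I -> I -> R) (g G P g' G' P' : I -> I -> R)
  (Gam Gam' : I -> I -> I -> R).
Hypothesis GamE : forall e b c, \sum_f E e f * Gam' f b c =
  \sum_a \sum_f E a b * E f c * Gam e a f + dE b e c.
Hypothesis PE : forall b c, P' b c = \sum_e \sum_f E e b * E f c * P e f.
Hypothesis gE : forall b c, g' b c = \sum_e \sum_f E e b * E f c * g e f.
Hypothesis PGE : forall b e, \sum_f (\sum_x P' b x * G' x f) * E e f =
  \sum_a E a b * \sum_x P a x * G x e.

Definition chart_alg (A B : slot n) : R :=
  match A, B with
  | Top, Top => 1
  | Mid b, Mid e => E e b
  | Bot, Bot => 1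
  | _, _ => 0
  end.

Definition chart_deriv (b : I) (A B : slot n) : R :=
  match A, B with
  | Mid c, Mid e => dE b e c
  | _, _ => 0
  end.

(** Only the middle slots see the coordinates. The inhomogeneous term of the Christoffel symbols
    cancels the derivative of the Jacobian; [PGE] is the covariance of the Schouten tensor with one
    index raised. *)
Lemma chart_law_alg b A B :
  chart_deriv b A B + slot_mul (form_alg g' G' P' Gam' b) chart_alg A B =
  \sum_a E a b * slot_mul chart_alg (form_alg g G P Gam a) A B.
Proof.
rewrite /slot_mul.
under [RHS]eq_bigr => a _ do rewrite big_slot.
rewrite big_slot; case: A => [|c|]; case: B => [|e|]; rewrite /= ?(mul0r, mulr0, addr0, add0r).
- rewrite big1 ?add0r; last by move=> f _; rewrite mulr0.
  by rewrite big1// => a _; rewrite big1 ?addr0 ?mulr0 ?add0r ?mulr0// => f _; rewrite mul0r.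
- transitivity (- E e b).
    rewrite -(sum_dl b (fun f => E e f)) -sumrN; apply: eq_bigr => f _; by rewrite mulNr.
  rewrite -(sum_dr e (fun a => - E a b)); apply: eq_bigr => a _.
  by rewrite mul1r big1 ?(mul0r, addr0)//; [ring|move=> f _; rewrite mul0r].
- rewrite big1; last by move=> f _; rewrite mulr0.
  by rewrite big1// => a _; rewrite big1 ?(mulr0, addr0, mul0r)// => f _; rewrite mul0r.
- rewrite big1; last by move=> f _; rewrite mulr0.
  rewrite ?(mulr1, addr0, add0r) PE; apply: eq_bigr => a _; rewrite ?(mul0r, mul1r, mulr0, add0r, addr0) mulr_sumr.
  by apply: eq_bigr => f _; rewrite mulrA.
- have -> : \sum_f - Gam' f b c * E e f = - (\sum_f E e f * Gam' f b c).
    by rewrite -sumrN; apply: eq_bigr => f _; ring.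
  rewrite GamE opprD addrCA subrr addr0 -sumrN; apply: eq_bigr => a _.
  rewrite ?(mul0r, mul1r, mulr0, add0r, addr0) -sumrN mulr_sumr; apply: eq_bigr => f _; ring.
- rewrite big1 ?add0r; last by move=> f _; rewrite mulr0.
  rewrite ?(mulr1, addr0, add0r) gE; apply: eq_bigr => a _; rewrite ?(mul0r, add0r, addr0) mulr_sumr.
  by apply: eq_bigr => f _; rewrite mulrA.
- rewrite big1; last by move=> f _; rewrite mulr0.
  by rewrite big1// => a _; rewrite big1 ?(mulr0, addr0, mul0r)// => f _; rewrite mul0r.
- have -> : \sum_f (- (\sum_x P' b x * G' x f)) * E e f = - \sum_f (\sum_x P' b x * G' x f) * E e f.
    by rewrite -sumrN; apply: eq_bigr => f _; rewrite mulNr.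
  rewrite PGE -sumrN; apply: eq_bigr => a _.
  have -> : \sum_f 0 * - Gam e a f = 0 :> R by rewrite big1// => f _; rewrite mul0r.
  ring.
- rewrite big1; last by move=> f _; rewrite mulr0.
  by rewrite big1// => a _; rewrite big1 ?(mulr0, addr0, mul0r)// => f _; rewrite mul0r.
Qed.

End ChartLawAlgebra.

Section ChartCovariance.
Variables (R : realType) (n : nat) (M : manifold R n) (i j : chart M).
Notation I := 'I_n.+1.
Notation d := (n.+1%:R : R).
Implicit Types (p : M) (a b c e : I).
Variable g : metric_field M.
Hypothesis hgi : regular_metric g i.
Hypothesis hgj : regular_metric g j.
Hypothesis g_chart : forall p, dom i p -> dom j p -> forall a b,
  g j p a b = \sum_c \sum_e jac i j p c a * jac i j p e b * g i p c e.
Local Notation T := (chart_change i j).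
Local Notation Ej p := (fun a b => jac i j p a b).

Lemma christoffel_chart_sum p e b c : dom i p -> dom j p ->
  \sum_f jac i j p e f * christoffel g j f b c p =
  \sum_a \sum_f jac i j p a b * jac i j p f c * christoffel g i e a f p
   + pd j b (fun q => jac i j q e c) p.
Proof.
move=> ip jp; have /matrixP/(_ e c) := christoffel_chart hgi hgj g_chart b ip jp.
rewrite mxE => H.
transitivity (\sum_k jac_mx i j p e k * chris_mx g j b p k c).
  by apply: eq_bigr => k _; rewrite !mxE.
rewrite H add_mxE; congr (_ + _).
  rewrite mxE; transitivity (\sum_f \sum_a jac i j p a b * jac i j p f c * christoffel g i e a f p).
    apply: eq_bigr => f _; rewrite summxE mulr_suml; apply: eq_bigr => a _.
    by rewrite !mxE; ring.
  by rewrite exchange_big.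
rewrite mxE; congr (pd j b _ p); apply/funext => q; by rewrite mxE.
Qed.

Lemma ginv_chart_sum p b c : dom i p -> dom j p ->
  \sum_x \sum_f jac i j p b x * jac i j p c f * ginv g j p x f = ginv g i p b c.
Proof.
move=> ip jp.
have H : jac_mx i j p *m invmx (g j p) *m (jac_mx i j p)^T = invmx (g i p).
  rewrite (ginv_chart hgi hgj g_chart ip jp).
  have := jac_mxK ip jp; move: (jac_mx i j p) (jac_mx j i p) (invmx _) => e ie G EE.
  by rewrite !mulmxA EE mul1mx -mulmxA -trmx_mul EE trmx1 mulmx1.
move/matrixP/(_ b c): H; rewrite -[RHS]/(ginv g i p b c) => <-.
rewrite mxE exchange_big/=; apply: eq_bigr => f _; rewrite mxE mulr_suml.
by apply: eq_bigr => x _; rewrite !mxE /ginv; ring.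
Qed.

Lemma schouten_ginv_chart p b e : dom i p -> dom j p ->
  \sum_f (\sum_x schouten g j b x p * ginv g j p x f) * jac i j p e f =
  \sum_a jac i j p a b * \sum_x schouten g i a x p * ginv g i p x e.
Proof.
move=> ip jp.
transitivity (\sum_a \sum_y jac i j p a b * schouten g i a y p * \sum_x \sum_f jac i j p y x * jac i j p e f * ginv g j p x f).
  transitivity (\sum_f \sum_x \sum_a \sum_y jac i j p a b * schouten g i a y p * (jac i j p y x * jac i j p e f * ginv g j p x f)).
    apply: eq_bigr => f _; rewrite mulr_suml; apply: eq_bigr => x _.
    rewrite (schouten_chart hgi hgj g_chart b x ip jp) -mulrA mulr_suml.
    apply: eq_bigr => a _; rewrite mulr_suml; apply: eq_bigr => y _; ring.
  transitivity (\sum_a \sum_f \sum_x \sum_y jac i j p a b * schouten g i a y p * (jac i j p y x * jac i j p e f * ginv g j p x f)).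
    rewrite [RHS]exchange_big/=; apply: eq_bigr => f _; by rewrite [RHS]exchange_big.
  apply: eq_bigr => a _.
  transitivity (\sum_f \sum_y \sum_x jac i j p a b * schouten g i a y p * (jac i j p y x * jac i j p e f * ginv g j p x f)).
    by apply: eq_bigr => f _; exact: exchange_big.
  rewrite exchange_big/=; apply: eq_bigr => y _.
  rewrite exchange_big/= mulr_sumr; apply: eq_bigr => x _.
  by rewrite mulr_sumr.
apply: eq_bigr => a _; rewrite mulr_sumr; apply: eq_bigr => y _.
by rewrite ginv_chart_sum// mulrA.
Qed.

Lemma chart_change_smooth p C D : dom i p -> dom j p ->
  smooth_near j p (fun x => T x C D).
Proof.
move=> ip jp; have sc k : smooth_near j p (fun=> k : R) by exact: smooth_near_cst.
by case: C => [|b|]; case: D => [|e|] //=; exact: jac_smooth.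
Qed.

Lemma chart_law p b C D : dom i p -> dom j p ->
  pd j b (fun x => T x C D) p + slot_mul (tractor_form g j p b) (T p) C D =
  \sum_a jac i j p a b * slot_mul (T p) (tractor_form g i p a) C D.
Proof.
move=> ip jp.
have := @chart_law_alg R n (Ej p) (fun b e c => pd j b (fun q => jac i j q e c) p)
  (fun a b => g i p a b) (ginv g i p) (fun a b => schouten g i a b p)
  (fun a b => g j p a b) (ginv g j p) (fun a b => schouten g j a b p)
  (fun c a b => christoffel g i c a b p) (fun c a b => christoffel g j c a b p)
  (fun e b c => christoffel_chart_sum e b c ip jp)
  (fun b c => schouten_chart hgi hgj g_chart b c ip jp)
  (fun b c => g_chart ip jp b c)
  (fun b e => schouten_ginv_chart b e ip jp) b C D.
move=> H; apply: (etrans (etrans _ H)); last first.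
  by [].
congr (_ + _).
by case: C {H} => [|c|]; case: D => [|e|] /=; rewrite ?pd_cst.
Qed.

Variable m : nat.
Implicit Types (F : M -> tensor R n m) (A B : multi n m).

Definition recharted F : M -> tensor R n m := fun x B => tens_act (T x) (F x) B.

Lemma nabla_recharted F p b A : dom i p -> dom j p -> smooth_tensor i p F ->
  nabla g j b (recharted F) p A =
  tens_act (T p) (fun B => \sum_a jac i j p a b * nabla g i a F p B) A.
Proof.
move=> ip jp sF.
have -> : nabla g j b (recharted F) p A = nabla g j b (fun x B => 1 * tens_act (T x) (F x) B) p A.
  by apply: (nabla_ext g b A openT) => // x _ _ B; rewrite mul1r.
have := @nabla_gauge R n M m g g i j p b T (fun=> 1) 0 (fun a => jac i j p a b) F A
  ip jp (fun C D => chart_change_smooth C D ip jp) sF (smooth_near_cst 1 jp)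
  (fun G sG => pd_chart b sG jp) (fun C D => chart_law b C D ip jp).
rewrite pd_cst mulr0 => -> //; rewrite mul1r; apply: tens_act_eq => B.
by rewrite mul0r addr0.
Qed.

(** The outer derivative differentiates the Jacobian produced by the inner one; these terms equal
    the inhomogeneous part of the Christoffel symbols contracted with the gradient, which is
    subtracted. *)
Lemma lap_recharted F p A : dom i p -> dom j p ->
  (forall q, dom i q -> smooth_tensor i q F) ->
  lap g j (recharted F) p A = tens_act (T p) (lap g i F p) A.
Proof.
move=> ip jp sF.
have sJ q c b : dom i q -> dom j q -> smooth_near i q (fun x => jac i j x c b).
  by move=> iq jq; exact: (smooth_near_chart (jac_smooth c b iq jq) iq).
pose W := dom i `&` dom j.
pose G b : M -> tensor R n m := fun x B => \sum_c jac i j x c b * nabla g i c F x B.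
have sN q c : dom i q -> smooth_tensor i q (nabla g i c F).
  by move=> iq; exact: (nabla_smooth hgi c (sF q iq)).
have sG b : smooth_tensor i p (G b).
  by move=> B; apply: smooth_near_sum => // c; apply: smooth_nearM; [exact: sJ|exact: sN].
pose X a b B := \sum_e jac i j p e a * \sum_c (pd i e (fun q => jac i j q c b) p * nabla g i c F p B
   + jac i j p c b * nabla g i e (nabla g i c F) p B).
have e1 a b : nabla g j a (nabla g j b (recharted F)) p A = tens_act (T p) (X a b) A.
  transitivity (nabla g j a (recharted (G b)) p A).
    apply: (nabla_ext g a A (overlap_open i j)) => // q [iq jq] _ B.
    exact: (nabla_recharted b B iq jq (sF q iq)).
  rewrite (nabla_recharted a A ip jp (sG b)); apply: tens_act_eq => B.
  apply: eq_bigr => e _; congr (_ * _).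
  have sc c : smooth_tensor i p (fun x B => jac i j x c b * nabla g i c F x B).
    by move=> C; apply: smooth_nearM; [exact: sJ|exact: sN].
  apply: etrans (nabla_sum g e B ip sc) _; apply: eq_bigr => c _.
  exact: (nablaM g e B (sJ p c b ip jp) (sN p c ip)).
have e2 c : nabla g j c (recharted F) p A = tens_act (T p) (G c p) A.
  exact: (nabla_recharted c A ip jp (sF p ip)).
have e3 : lap g j (recharted F) p A = tens_act (T p)
   (fun B => \sum_a \sum_b ginv g j p a b * (X a b B - \sum_c christoffel g j c a b p * G c p B)) A.
  rewrite tens_act_lap; apply: eq_bigr => a _; apply: eq_bigr => b _; congr (_ * (_ - _)).
    exact: e1.
  by apply: eq_bigr => c _; congr (_ * _); exact: e2.
rewrite e3; apply: tens_act_eq => B.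
pose Y e c := nabla g i e (nabla g i c F) p B - \sum_f christoffel g i f e c p * nabla g i f F p B.
have XY a b : X a b B - \sum_c christoffel g j c a b p * G c p B =
   \sum_e \sum_c jac i j p e a * jac i j p c b * Y e c.
  have h1 : \sum_c christoffel g j c a b p * G c p B = \sum_f (\sum_e \sum_c jac i j p e a * jac i j p c b * christoffel g i f e c p
      + pd j a (fun q => jac i j q f b) p) * nabla g i f F p B.
    transitivity (\sum_f (\sum_c jac i j p f c * christoffel g j c a b p) * nabla g i f F p B).
      under eq_bigr => c _ do rewrite mulr_sumr.
      rewrite exchange_big/=; apply: eq_bigr => f _; rewrite mulr_suml; apply: eq_bigr => c _.
      by rewrite mulrCA mulrA.
    by apply: eq_bigr => f _; congr (_ * _); exact: christoffel_chart_sum.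
  have h2 : X a b B = \sum_f pd j a (fun q => jac i j q f b) p * nabla g i f F p B
     + \sum_e \sum_c jac i j p e a * jac i j p c b * nabla g i e (nabla g i c F) p B.
    have h3 : \sum_f pd j a (fun q => jac i j q f b) p * nabla g i f F p B =
       \sum_e \sum_f jac i j p e a * (pd i e (fun q => jac i j q f b) p * nabla g i f F p B).
      rewrite exchange_big/=; apply: eq_bigr => f _.
      rewrite (pd_chart a (sJ p f b ip jp) jp) mulr_suml; apply: eq_bigr => e _.
      by rewrite mulrA.
    rewrite h3 -big_split/=; apply: eq_bigr => e _; rewrite -big_split mulr_sumr/=.
    by apply: eq_bigr => c _; rewrite mulrDr; congr (_ + _); exact: mulrA.
  have h4 : \sum_f (\sum_e \sum_c jac i j p e a * jac i j p c b * christoffel g i f e c p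
      + pd j a (fun q => jac i j q f b) p) * nabla g i f F p B =
     \sum_e \sum_c jac i j p e a * jac i j p c b * (\sum_f christoffel g i f e c p * nabla g i f F p B)
     + \sum_f pd j a (fun q => jac i j q f b) p * nabla g i f F p B.
    under eq_bigr => f _ do rewrite mulrDl.
    rewrite big_split/=; congr (_ + _).
    under eq_bigr => f _ do rewrite mulr_suml.
    rewrite exchange_big/=; apply: eq_bigr => e _.
    under eq_bigr => f _ do rewrite mulr_suml.
    rewrite exchange_big/=; apply: eq_bigr => c _.
    by rewrite mulr_sumr; apply: eq_bigr => f _; exact/esym/mulrA.
  rewrite h1 h4 h2 opprD addrCA addrA.
  have -> : \sum_e \sum_c jac i j p e a * jac i j p c b * Y e c =
    \sum_e \sum_c jac i j p e a * jac i j p c b * nabla g i e (nabla g i c F) p B -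
    \sum_e \sum_c jac i j p e a * jac i j p c b * (\sum_f christoffel g i f e c p * nabla g i f F p B).
    rewrite -sumrB; apply: eq_bigr => e _; rewrite -sumrB; apply: eq_bigr => c _.
    by rewrite -mulrBr.
  move: (\sum_f _) (\sum_e _) (\sum_e _) => x y z; ring.
transitivity (\sum_e \sum_c ginv g i p e c * Y e c); last by [].
transitivity (\sum_a \sum_b \sum_e \sum_c jac i j p e a * jac i j p c b * ginv g j p a b * Y e c).
  apply: eq_bigr => a _; apply: eq_bigr => b _; rewrite XY mulr_sumr; apply: eq_bigr => e _.
  rewrite mulr_sumr; apply: eq_bigr => c _; ring.
transitivity (\sum_e \sum_c \sum_a \sum_b jac i j p e a * jac i j p c b * ginv g j p a b * Y e c).
  transitivity (\sum_a \sum_e \sum_b \sum_c jac i j p e a * jac i j p c b * ginv g j p a b * Y e c).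
    by apply: eq_bigr => a _; exact: exchange_big.
  rewrite exchange_big/=; apply: eq_bigr => e _.
  transitivity (\sum_a \sum_c \sum_b jac i j p e a * jac i j p c b * ginv g j p a b * Y e c).
    by apply: eq_bigr => a _; exact: exchange_big.
  exact: exchange_big.
apply: eq_bigr => e _; apply: eq_bigr => c _; rewrite -ginv_chart_sum// mulr_suml.
by apply: eq_bigr => a _; rewrite mulr_suml.
Qed.

End ChartCovariance.

Section ChartIdot.
Variables (R : realType) (n : nat) (M : manifold R n) (i j : chart M).
Notation I := 'I_n.+1.
Notation d := (n.+1%:R : R).
Variable g : metric_field M.
Hypothesis hgi : regular_metric g i.
Hypothesis hgj : regular_metric g j.
Hypothesis g_chart : forall p, dom i p -> dom j p -> forall a b,
  g j p a b = \sum_c \sum_e jac i j p c a * jac i j p e b * g i p c e.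

Lemma lap_density_chart (f : M -> R) p : dom i p -> dom j p ->
  (forall q, dom i q -> smooth_near i q f) ->
  lap_density g j f p = lap_density g i f p.
Proof.
move=> ip jp sf; pose A0 : multi n 0 := [ffun=> Top].
have := lap_recharted hgi hgj g_chart (F := scalar_tensor f) A0 ip jp (fun q iq B => sf q iq).
rewrite tens_act0 lap_scalar.
have -> : recharted i j (scalar_tensor f) = scalar_tensor f.
  by apply/funext => x; apply/funext => B; rewrite /recharted tens_act0.
by rewrite lap_scalar.
Qed.

Lemma idot_recharted m (f : M -> R) (w : R) (F : M -> tensor R n m) p A : dom i p -> dom j p ->
  (forall q, dom i q -> smooth_near i q f) ->
  (forall q, dom i q -> smooth_tensor i q F) ->
  idot g j f w (recharted i j F) p A = tens_act (chart_change i j p) (idot g i f w F p) A.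
Proof.
move=> ip jp sf sF.
have e1 : yamabe j g w (recharted i j F) p A = tens_act (chart_change i j p) (yamabe i g w F p) A.
  rewrite /yamabe tens_actD tens_actZ (lap_recharted hgi hgj g_chart A ip jp sF).
  by rewrite (schoutenJ_chart hgi hgj g_chart ip jp).
have e2 : grad_pair g j f (recharted i j F) p A =
    tens_act (chart_change i j p) (grad_pair g i f F p) A.
  transitivity (\sum_a \sum_b ginv g j p a b * (\sum_e jac i j p e a * pd i e f p) *
     tens_act (chart_change i j p) (fun B => \sum_c jac i j p c b * nabla g i c F p B) A).
    apply: eq_bigr => a _; apply: eq_bigr => b _; congr (_ * _ * _).
      exact: (pd_chart a (sf p ip) jp).
    exact: (nabla_recharted hgi hgj g_chart b A ip jp (sF p ip)).
  transitivity (tens_act (chart_change i j p) (fun B => \sum_a \sum_b (ginv g j p a b * (\sum_e jac i j p e a * pd i e f p)) *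
    (\sum_c jac i j p c b * nabla g i c F p B)) A).
    rewrite tens_act_sum; apply: eq_bigr => a _; rewrite tens_act_sum; apply: eq_bigr => b _.
    by rewrite tens_actZ.
  apply: tens_act_eq => B.
  transitivity (\sum_a \sum_b \sum_e \sum_c jac i j p e a * jac i j p c b * ginv g j p a b * (pd i e f p * nabla g i c F p B)).
    apply: eq_bigr => a _; apply: eq_bigr => b _; rewrite -mulrA mulr_suml mulr_sumr; apply: eq_bigr => e _.
    by rewrite 2!mulr_sumr; apply: eq_bigr => c _; ring.
  transitivity (\sum_e \sum_c \sum_a \sum_b jac i j p e a * jac i j p c b * ginv g j p a b * (pd i e f p * nabla g i c F p B)).
    transitivity (\sum_a \sum_e \sum_b \sum_c jac i j p e a * jac i j p c b * ginv g j p a b * (pd i e f p * nabla g i c F p B)).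
      by apply: eq_bigr => a _; exact: exchange_big.
    rewrite exchange_big/=; apply: eq_bigr => e _.
    transitivity (\sum_a \sum_c \sum_b jac i j p e a * jac i j p c b * ginv g j p a b * (pd i e f p * nabla g i c F p B)).
      by apply: eq_bigr => a _; exact: exchange_big.
    exact: exchange_big.
  apply: eq_bigr => e _; apply: eq_bigr => c _.
  rewrite -(ginv_chart_sum hgi hgj g_chart e c ip jp) -mulrA mulr_suml.
  by apply: eq_bigr => a _; rewrite mulr_suml.
rewrite {1}/idot e1 e2 (lap_density_chart ip jp sf) (schoutenJ_chart hgi hgj g_chart ip jp).
rewrite /idot; apply/esym; apply: etrans (tens_actD _ _ _ _) _; congr (_ + _); last exact: tens_actZ.
apply: etrans (tens_actB _ _ _ _) _; congr (_ - _); exact: tens_actZ.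
Qed.

End ChartIdot.

(** * The sl(2) relation *)

Section IdotAlgebra.
Variables (R : realType) (n : nat) (M : manifold R n).
Notation I := 'I_n.+1.
Notation d := (n.+1%:R : R).
Variables (g : metric_field M) (i : chart M).
Implicit Types (p : M) (f : M -> R).

Lemma lap_ext m p (F G : M -> tensor R n m) (W : set M) A : open W -> W p -> dom i p ->
  (forall q, W q -> dom i q -> forall B, F q B = G q B) -> lap g i F p A = lap g i G p A.
Proof.
move=> oW Wp ip FG; apply: eq_bigr => a _; apply: eq_bigr => b _; congr (_ * (_ - _)).
  apply: (nabla_ext g a A oW) => // q Wq iq B.
  exact: (nabla_ext g b B oW).
by apply: eq_bigr => c _; congr (_ * _); exact: (nabla_ext g c A oW).
Qed.

Lemma idot_ext m f w p (F G : M -> tensor R n m) (W : set M) A : open W -> W p -> dom i p ->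
  (forall q, W q -> dom i q -> forall B, F q B = G q B) ->
  idot g i f w F p A = idot g i f w G p A.
Proof.
move=> oW Wp ip FG; rewrite /idot /yamabe (lap_ext A oW Wp ip FG) (FG p Wp ip A).
congr (_ + _ * _).
apply: eq_bigr => a _; apply: eq_bigr => b _; congr (_ * _).
exact: (nabla_ext g b A oW).
Qed.

Hypothesis hg : regular_metric g i.

Lemma nabla_lin m (k : R) p (F G : M -> tensor R n m) a A : smooth_tensor i p F -> smooth_tensor i p G ->
  nabla g i a (fun x B => k * F x B + G x B) p A = k * nabla g i a F p A + nabla g i a G p A.
Proof.
move=> sF sG; have ip := smooth_near_dom (sF A).
have sc := smooth_near_cst k ip.
have skF : smooth_tensor i p (fun x B => k * F x B) by move=> B; apply: smooth_nearM.
apply: etrans (nablaD g a A skF sG) _; congr (_ + _).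
by apply: etrans (nablaM g a A sc sF) _; rewrite pd_cst mul0r add0r.
Qed.

Lemma idot_lin m f w (k : R) p (F G : M -> tensor R n m) A : dom i p ->
  (forall q, dom i q -> smooth_tensor i q F) -> (forall q, dom i q -> smooth_tensor i q G) ->
  idot g i f w (fun x B => k * F x B + G x B) p A = k * idot g i f w F p A + idot g i f w G p A.
Proof.
move=> ip sF sG.
have e1 : lap g i (fun x B => k * F x B + G x B) p A = k * lap g i F p A + lap g i G p A.
  rewrite /lap mulr_sumr -big_split/=; apply: eq_bigr => a _.
  rewrite mulr_sumr -big_split/=; apply: eq_bigr => b _.
  have -> : nabla g i a (nabla g i b (fun x B => k * F x B + G x B)) p A =
      k * nabla g i a (nabla g i b F) p A + nabla g i a (nabla g i b G) p A.
    transitivity (nabla g i a (fun x B => k * nabla g i b F x B + nabla g i b G x B) p A).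
      apply: (nabla_ext g a A (dom_open i)) => // q iq _ B.
      by apply: nabla_lin; [exact: sF|exact: sG].
    apply: nabla_lin; apply: nabla_smooth => //; [exact: sF|exact: sG].
  have -> : \sum_c christoffel g i c a b p * nabla g i c (fun x B => k * F x B + G x B) p A =
    k * (\sum_c christoffel g i c a b p * nabla g i c F p A) + \sum_c christoffel g i c a b p * nabla g i c G p A.
    rewrite mulr_sumr -big_split/=; apply: eq_bigr => c _.
    rewrite (nabla_lin k c A (sF p ip) (sG p ip)); ring.
  by move: (\sum_c _) (\sum_c _) (nabla _ _ _ _ _ _) (nabla _ _ _ _ _ _) (ginv _ _ _ _ _) => *; ring.
have e2 : grad_pair g i f (fun x B => k * F x B + G x B) p A =
    k * grad_pair g i f F p A + grad_pair g i f G p A.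
  rewrite /grad_pair mulr_sumr -big_split/=; apply: eq_bigr => a _.
  rewrite mulr_sumr -big_split/=; apply: eq_bigr => b _.
  rewrite (nabla_lin k b A (sF p ip) (sG p ip)); ring.
rewrite /idot /yamabe e1 e2.
move: (lap _ _ _ _ _) (lap _ _ _ _ _) (grad_pair _ _ _ _ _ _) (grad_pair _ _ _ _ _ _) d^-1 => *; ring.
Qed.

Lemma lap_density_smooth p f : smooth_near i p f -> smooth_near i p (lap_density g i f).
Proof.
move=> sf; have ip := smooth_near_dom sf.
have := @lap_smooth R n M 0 g i hg p (scalar_tensor f) (fun=> sf) [ffun=> Top].
by apply: (smooth_near_ext openT) => // q _ iq; rewrite lap_scalar.
Qed.

Lemma idot_smooth m f w p (F : M -> tensor R n m) : smooth_near i p f -> smooth_tensor i p F ->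
  smooth_tensor i p (idot g i f w F).
Proof.
move=> sf sF A; have ip := smooth_near_dom sf.
have sJ := schoutenJ_smooth hg ip; have sL := lap_density_smooth sf.
have sc k : smooth_near i p (fun=> k : R) by exact: smooth_near_cst.
apply: smooth_nearD; [apply: smooth_nearB|].
- apply: smooth_nearM; first exact: smooth_nearN.
  apply: smooth_nearD; first exact: (lap_smooth hg sF).
  by apply: smooth_nearM => //; apply: smooth_nearM.
- apply: smooth_nearM => //; apply: smooth_nearM => //; apply: smooth_nearM => //.
  by apply: smooth_nearD => //; exact: smooth_nearM.
- apply: smooth_nearM => //; apply: smooth_near_sum => // a; apply: smooth_near_sum => // b.
  apply: smooth_nearM; last exact: nabla_smooth.
  by apply: smooth_nearM; [exact: ginv_smooth|exact: smooth_near_pd].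
Qed.

Lemma grad_pairM m p f (F : M -> tensor R n m) A : smooth_near i p f -> smooth_tensor i p F ->
  grad_pair g i f (fun x B => f x * F x B) p A =
  sqnorm (ginv g i p) (fun a => pd i a f p) * F p A + f p * grad_pair g i f F p A.
Proof.
move=> sf sF; rewrite /grad_pair /sqnorm mulr_suml mulr_sumr -big_split/=.
apply: eq_bigr => a _; rewrite mulr_suml mulr_sumr -big_split/=; apply: eq_bigr => b _.
rewrite (nablaM g b A sf sF); ring.
Qed.

Lemma lapM m p f (F : M -> tensor R n m) A : smooth_near i p f -> smooth_tensor i p F ->
  lap g i (fun x B => f x * F x B) p A =
  f p * lap g i F p A + 2 * grad_pair g i f F p A + lap_density g i f p * F p A.
Proof.
move=> sf sF; have ip := smooth_near_dom sf.
(* The inner derivative is expanded on a whole neighbourhood before it is differentiated again, so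
   smoothness at [p] is first spread to nearby points. *)
have [ W [oW Wp] sW] : exists W : set M, [/\ open W, W p &
    forall q, W q -> smooth_near i q f /\ smooth_tensor i q F].
  have nb (h : M -> R) : smooth_near i p h -> \forall q \near p, smooth_near i q h.
    move=> [_ [ O [oO Op sO]]].
    have : nbhs p (dom i `&` [set q | O (coord i q)]).
      by apply: open_nbhs_nbhs; split => //; exact: preimage_coord_open.
    by apply: filterS => q [iq Oq]; split => //; exists O.
  have nbF : \forall q \near p, forall B, smooth_near i q (fun x => F x B).
    by apply: filter_forall => B; exact: nb.
  have : nbhs p [set q | smooth_near i q f /\ smooth_tensor i q F] by exact: filterI (nb _ sf) nbF.
  rewrite nbhsE => -[W] [oW Wp] sW.
  by exists W; split => // q /sW.
have e1 a b : nabla g i a (nabla g i b (fun x B => f x * F x B)) p A =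
   pd i a (pd i b f) p * F p A + pd i b f p * nabla g i a F p A +
   (pd i a f p * nabla g i b F p A + f p * nabla g i a (nabla g i b F) p A).
  transitivity (nabla g i a (fun x B => pd i b f x * F x B + f x * nabla g i b F x B) p A).
    apply: (nabla_ext g a A oW Wp ip) => q /sW[sfq sFq] iq B; exact: nablaM.
  have s1 : smooth_tensor i p (fun x B => pd i b f x * F x B).
    by move=> B; apply: smooth_nearM => //; exact: smooth_near_pd.
  have s2 : smooth_tensor i p (fun x B => f x * nabla g i b F x B).
    by move=> B; apply: smooth_nearM => //; exact: nabla_smooth.
  rewrite (nablaD g a A s1 s2); congr (_ + _).
    exact: (nablaM g a A (smooth_near_pd b sf) sF).
  exact: (nablaM g a A sf (nabla_smooth hg b sF)).
have e2 : grad_pair g i f F p A = \sum_a \sum_b ginv g i p a b * pd i b f p * nabla g i a F p A.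
  rewrite /grad_pair exchange_big/=; apply: eq_bigr => a _; apply: eq_bigr => b _.
  by rewrite (ginv_sym hg _ _ ip).
rewrite mulr2n mulrDl mul1r {2}e2.
rewrite /lap /lap_density /grad_pair mulr_sumr mulr_suml -!big_split/=; apply: eq_bigr => a _.
rewrite mulr_sumr mulr_suml -!big_split/=; apply: eq_bigr => b _.
have -> : \sum_c christoffel g i c a b p * nabla g i c (fun x B => f x * F x B) p A =
   (\sum_c christoffel g i c a b p * pd i c f p) * F p A
   + f p * (\sum_c christoffel g i c a b p * nabla g i c F p A).
  rewrite mulr_suml mulr_sumr -big_split/=; apply: eq_bigr => c _.
  rewrite (nablaM g c A sf sF); ring.
rewrite (e1 a b).
move: (\sum_c _) (\sum_c _) (nabla _ _ _ _ _ _) (nabla _ _ _ _ _ _) (nabla _ _ _ _ _ _) => *; ring.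
Qed.

(** The pairing of [df] with the derivative of [F] enters with coefficient [- 2 f] from the
    Laplacian and [(d + 2 w) f] from the gradient, together the coefficient for weight [w]. The
    terms in [F] itself assemble into [(d + 2 w) I^2]. *)
Lemma idotM m f w p (F : M -> tensor R n m) A : smooth_near i p f -> smooth_tensor i p F ->
  idot g i f (w + 1) (fun x B => f x * F x B) p A =
  f p * idot g i f w F p A + (d + 2 * w) *
   (sqnorm (ginv g i p) (fun a => pd i a f p)
     - 2 * d^-1 * f p * (lap_density g i f p + schoutenJ g i p * f p)) * F p A.
Proof.
move=> sf sF; rewrite /idot /yamabe lapM// grad_pairM//.
have d0 : d != 0 by rewrite pnatr_eq0.
move: (lap_density _ _ _ _) (schoutenJ _ _ _) (grad_pair _ _ _ _ _ _) (lap _ _ _ _ _) (sqnorm _ _)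
  (f p) (F p A) d d0 => l J gp L s y t dd d0.
by field.
Qed.

End IdotAlgebra.

Section ScaleTractor.
Variables (R : realType) (n : nat) (M : manifold R n).
Notation I := 'I_n.+1.
Notation d := (n.+1%:R : R).
Variables (sigma : density M) (g : metric_field M) (i : chart M).

Lemma IsqE p : Isq sigma g i p = sqnorm (ginv g i p) (fun a => pd i a (sigma g) p)
  - 2 * d^-1 * sigma g p * (lap_density g i (sigma g) p + schoutenJ g i p * sigma g p).
Proof.
rewrite /Isq /tractor_metric /scale_tractor /sqnorm addrC; congr (_ + _).
by move: (lap_density _ _ _ _) (schoutenJ _ _ _) (sigma _ _) d^-1 => l J y z; ring.
Qed.

(* [I.D sigma = d I^2], so that [I^2] inherits the covariance of [I.D]. *)
Lemma Isq_idot p A : d * Isq sigma g i p =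
  idot g i (sigma g) 1 (scalar_tensor (sigma g)) p A.
Proof.
rewrite IsqE /idot /yamabe lap_scalar.
have -> : grad_pair g i (sigma g) (scalar_tensor (sigma g)) p A =
    sqnorm (ginv g i p) (fun a => pd i a (sigma g) p).
  by apply: eq_bigr => a _; apply: eq_bigr => b _; rewrite nabla_scalar.
have d0 : d != 0 by rewrite pnatr_eq0.
rewrite /scalar_tensor; move: (sqnorm _ _) (lap_density _ _ _ _) (schoutenJ _ _ _) (sigma _ _) d d0.
by move=> s l J y dd d0; field.
Qed.

Hypothesis hg : regular_metric g i.
Hypothesis ssig : forall p, dom i p -> smooth_near i p (sigma g).

Lemma Isq_smooth p : dom i p -> smooth_near i p (Isq sigma g i).
Proof.
move=> ip; have d0 : d != 0 by rewrite pnatr_eq0.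
have H := @idot_smooth R n M g i hg 0 (sigma g) 1 p (scalar_tensor (sigma g)) (ssig ip) (fun=> ssig ip) [ffun=> Top].
have := smooth_nearM (smooth_near_cst d^-1 ip) H.
apply: (smooth_near_ext openT) => // q _ iq; rewrite -Isq_idot; exact: mulKf.
Qed.

(** The one-step constants [d + 2 v], for [v] running from [w] to [w + k], add up to
    [(k + 1) (d + 2 w + k)]. *)
Lemma idot_powM m w k p (F : M -> tensor R n m) A : dom i p ->
  (forall q, dom i q -> smooth_tensor i q F) ->
  idot g i (sigma g) (w + k.+1%:R) (fun x B => sigma g x ^+ k.+1 * F x B) p A =
  sigma g p ^+ k.+1 * idot g i (sigma g) w F p A +
  k.+1%:R * (d + 2 * w + k%:R) * Isq sigma g i p * (sigma g p ^+ k * F p A).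
Proof.
move=> ip sF; elim: k A => [|k IH] A.
  rewrite -[1%:R]/(1 : R) (idotM hg w A (ssig ip) (sF p ip)) -IsqE expr1 addr0 expr0; ring.
have sk : smooth_tensor i p (fun x B => sigma g x ^+ k.+1 * F x B).
  move=> B; apply: smooth_nearM; last exact: sF.
  by apply: smooth_nearX; exact: ssig.
have -> : w + k.+2%:R = (w + k.+1%:R) + 1 by rewrite -[k.+2]addn1 natrD addrA.
transitivity (idot g i (sigma g) (w + k.+1%:R + 1) (fun x B => sigma g x * (sigma g x ^+ k.+1 * F x B)) p A).
  by apply: (@idot_ext R n M g i m (sigma g) _ p _ _ setT A openT) => // q _ _ B; rewrite exprS mulrA.
rewrite (idotM hg _ A (ssig ip) sk) -IsqE IH.
move: (idot _ _ _ _ _ _ _) (Isq _ _ _ _) (sigma g p) (F p A) => x y s t.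
rewrite -[k.+2]addn1 -[k.+1]addn1 !natrD !exprD; ring.
Qed.

End ScaleTractor.

(** * Sections of tractor bundles *)

Section Frames.
Variables (R : realType) (n : nat) (M : manifold R n) (m : nat).
Notation I := 'I_n.+1.
Variables (c : set (metric_field M)) (Phi : subbundle M m).
Hypothesis hPhi : tractor_bundle c Phi.
Hypothesis hreg : forall g i, c g -> regular_metric g i.
Implicit Types (g : metric_field M) (i : chart M) (p : M).

(* The Gram matrix of a frame is invertible since the ground field is real,
   which makes the coefficients of a smooth field smooth. *)
Lemma frame_coef g i p0 : c g -> dom i p0 ->
  exists (U : set M) (r : nat) (e : 'I_r -> M -> tensor R n m),
  [/\ open U /\ U p0, U `<=` dom i, forall k q, U q -> smooth_tensor i q (e k),
      forall q, U q -> [/\ Phi g i q = [set t | exists x : 'I_r -> R,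
                                 t = fun A => \sum_k x k * e k q A] &
                  forall k a, Phi g i q (nabla g i a (e k) q)] &
      forall F : M -> tensor R n m, (forall q, U q -> smooth_tensor i q F) ->
        (forall q, U q -> Phi g i q (F q)) -> exists x : 'I_r -> M -> R,
          [/\ forall k q, U q -> smooth_near i q (x k),
              forall q A, U q -> F q A = \sum_k x k q * e k q A &
              forall q, U q -> (forall A, F q A = 0) -> forall k, x k q = 0]].
Proof.
move=> cg ip0; have [H _ _] := hPhi.
have [U [r [e [[oU Up0] Ui se he]]]] := H g i p0 cg ip0.
have se' k q : U q -> smooth_tensor i q (e k).
  by move=> Uq A; exact: (iffLR (smooth_inP i _ oU) (se k A) q Uq (Ui q Uq)).
exists U, r, e; split => //.
  by move=> q /he[].
move=> F sF PF.
pose G q : 'M[R]_r := \matrix_(k, l) \sum_A e k q A * e l q A.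
have sG q k l : U q -> smooth_near i q (fun x => G x k l).
  move=> Uq; have -> : (fun x => G x k l) = fun x => \sum_A e k x A * e l x A.
    by apply/funext => x; rewrite mxE.
  by apply: smooth_near_sum (Ui q Uq) _ => A; apply: smooth_nearM; exact: se'.
have uG q : U q -> G q \in unitmx.
  move=> Uq; rewrite -row_free_unit -kermx_eq0; apply/eqP/row_matrixP => k0.
  set v := row k0 _; have vG : v *m G q = 0.
    by apply/sub_kermxP; exact: row_sub.
  rewrite row0; clearbody v.
  have [ind _ _] := he q Uq; apply/rowP => k; rewrite [RHS]mxE.
  apply: (ind (fun k => v 0 k)) => A.
  have s0 : \sum_A (\sum_k v 0 k * e k q A) ^+ 2 = 0.
    transitivity ((v *m G q *m v^T) 0 0); last by rewrite vG mul0mx mxE.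
    rewrite mxE; under [RHS]eq_bigr => l _ do rewrite !mxE mulr_suml.
    rewrite exchange_big/=.
    transitivity (\sum_k \sum_l \sum_B v 0 k * e k q B * (v 0 l * e l q B)).
      transitivity (\sum_B \sum_k \sum_l v 0 k * e k q B * (v 0 l * e l q B)).
        by apply: eq_bigr => B _; rewrite expr2 mulr_suml; apply: eq_bigr => k' _; rewrite mulr_sumr.
      by rewrite exchange_big/=; apply: eq_bigr => k' _; exact: exchange_big.
    apply: eq_bigr => k' _; apply: eq_bigr => l _; rewrite !mxE mulr_sumr mulr_suml.
    by apply: eq_bigr => B _; ring.
  have /eqP := s0; rewrite psumr_eq0; last by move=> B _; exact: sqr_ge0.
  by move=> /allP/(_ A (mem_index_enum _)); rewrite /= sqrf_eq0 => /eqP.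
pose x k q := \sum_l invmx (G q) k l * \sum_A e l q A * F q A.
exists x; split.
- move=> k q Uq; apply: smooth_near_sum (Ui q Uq) _ => l; apply: smooth_nearM.
    by apply: smooth_near_inv; [move=> a b; exact: sG|exact: uG].
  by apply: smooth_near_sum (Ui q Uq) _ => A; apply: smooth_nearM; [exact: se'|exact: sF].
- move=> q A Uq; have [_ PE _] := he q Uq.
  have := PF q Uq; rewrite PE => -[y Fy].
  rewrite [LHS](congr1 (fun t => t A) Fy); apply: eq_bigr => k _; congr (_ * _).
  rewrite /x; transitivity (((invmx (G q) *m G q) *m \col_k y k) k 0).
    by rewrite mulVmx ?uG// mul1mx mxE.
  rewrite -mulmxA mxE; apply: eq_bigr => l _; congr (_ * _).
  rewrite mxE; transitivity (\sum_k' \sum_A (e l q A * e k' q A) * y k').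
    by apply: eq_bigr => k' _; rewrite !mxE mulr_suml.
  rewrite exchange_big/=; apply: eq_bigr => B _; rewrite Fy mulr_sumr.
  by apply: eq_bigr => k' _; ring.
- move=> q Uq F0 k; rewrite /x big1// => l _; rewrite big1 ?mulr0// => A _.
  by rewrite F0 mulr0.
Qed.

Lemma fibre_lin g i p (a : R) (t s : tensor R n m) : c g -> dom i p ->
  Phi g i p t -> Phi g i p s -> Phi g i p (fun A => a * t A + s A).
Proof.
move=> cg ip; have [U [r [e [[oU Up] _ _ he _]]]] := frame_coef cg ip.
have [-> _] := he p Up; move=> [x ->] [y ->]; exists (fun k => a * x k + y k).
apply/funext => A; rewrite mulr_sumr -big_split/=; apply: eq_bigr => k _.
by rewrite mulrDl mulrA.
Qed.

Lemma fibre0 g i p : c g -> dom i p -> Phi g i p (fun=> 0).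
Proof.
move=> cg ip; have [U [r [e [[oU Up] _ _ he _]]]] := frame_coef cg ip.
have [-> _] := he p Up; exists (fun=> 0); apply/funext => A.
by rewrite big1// => k _; rewrite mul0r.
Qed.

Lemma fibreZ g i p (a : R) (t : tensor R n m) : c g -> dom i p ->
  Phi g i p t -> Phi g i p (fun A => a * t A).
Proof.
move=> cg ip Pt; have := fibre_lin a cg ip Pt (fibre0 cg ip).
by congr (Phi _ _ _ _); apply/funext => A; rewrite addr0.
Qed.

Lemma fibreD g i p (t s : tensor R n m) : c g -> dom i p ->
  Phi g i p t -> Phi g i p s -> Phi g i p (fun A => t A + s A).
Proof.
move=> cg ip Pt Ps; have := fibre_lin 1 cg ip Pt Ps.
by congr (Phi _ _ _ _); apply/funext => A; rewrite mul1r.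
Qed.

Lemma fibre_sum g i p (J : Type) (s : seq J) (t : J -> tensor R n m) : c g -> dom i p ->
  (forall k, Phi g i p (t k)) -> Phi g i p (fun A => \sum_(k <- s) t k A).
Proof.
move=> cg ip Pt; elim: s => [|k s IH].
  have -> : (fun A => \sum_(k <- [::]) t k A) = fun=> 0 by apply/funext => A; rewrite big_nil.
  exact: fibre0.
have -> : (fun A => \sum_(k <- k :: s) t k A) = fun A => t k A + \sum_(k <- s) t k A.
  by apply/funext => A; rewrite big_cons.
exact: fibreD.
Qed.

(** In a frame with smooth coefficients the derivative splits into derivatives of coefficients times
    the frame and coefficients times derivatives of the frame; the connection preserves the bundle,
    so both parts stay in the fibre. *)
Lemma fibre_nabla g i a p (F : M -> tensor R n m) : c g -> dom i p ->
  (forall q, dom i q -> smooth_tensor i q F) -> (forall q, dom i q -> Phi g i q (F q)) ->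
  Phi g i p (nabla g i a F p).
Proof.
move=> cg ip sF PF; have [U [r [e [[oU Up] Ui se he hx]]]] := frame_coef cg ip.
have [x [sx Fx _]] := hx F (fun q Uq => sF q (Ui q Uq)) (fun q Uq => PF q (Ui q Uq)).
have [PE Pe] := he p Up.
have -> : nabla g i a F p = fun A => \sum_k (pd i a (x k) p * e k p A + x k p * nabla g i a (e k) p A).
  apply/funext => A.
  transitivity (nabla g i a (fun q B => \sum_k x k q * e k q B) p A).
    by apply: (nabla_ext g a A oU) => // q Uq _ B; exact: Fx.
  rewrite (nabla_sum g a (F := fun k q B => x k q * e k q B) A ip); last first.
    by move=> k B; apply: smooth_nearM; [exact: sx|exact: se].
  by apply: eq_bigr => k _; exact: (nablaM g a A (sx k p Up) (se k p Up)).
apply: fibre_sum => // k; apply: fibreD => //; apply: fibreZ => //.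
rewrite PE; exists (fun l => (l == k)%:R); apply/funext => A.
by rewrite (bigD1 k)//= eqxx mul1r big1 ?addr0// => l /negbTE ->; rewrite mul0r.
Qed.

Lemma fibre_idot g i f w p (F : M -> tensor R n m) : c g -> dom i p ->
  (forall q, dom i q -> smooth_tensor i q F) -> (forall q, dom i q -> Phi g i q (F q)) ->
  Phi g i p (idot g i f w F p).
Proof.
move=> cg ip sF PF.
have PN q a : dom i q -> Phi g i q (nabla g i a F q) by move=> iq; exact: fibre_nabla.
have sN q a : dom i q -> smooth_tensor i q (nabla g i a F).
  by move=> iq; exact: (nabla_smooth (@hreg g i cg) a (sF q iq)).
apply: (@fibreD g i p (fun A => - f p * yamabe i g w F p A - _ * F p A)
  (fun A => _ * grad_pair g i f F p A)) => //.
  apply: (@fibreD g i p (fun A => - f p * yamabe i g w F p A) (fun A => - (_ * F p A))) => //.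
    apply: fibreZ => //; rewrite /yamabe.
    apply: (@fibreD g i p (lap g i F p) (fun A => _ * F p A)) => //; last by apply: fibreZ => //; exact: PF.
    apply: fibre_sum => // a; apply: fibre_sum => // b; apply: fibreZ => //.
    apply: (@fibreD g i p (fun A => nabla g i a (nabla g i b F) p A) (fun A => - \sum_c0 _)) => //.
      exact: (fibre_nabla a cg ip (fun q iq => sN q b iq) (fun q iq => PN q b iq)).
    have -> : (fun A => - (\sum_c0 christoffel g i c0 a b p * nabla g i c0 F p A)) =
      fun A => \sum_c0 (- christoffel g i c0 a b p) * nabla g i c0 F p A.
      by apply/funext => A; rewrite -sumrN; apply: eq_bigr => c0 _; rewrite mulNr.
    by apply: fibre_sum => // c0; apply: fibreZ => //; exact: PN.
  set k := (X in fun A => - (X * _)).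
  have -> : (fun A => - (k * F p A)) = fun A => - k * F p A by apply/funext => A; rewrite mulNr.
  by apply: fibreZ => //; exact: PF.
apply: fibreZ => //; apply: fibre_sum => // a; apply: fibre_sum => // b; apply: fibreZ => //.
exact: PN.
Qed.

End Frames.

(** * Sections and the action of I.D on them *)

Section SectionOperations.
Variables (R : realType) (n : nat) (M : manifold R n) (m : nat).
Notation I := 'I_n.+1.
Notation d := (n.+1%:R : R).
Hypothesis n2 : (2 <= n)%N.
Variables (q : nat) (c : set (metric_field M)) (Phi : subbundle M m).
Hypothesis hc : conformal_class q c.
Hypothesis hPhi : tractor_bundle c Phi.
Implicit Types (g : metric_field M) (i : chart M) (p : M) (F G : tractor_field M m) (U W : set M).
Implicit Types (v w : R) (s : metric_field M -> chart M -> M -> R).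

Lemma class_metric g : c g -> is_metric q g.
Proof. by have [g0 _ ->] := hc; case. Qed.

Lemma class_regular g i : c g -> regular_metric g i.
Proof. by move=> cg; exact: is_metric_regular (class_metric cg). Qed.

Lemma section_onP U w F : open U -> section_on c Phi U w F <->
  [/\ forall g i p, c g -> U p -> dom i p -> smooth_tensor i p (F g i),
      forall g i p, c g -> U p -> dom i p -> Phi g i p (F g i p),
      forall g ghat Omega, c g -> c ghat -> rescaling Omega g ghat ->
        forall i p, U p -> dom i p -> forall A, F ghat i p A =
          Omega p `^ w * tens_act (scale_change Omega g i p) (F g i p) A &
      forall g i j p, c g -> U p -> dom i p -> dom j p -> forall A,
          F g j p A = tens_act (chart_change i j p) (F g i p) A].
Proof.
move=> oU; split=> -[sF PF gF jF]; split => //.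
- move=> g i p cg Up ip A; exact: (iffLR (smooth_inP i _ oU) (sF g i A cg)).
- by move=> g i A cg; apply/(smooth_inP i _ oU) => p Up ip; exact: sF.
Qed.

Lemma section_onS U W w F : open U -> open W -> W `<=` U ->
  section_on c Phi U w F -> section_on c Phi W w F.
Proof.
move=> oU oW WU /(section_onP _ _ oU)[sF PF gF jF]; apply/(section_onP _ _ oW); split.
- by move=> g i p cg /WU; exact: sF.
- by move=> g i p cg /WU; exact: PF.
- by move=> g gh Om cg cgh h i p /WU Up; exact: gF.
- by move=> g i j p cg /WU; exact: jF.
Qed.

Lemma section_on_eq U w F G : open U -> eq_on c U F G ->
  section_on c Phi U w F -> section_on c Phi U w G.
Proof.
move=> oU FG /(section_onP _ _ oU)[sF PF gF jF]; apply/(section_onP _ _ oU).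
have FGE g i p : c g -> U p -> dom i p -> G g i p = F g i p.
  by move=> cg Up ip; apply/funext => A; rewrite FG.
split.
- move=> g i p cg Up ip A; have sFA := sF g i p cg Up ip A.
  by apply: smooth_near_ext sFA; [exact: oU|exact: Up|move=> x Ux ix; exact: FG].
- by move=> g i p cg Up ip; rewrite FGE//; exact: PF.
- by move=> g gh Om cg cgh h i p Up ip A; rewrite !FGE//; exact: gF.
- by move=> g i j p cg Up ip jp A; rewrite !FGE//; exact: jF.
Qed.

(** Chart-independent scalars of weight [v], the multipliers of sections: powers of [sigma], [I^2]
    and its inverse, cutoff functions. *)
Definition scalar_section U v s :=
  [/\ forall g i p, c g -> U p -> dom i p -> smooth_near i p (s g i),
      forall g ghat Omega, c g -> c ghat -> rescaling Omega g ghat ->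
        forall i p, U p -> dom i p -> s ghat i p = Omega p `^ v * s g i p &
      forall g i j p, c g -> U p -> dom i p -> dom j p -> s g j p = s g i p].

Lemma section_onM U v w s F : open U -> scalar_section U v s -> section_on c Phi U w F ->
  section_on c Phi U (w + v) (fun g i p A => s g i p * F g i p A).
Proof.
move=> oU [ss gs js] /(section_onP _ _ oU)[sF PF gF jF]; apply/(section_onP _ _ oU); split.
- by move=> g i p cg Up ip A; apply: smooth_nearM; [exact: ss|exact: sF].
- by move=> g i p cg Up ip; apply: (fibreZ hPhi) => //; exact: PF.
- move=> g gh Om cg cgh h i p Up ip A.
  rewrite (gs g gh Om)// (gF g gh Om)// tens_actZ.
  have [_ Om0 _] := h; have -> : Om p `^ (w + v) = Om p `^ w * Om p `^ v.
    by rewrite powRD// (gt_eqF (Om0 p)) implybT.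
  ring.
- by move=> g i j p cg Up ip jp A; rewrite (js g i j)// (jF g i j)// tens_actZ.
Qed.

Lemma section_onD U w F G : open U -> section_on c Phi U w F -> section_on c Phi U w G ->
  section_on c Phi U w (fun g i p A => F g i p A + G g i p A).
Proof.
move=> oU /(section_onP _ _ oU)[sF PF gF jF] /(section_onP _ _ oU)[sG PG gG jG].
apply/(section_onP _ _ oU); split.
- by move=> g i p cg Up ip A; apply: smooth_nearD; [exact: sF|exact: sG].
- by move=> g i p cg Up ip; apply: (fibreD hPhi) => //; [exact: PF|exact: PG].
- move=> g gh Om cg cgh h i p Up ip A.
  by rewrite (gF g gh Om)// (gG g gh Om)// tens_actD mulrDr.
- by move=> g i j p cg Up ip jp A; rewrite (jF g i j)// (jG g i j)// tens_actD.
Qed.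

Lemma section_on0 U w : open U -> section_on c Phi U w (fun _ _ _ _ => 0).
Proof.
move=> oU; have t0 T A : tens_act T (fun=> 0 : R) A = 0 :> R by move=> *; rewrite /tens_act big1// => B _; rewrite mulr0.
apply/(section_onP _ _ oU); split.
- by move=> g i p cg Up ip A; exact: smooth_near_cst.
- by move=> g i p cg Up ip; exact: (fibre0 hPhi).
- by move=> g gh Om cg cgh h i p Up ip A; rewrite t0 mulr0.
- by move=> g i j p cg Up ip jp A; rewrite t0.
Qed.

Lemma scalar_section_cst U k : scalar_section U 0 (fun _ _ _ => k).
Proof.
split => //; first by move=> g i p _ _ ip; exact: smooth_near_cst.
by move=> g gh Om _ _ _ i p _ _; rewrite powRr0 mul1r.
Qed.

Lemma section_onZ U w k F : open U -> section_on c Phi U w F ->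
  section_on c Phi U w (fun g i p A => k * F g i p A).
Proof. by move=> oU sF; have := section_onM oU (scalar_section_cst U k) sF; rewrite addr0. Qed.

Variable sigma : density M.
Hypothesis hsigma : is_density c 1 sigma.

Lemma sigma_smooth g i p : c g -> dom i p -> smooth_near i p (sigma g).
Proof. by move=> cg ip; have [s _] := hsigma; exact: (iffLR (smooth_inP i _ openT) (s g cg i)). Qed.

Lemma scalar_section_sigma U k : scalar_section U k%:R (fun g _ p => sigma g p ^+ k).
Proof.
split => //; first by move=> g i p cg _ ip; apply: smooth_nearX; exact: sigma_smooth.
move=> g gh Om cg cgh h i p _ _; have [_ /(_ g gh Om cg cgh h) ->] := hsigma.
have [_ Om0 _] := h.
by rewrite powRr1 ?(ltW (Om0 p))// exprMn powR_mulrn// ltW.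
Qed.

Lemma chart_covariance g i j p a b : c g -> dom i p -> dom j p ->
  g j p a b = \sum_c \sum_e jac i j p c a * jac i j p e b * g i p c e.
Proof. by move=> cg ip jp; have [_ _ H] := class_metric cg; exact: H. Qed.

Lemma idot_scale m' (F : M -> tensor R n m') g gh Om i w p A : c g -> c gh -> rescaling Om g gh ->
  dom i p -> (forall x, dom i x -> smooth_tensor i x F) ->
  idot gh i (sigma gh) w (rescaled i g Om w F) p A =
  Om p `^ (w - 1) * tens_act (scale_change Om g i p) (idot g i (sigma g) w F p) A.
Proof.
move=> cg cgh h ip sF; have [sOm Om0 ghE] := h.
apply: (@idot_rescaled R n M i g gh Om (class_regular cg) (class_regular cgh) _ Om0 (ghE i) n2) => //.
- by move=> x ix; exact: (iffLR (smooth_inP i _ openT) (sOm i)).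
- by move=> x ix; exact: sigma_smooth.
- by move=> x; have [_ H] := hsigma; exact: (H g gh Om).
Qed.

Lemma idot_chart m' (F : M -> tensor R n m') g i j w p A : c g -> dom i p -> dom j p ->
  (forall x, dom i x -> smooth_tensor i x F) ->
  idot g j (sigma g) w (recharted i j F) p A =
  tens_act (chart_change i j p) (idot g i (sigma g) w F p) A.
Proof.
move=> cg ip jp sF; apply: (idot_recharted (class_regular cg) (class_regular cg)) => //.
- by move=> x ix jx a b; exact: chart_covariance.
- by move=> x ix; exact: sigma_smooth.
Qed.

Lemma Isq_smooth_near g i p : c g -> dom i p -> smooth_near i p (Isq sigma g i).
Proof.
by move=> cg; apply: Isq_smooth; [exact: class_regular|move=> x; exact: sigma_smooth].
Qed.

(** Up to the factor [d], [I^2] is I.D of sigma, and I.D takes weight one to weight zero; viewing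
    sigma as a tensor without indices makes the covariance lemmas apply to it. *)
Lemma scalar_section_Isq U : scalar_section U 0 (Isq sigma).
Proof.
have d0 : d != 0 by rewrite pnatr_eq0.
pose A0 : multi n 0 := [ffun=> Top].
split.
- by move=> g i p cg _ ip; exact: Isq_smooth_near.
- move=> g gh Om cg cgh h i p _ ip; apply: (mulfI d0).
  rewrite powRr0 mul1r !(Isq_idot _ _ _ _ A0).
  transitivity (idot gh i (sigma gh) 1 (rescaled i g Om 1 (scalar_tensor (sigma g))) p A0).
    apply: (@idot_ext R n M gh i 0 (sigma gh) 1 p _ _ setT A0 openT) => // x _ ix B.
    by rewrite /rescaled tens_act0 /scalar_tensor; have [_ H] := hsigma; exact: (H g gh Om).
  rewrite (idot_scale 1 A0 cg cgh h ip); last by move=> x ix B; exact: sigma_smooth.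
  by rewrite tens_act0 subrr powRr0 mul1r.
- move=> g i j p cg _ ip jp; apply: (mulfI d0); rewrite !(Isq_idot _ _ _ _ A0).
  transitivity (idot g j (sigma g) 1 (recharted i j (scalar_tensor (sigma g))) p A0).
    apply: (@idot_ext R n M g j 0 (sigma g) 1 p _ _ setT A0 openT) => // x _ ix B.
    by rewrite /recharted tens_act0.
  rewrite (idot_chart 1 A0 cg ip jp); last by move=> x ix B; exact: sigma_smooth.
  by rewrite tens_act0.
Qed.

Hypothesis hI : forall g i p, c g -> dom i p -> Isq sigma g i p != 0.

Lemma scalar_section_IsqV U : scalar_section U 0 (fun g i p => (Isq sigma g i p)^-1).
Proof.
have [ss gs js] := scalar_section_Isq U; split.
- by move=> g i p cg Up ip; apply: smooth_nearV; [exact: ss|exact: hI].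
- by move=> g gh Om cg cgh h i p Up ip; rewrite (gs g gh Om)// powRr0 !mul1r.
- by move=> g i j p cg Up ip jp; rewrite (js g i j).
Qed.

(** For the two transformation laws the representative of [F] in the other scale or chart is first
    replaced by the transported one on an open set, since [idot] differentiates it; the covariance
    lemmas then apply. *)
Lemma section_IdotD w F : is_section c Phi w F -> is_section c Phi (w - 1) (IdotD sigma w F).
Proof.
move=> /(section_onP _ _ openT)[sF PF gF jF].
have sF' g i : c g -> forall x, dom i x -> smooth_tensor i x (F g i).
  by move=> cg x ix; exact: sF.
apply/(section_onP _ _ openT); split.
- move=> g i p cg _ ip A.
  have H := idot_smooth (class_regular cg) w (sigma_smooth cg ip) (sF' g i cg p ip).
  by apply: smooth_near_ext (H A); [exact: openT|by []|move=> x _ _; rewrite IdotDE].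
- move=> g i p cg _ ip.
  have -> : IdotD sigma w F g i p = idot g i (sigma g) w (F g i) p.
    by apply/funext => A; rewrite IdotDE.
  by apply: (fibre_idot hPhi) => //; [move=> g' i'; exact: class_regular|exact: sF'|move=> x ix; exact: PF].
- move=> g gh Om cg cgh h i p _ ip A.
  rewrite IdotDE; transitivity (idot gh i (sigma gh) w (rescaled i g Om w (F g i)) p A).
    apply: (@idot_ext R n M gh i m (sigma gh) w p _ _ setT A openT) => // x _ ix B.
    exact: gF.
  rewrite (idot_scale w A cg cgh h ip (sF' g i cg)); congr (_ * _); apply: tens_act_eq => B.
  by rewrite IdotDE.
- move=> g i j p cg _ ip jp A.
  rewrite IdotDE; transitivity (idot g j (sigma g) w (recharted i j (F g i)) p A).
    apply: (@idot_ext R n M g j m (sigma g) w p _ _ _ A (overlap_open i j)) => // x [ix jx] _ B.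
    exact: jF.
  rewrite (idot_chart w A cg ip jp (sF' g i cg)); apply: tens_act_eq => B.
  by rewrite IdotDE.
Qed.

Lemma IdotD_eq w F G : eq_on c setT F G -> eq_on c setT (IdotD sigma w F) (IdotD sigma w G).
Proof.
move=> FG g i p cg _ ip A; rewrite !IdotDE.
by apply: (@idot_ext R n M g i m (sigma g) w p _ _ setT A openT) => // x _ ix B; exact: FG.
Qed.

Lemma IdotD_lin w k F G : is_section c Phi w F -> is_section c Phi w G ->
  eq_on c setT (IdotD sigma w (fun g i p A => k * F g i p A + G g i p A))
    (fun g i p A => k * IdotD sigma w F g i p A + IdotD sigma w G g i p A).
Proof.
move=> /(section_onP _ _ openT)[sF _ _ _] /(section_onP _ _ openT)[sG _ _ _] g i p cg _ ip A.
rewrite !IdotDE; apply: (@idot_lin R n M g i (class_regular cg) m) => // x ix; [exact: sF|exact: sG].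
Qed.

Lemma IdotD_sigma w k F : is_section c Phi w F ->
  eq_on c setT (IdotD sigma (w + k.+1%:R) (fun g i p A => sigma g p ^+ k.+1 * F g i p A))
   (fun g i p A => sigma g p ^+ k.+1 * IdotD sigma w F g i p A +
      k.+1%:R * (d + 2 * w + k%:R) * Isq sigma g i p * (sigma g p ^+ k * F g i p A)).
Proof.
move=> /(section_onP _ _ openT)[sF _ _ _] g i p cg _ ip A; rewrite !IdotDE.
apply: (@idot_powM R n M sigma g i (class_regular cg)) => // x ix; [exact: sigma_smooth|exact: sF].
Qed.

End SectionOperations.

(** * Division of sections by the defining density *)

Section SectionDivision.
Variables (R : realType) (n : nat) (M : manifold R n) (m : nat).
Variables (q : nat) (c : set (metric_field M)) (Phi : subbundle M m).
Hypothesis hc : conformal_class q c.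
Hypothesis hPhi : tractor_bundle c Phi.
Variables (sigma : density M) (Sigma : set M).
Hypothesis hsigma : is_density c 1 sigma.
Hypothesis hSigma : defining_density c sigma Sigma.
Implicit Types (g : metric_field M) (i : chart M) (p : M) (F G : tractor_field M m) (U W : set M).

Lemma SigmaP g p : c g -> Sigma p <-> sigma g p = 0.
Proof. by move=> cg; have [-> _] := hSigma cg. Qed.

Definition chart_quotient g i (h : M -> R) p :=
  quotient (sigma g \o param i) (h \o param i) (coord i p).

Lemma sigma_regular g i W u : c g -> (coord i @` (W `&` dom i)) u ->
  (sigma g \o param i) u = 0 -> exists a, partial a (sigma g \o param i) u != 0.
Proof.
move=> cg [p [Wp ip] <-] /=; rewrite coordK// => sp0.
have [_ H] := hSigma cg; have [[a ap] _] := H i p (iffRL (SigmaP p cg) sp0) ip.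
by exists a.
Qed.

Lemma chart_quotientP g i W h : c g -> open W ->
  (forall p, W p -> dom i p -> smooth_near i p h) ->
  (forall p, W p -> dom i p -> sigma g p = 0 -> h p = 0) ->
  (forall p, W p -> dom i p -> smooth_near i p (chart_quotient g i h)) /\
  (forall p, W p -> dom i p -> h p = sigma g p * chart_quotient g i h p).
Proof.
move=> cg oW sh h0.
have oU := (@image_coord_open R n M i W oW).
have ss : smooth_in i W (sigma g).
  by apply/(smooth_inP i _ oW) => p _ ip; exact: (sigma_smooth hsigma cg ip).
have sh' : smooth_in i W h by exact/(smooth_inP i _ oW).
have [|sq qE] := smooth_quotient oU ss sh' (fun u => @sigma_regular g i W u cg).
  by move=> u [p [Wp ip] <-] /=; rewrite coordK//; exact: h0.
split; last first.
  move=> p Wp ip; have /= := qE (coord i p); rewrite coordK// => -> //.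
  by exists p.
apply/(smooth_inP i _ oW); apply: (smooth_on_ext oU _ sq) => u /set_mem [p [Wp ip] <-].
by rewrite /chart_quotient /= coordK.
Qed.

(** Multiplication by sigma is injective on smooth functions; all later comparisons of coefficients
    rest on this. *)
Lemma sigma_cancel g i W h : c g -> open W ->
  (forall p, W p -> dom i p -> smooth_near i p h) ->
  (forall p, W p -> dom i p -> sigma g p * h p = 0) ->
  forall p, W p -> dom i p -> h p = 0.
Proof.
move=> cg oW sh h0 p Wp ip.
have oU := (@image_coord_open R n M i W oW).
have ss : smooth_in i W (sigma g).
  by apply/(smooth_inP i _ oW) => x _ ix; exact: (sigma_smooth hsigma cg ix).
have sh' : smooth_in i W h by exact/(smooth_inP i _ oW).
have /= := @smooth_cancel R n _ _ (h \o param i) oU ss sh' (fun u => @sigma_regular g i W u cg) _ (coord i p).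
rewrite coordK//; apply; last by exists p.
by move=> u [x [Wx ix] <-] /=; rewrite coordK//; exact: h0.
Qed.

Lemma section_cancel U w F k : open U -> section_on c Phi U w F ->
  eq_on c U (fun g i p A => sigma g p ^+ k * F g i p A) (fun _ _ _ _ => 0) ->
  eq_on c U F (fun _ _ _ _ => 0).
Proof.
move=> oU /(section_onP _ _ _ _ oU)[sF _ _ _]; elim: k => [|k IH] H.
  by move=> g i p cg Up ip A; have := H g i p cg Up ip A; rewrite expr0 mul1r.
apply: IH => g i p cg Up ip A.
apply: (@sigma_cancel g i U (fun x => sigma g x ^+ k * F g i x A)) Up ip => //.
  move=> x Ux ix; apply: smooth_nearM; last exact: sF.
  by apply: smooth_nearX; exact: (sigma_smooth hsigma cg ix).
by move=> x Ux ix; rewrite mulrA -exprS; exact: H.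
Qed.

(** The quotient is formed component by component, in each scale and chart separately. Its
    transformation laws then follow from those of [F] by cancelling sigma, whose own weight accounts
    for [w - 1]. *)
Lemma section_div w F : is_section c Phi w F -> eq_on c Sigma F (fun _ _ _ _ => 0) ->
  exists2 S, is_section c Phi (w - 1) S &
    eq_on c setT F (fun g i p A => sigma g p * S g i p A).
Proof.
move=> /(section_onP _ _ _ _ openT)[sF PF gF jF] F0.
pose S : tractor_field M m := fun g i p A => chart_quotient g i (fun x => F g i x A) p.
have HS g i A : c g ->
  (forall p, dom i p -> smooth_near i p (fun x => S g i x A)) /\
  (forall p, dom i p -> F g i p A = sigma g p * S g i p A).
  move=> cg; have [||H1 H2] := @chart_quotientP g i setT (fun x => F g i x A) cg openT.
  - by move=> p _ ip; exact: sF.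
  - by move=> p _ ip /(SigmaP p cg) Sp; exact: F0.
  by split=> p ip; [exact: H1|exact: H2].
have sS g i p : c g -> dom i p -> smooth_tensor i p (S g i).
  by move=> cg ip A; have [H _] := HS g i A cg; exact: H.
have FS g i p A : c g -> dom i p -> F g i p A = sigma g p * S g i p A.
  by move=> cg ip; have [_ H] := HS g i A cg; exact: H.
exists S; last by move=> g i p cg _ ip A; exact: FS.
apply/(section_onP _ _ _ _ openT); split.
- by move=> g i p cg _ ip; exact: sS.
- move=> g i p cg _ ip.
  have [U [r [e [[oU Up] Ui se he hx]]]] := frame_coef hPhi cg ip.
  have [x [sx Fx x0]] := hx (F g i) (fun p Up => sF g i p cg I (Ui p Up))
     (fun p Up => PF g i p cg I (Ui p Up)).
  (* The fibre is known through a frame, so the coefficients of [F] are divided as well; the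
     combination of the frame with these quotients agrees with [S] after multiplication by sigma. *)
  pose y k := chart_quotient g i (x k).
  have Hy k : (forall p, U p -> dom i p -> smooth_near i p (y k)) /\
      (forall p, U p -> dom i p -> x k p = sigma g p * y k p).
    apply: chart_quotientP => // [p' Up' _|p' Up' ip' /(SigmaP p' cg) Sp']; first exact: sx.
    by apply: x0 => // A; exact: F0.
  have [PE _] := he p Up.
  rewrite PE; exists (fun k => y k p); apply/funext => A; apply/eqP; rewrite -subr_eq0; apply/eqP.
  apply: (@sigma_cancel g i U (fun z => S g i z A - \sum_k y k z * e k z A)) => //.
    move=> z Uz iz; apply: smooth_nearB; first exact: sS.
    by apply: smooth_near_sum => // k; apply: smooth_nearM; [exact: (Hy k).1|exact: se].
  move=> z Uz iz; rewrite mulrBr -FS// Fx// mulr_sumr -sumrB big1// => k _.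
  by rewrite (Hy k).2// mulrA subrr.
- move=> g gh Om cg cgh h i p _ ip A; have [sOm Om0 _] := h.
  have sOm' x : dom i x -> smooth_near i x Om.
    by move=> ix; exact: (iffLR (smooth_inP i _ openT) (sOm i)).
  pose X x := tens_act (scale_change Om g i x) (S g i x) A.
  have sX x : dom i x -> smooth_near i x X.
    by move=> ix; apply: (smooth_tens_act A) => [//|C D|B]; [exact: (scale_change_smooth (class_regular hc cg) sOm' Om0)|exact: sS].
  have H x : dom i x -> Om x * S gh i x A - Om x `^ w * X x = 0.
    apply: (@sigma_cancel g i setT (fun x => Om x * S gh i x A - Om x `^ w * X x) cg openT) => //.
      move=> z _ iz; apply: smooth_nearB; apply: smooth_nearM; [exact: sOm'|exact: sS| |exact: sX].
      by apply: smooth_near_powR => //; exact: sOm'.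
    move=> z _ iz; have := gF g gh Om cg cgh h i z I iz A.
    rewrite (FS gh)//; have [_ /(_ g gh Om cg cgh h) ->] := hsigma.
    have -> : tens_act (scale_change Om g i z) (F g i z) A = sigma g z * X z.
      by rewrite /X -tens_actZ; apply: tens_act_eq => B; exact: FS.
    rewrite powRr1 ?(ltW (Om0 z))// => E; apply/eqP; rewrite mulrBr subr_eq0; apply/eqP.
    by rewrite mulrCA mulrA E mulrCA.
  have O0 : Om p != 0 by rewrite gt_eqF.
  have := H p ip => /subr0_eq E; apply: (mulfI O0); rewrite E -/(X p) mulrA; congr (_ * _).
  have := @powRD _ (Om p) (w - 1) 1; rewrite subrK powRr1 ?(ltW (Om0 p))// => -> //.
    exact: mulrC.
  by rewrite (gt_eqF (Om0 p)) implybT.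
- move=> g i j p cg _ ip jp A.
  pose X x := tens_act (chart_change i j x) (S g i x) A.
  apply/eqP; rewrite -subr_eq0; apply/eqP.
  apply: (@sigma_cancel g j (dom i) (fun x => S g j x A - X x)) => //.
  + exact: dom_open.
  + move=> z iz jz; apply: smooth_nearB; first exact: sS.
    apply: (smooth_tens_act A) => [//|C D|B]; first exact: chart_change_smooth.
    by apply: smooth_near_chart jz; exact: sS.
  + move=> z iz jz; rewrite mulrBr -FS// (jF g i j z cg I iz jz).
    apply/eqP; rewrite subr_eq0; apply/eqP; rewrite /X -tens_actZ.
    by apply: tens_act_eq => B; rewrite FS.
Qed.

End SectionDivision.

(** * Extension of sections off the hypersurface *)

Section Extension.
Variables (R : realType) (n : nat) (M : manifold R n).
Implicit Types (i j : chart M) (p : M) (U V : set M).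
Notation E := 'rV[R]_n.+1.

(** The Lindelof property: each basic open set contained in some [V p], numbered by an injection
    into the naturals, selects one such point; [p0] fills the other numbers. *)
Lemma countable_subcover (V : M -> set M) p0 : (forall p, open (V p)) -> (forall p, V p p) ->
  exists P : nat -> M, forall x, exists k, V (P k) x.
Proof.
move=> oV Vp; have [B /countable_injP[f finj] [oB hB]] := mfd_second_countable M.
pose good k p := exists b, [/\ B b, f b = k & b `<=` V p].
have /choice[P HP] : forall k, exists p, (exists p', good k p') -> good k p.
  move=> k; have [[p gp]|ng] := pselect (exists p, good k p); first by exists p.
  by exists p0.
exists P => x; have [b /= [Bb bx] bV] := hB x _ (open_nbhs_nbhs (conj (oV x) (Vp x))).
exists (f b); have [|b' [Bb' fb' b'V]] := HP (f b); first by exists x, b; split.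
by apply: b'V; rewrite (finj b' b)// ?inE.
Qed.

Definition cutoff U V (chi : M -> R) :=
  [/\ forall i p, dom i p -> smooth_near i p chi, forall p, V p -> chi p = 1 &
    exists C, [/\ closed C, C `<=` U & forall p, ~ C p -> chi p = 0]].

(** A bump function in a chart. The closed coordinate ball is compact, so its image is compact,
    hence closed because the manifold is Hausdorff, and the extension by zero is smooth. *)
Lemma cutoff_exists U p : open U -> U p ->
  exists V chi, [/\ open V, V p & cutoff U V chi].
Proof.
move=> oU Up; have [i ip] := mfd_cover p.
pose O := coord i @` (U `&` dom i).
have oO : open O by exact: image_coord_open.
have Ou : O (coord i p) by exists p.
have [r r0 rO] : exists2 r : R, 0 < r & forall x, `|x - coord i p| <= r -> O x.
  have /nbhs_ballP[e /= e0 eO] := open_nbhs_nbhs (conj oO Ou).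
  exists (e / 2); first by rewrite divr_gt0.
  move=> x xr; apply: eO; rewrite -ball_normE /ball_/= distrC; apply: le_lt_trans xr _.
  by rewrite ltr_pdivrMr// ltr_pMr// ltr1n.
have [b [sb b1 b0]] := bump_exists (coord i p) r0.
pose K := [set x : E | `|x - coord i p| <= r].
pose chi q := if q \in dom i then b (coord i q) else 0.
have cK : compact K.
  apply: bounded_closed_compact.
    exists (r + `|coord i p|); split; first exact: num_real.
    move=> N Nr x Kx; apply: le_trans (ltW Nr).
    by rewrite -[x in `|x|](subrK (coord i p)); apply: le_trans (ler_normD _ _) _; rewrite lerD2r.
  have -> : K = closed_ball_ Num.norm (coord i p) r.
    by apply/seteqP; split => x; rewrite /closed_ball_ /= /K /= distrC.
  by rewrite -closed_ballE//; exact: closed_ball_closed.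
have cC : closed (param i @` K).
  apply: compact_closed; first exact: mfd_hausdorff.
  apply: continuous_compact cK; apply: continuous_subspaceW (_ : K `<=` O) _.
    by move=> x; exact: rO.
  rewrite continuous_open_subspace// => x /set_mem Ox.
  by apply: param_continuous; case: Ox => y [_ iy] <-; exists y.
have chi0 q : ~ (param i @` K) q -> chi q = 0.
  move=> Cq; rewrite /chi; case: ifPn => // /set_mem iq; apply: b0.
  rewrite ltNge; apply/negP => H; apply: Cq; exists (coord i q) => //.
  exact: coordK.
have [N [oN Np] N1] : exists2 N : set E, open N /\ N (coord i p) & forall x, N x -> b x = 1.
  have /nbhs_ballP[e /= e0 eb] := b1; exists (ball (coord i p) e); last exact: eb.
  by split; [exact: ball_open|exact: ballxx].
exists (dom i `&` [set q | N (coord i q)]), chi; split => //.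
  exact: preimage_coord_open.
split.
- move=> j q jq; have [iq|niq] := pselect (dom i q).
    apply: (@smooth_near_chart _ _ _ i j q chi _ jq); split => //; exists (coord i @` dom i).
    split; [exact: range_open|by exists q|].
    have sb' : smooth_on (coord i @` dom i) b by exact: smooth_on_sub sb.
    have bchi : {in coord i @` dom i, b =1 chi \o param i}.
      by move=> u /set_mem [y iy <-]; rewrite /= coordK// /chi mem_set.
    exact: (@smooth_on_ext R n _ _ _ (@range_open R n M i) bchi sb').
  apply: (@smooth_near_ext _ _ _ j q (fun=> 0) chi (~` (param i @` K))).
  - exact: closed_openC.
  - move=> [x Kx xq]; apply: niq; rewrite -xq.
    by have [y [_ iy] <-] := rO x Kx; rewrite coordK.
  - by move=> z Cz _; rewrite chi0.
  - exact: smooth_near_cst.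
- by move=> q [iq Nq]; rewrite /chi mem_set//; exact: N1.
- exists (param i @` K); split => // q [x Kx <-].
  by have [y [Uy iy] <-] := rO x Kx; rewrite coordK.
Qed.

(** A telescoping partition of unity: the first [N] terms sum to one minus the product of the
    [1 - chi j]. Where [chi k = 1] all later terms vanish and the sum has reached one, which gives
    local finiteness on the sets [V k] of the cover. *)
Definition partition_fun (chi : nat -> M -> R) k p := chi k p * \prod_(j < k) (1 - chi j p).

Lemma partition_fun_sum chi N p :
  \sum_(k < N) partition_fun chi k p = 1 - \prod_(j < N) (1 - chi j p).
Proof.
elim: N => [|N IH]; first by rewrite !big_ord0 subrr.
rewrite !big_ord_recr /= IH /partition_fun; ring.
Qed.

Lemma partition_fun_eq0 chi k l p : chi k p = 1 -> (k < l)%N -> partition_fun chi l p = 0.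
Proof.
move=> ck kl; rewrite /partition_fun (bigD1 (Ordinal kl))//= ck subrr mul0r mulr0 //.
Qed.

Lemma partition_fun_sum1 chi k p : chi k p = 1 -> \sum_(j < k.+1) partition_fun chi j p = 1.
Proof. by move=> ck; rewrite partition_fun_sum big_ord_recr/= ck subrr mulr0 subr0. Qed.

Variables (m q : nat) (c : set (metric_field M)) (Phi : subbundle M m).
Hypothesis hc : conformal_class q c.
Hypothesis hPhi : tractor_bundle c Phi.
Implicit Types (F G : tractor_field M m) (w : R).

Lemma section_local w G : (forall p, exists U, [/\ open U, U p & section_on c Phi U w G]) ->
  is_section c Phi w G.
Proof.
move=> H; apply/(section_onP _ _ _ _ openT).
have loc p : exists U, [/\ open U, U p & [/\ forall g i p, c g -> U p -> dom i p -> smooth_tensor i p (G g i),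
      forall g i p, c g -> U p -> dom i p -> Phi g i p (G g i p),
      forall g ghat Omega, c g -> c ghat -> rescaling Omega g ghat ->
        forall i p, U p -> dom i p -> forall A, G ghat i p A =
          Omega p `^ w * tens_act (scale_change Omega g i p) (G g i p) A &
      forall g i j p, c g -> U p -> dom i p -> dom j p -> forall A,
          G g j p A = tens_act (chart_change i j p) (G g i p) A]].
  by have [U [oU Up /(section_onP _ _ _ _ oU) ?]] := H p; exists U.
split.
- by move=> g i p cg _ ip; have [U [oU Up [h _ _ _]]] := loc p; exact: h.
- by move=> g i p cg _ ip; have [U [oU Up [_ h _ _]]] := loc p; exact: h.
- by move=> g gh Om cg cgh r i p _ ip A; have [U [oU Up [_ _ h _]]] := loc p; exact: h.
- by move=> g i j p cg _ ip jp A; have [U [oU Up [_ _ _ h]]] := loc p; exact: h.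
Qed.

Lemma scalar_section_fun U (f : M -> R) : (forall i p, dom i p -> smooth_near i p f) ->
  scalar_section c U 0 (fun _ _ p => f p).
Proof.
move=> sf; split => //; first by move=> g i p _ _; exact: sf.
by move=> g gh Om _ _ _ i p _ _; rewrite powRr0 mul1r.
Qed.

Lemma cutoff_section U V w chi F : open U -> cutoff U V chi -> section_on c Phi U w F ->
  is_section c Phi w (fun g i p A => chi p * F g i p A).
Proof.
move=> oU [schi _ [C [cC CU chi0]]] sF; apply: section_local => p.
have [Cp|nCp] := pselect (C p).
  exists U; split => //; first exact: CU.
  by have := section_onM hPhi oU (scalar_section_fun U schi) sF; rewrite addr0.
exists (~` C); have oC : open (~` C) by exact: closed_openC.
split => //; apply: (section_on_eq oC _ (section_on0 hPhi w oC)).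
by move=> g i x cg Cx ix A; rewrite chi0// mul0r.
Qed.

Lemma class_nonempty : exists g, c g.
Proof.
have [g hg ->] := hc; exists g; split => //; exists (fun=> 1); split => //.
  by move=> i; apply/(smooth_inP i _ openT) => p _ ip; exact: smooth_near_cst.
by move=> i p ip; rewrite expr1n scale1r.
Qed.

Variables (sigma : density M) (Sigma : set M).
Hypothesis hsigma : is_density c 1 sigma.
Hypothesis hSigma : defining_density c sigma Sigma.

Lemma Sigma_compl_open : open (~` Sigma).
Proof.
have [g cg] := class_nonempty.
rewrite openE => p Sp; have [i ip] := mfd_cover p.
have s0 : sigma g p != 0 by apply/eqP => /(SigmaP hSigma p cg).
have ss := sigma_smooth hsigma cg ip.
have [ O [oO Op _ HO]] := smooth_near_open (P := fun x => x != 0) ss (@open_nonzero _ _) s0.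
have : nbhs p (dom i `&` [set y | O (coord i y)]).
  by apply: open_nbhs_nbhs; split => //; exact: preimage_coord_open.
apply: filterS => y [iy Oy] /(SigmaP hSigma y cg) sy.
by have := HO _ Oy; rewrite coordK// sy eqxx.
Qed.

(** Local extensions, completed by zero on the open complement of the hypersurface, are glued with
    the partition of unity. Every point lies in some [V k], on which the partial sums are constant
    from [N = k + 1] on. *)
Lemma section_extension w phi : section_along c Phi Sigma w phi ->
  exists2 F, is_section c Phi w F & eq_on c Sigma F phi.
Proof.
move=> hphi.
have [[p0 _]|emp] := pselect (exists p : M, True); last first.
  exists (fun _ _ _ _ => 0); first exact: (section_on0 hPhi w openT).
  by move=> g i p; exfalso; apply: emp; exists p.
have loc p : exists X : set M * tractor_field M m * set M * (M -> R),
    let: (U, F, V, chi) := X in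
    [/\ open U /\ section_on c Phi U w F, eq_on c (U `&` Sigma) phi F, open V, V p & cutoff U V chi].
  have [U [F [oU Up sF eF]]] : exists U F, [/\ open U, U p, section_on c Phi U w F &
      eq_on c (U `&` Sigma) phi F].
    have [Sp|nSp] := pselect (Sigma p); first exact: hphi.
    exists (~` Sigma), (fun _ _ _ _ => 0); split => //; first exact: Sigma_compl_open.
      by apply: (section_on0 hPhi w); exact: Sigma_compl_open.
    by move=> g i x _ [] /[swap].
  have [V [chi [oV Vp hchi]]] := cutoff_exists oU Up.
  by exists (U, F, V, chi).
have [X HX] := choice loc.
pose VV p := (X p).1.2.
have [||P HP] := @countable_subcover VV p0.
- by move=> p; have := HX p; rewrite /VV; case: (X p) => -[[U F] V] chi [].
- by move=> p; have := HX p; rewrite /VV; case: (X p) => -[[U F] V] chi [].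
pose U k := (X (P k)).1.1.1; pose F k := (X (P k)).1.1.2; pose V k := VV (P k).
pose chi k := (X (P k)).2.
have HX' k : [/\ open (U k) /\ section_on c Phi (U k) w (F k), eq_on c (U k `&` Sigma) phi (F k), open (V k),
   V k (P k) & cutoff (U k) (V k) (chi k)].
  by have := HX (P k); rewrite /U /F /V /VV /chi; case: (X _) => -[[U' F'] V'] chi'.
pose psi := partition_fun chi.
pose S N : tractor_field M m := fun g i p A => \sum_(k < N) psi k p * F k g i p A.
have schi k i p : dom i p -> smooth_near i p (chi k).
  by move=> ip; have [_ _ _ _ [h _ _]] := HX' k; exact: h.
have sS N : is_section c Phi w (S N).
  elim: N => [|N IH].
    apply: (section_on_eq openT _ (section_on0 hPhi w openT)).
    by move=> g i p _ _ _ A; rewrite /S big_ord0.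
  have [[oU sF] _ _ _ hchi] := HX' N.
  have s1 := cutoff_section oU hchi sF.
  have s2 : is_section c Phi w (fun g i p A => psi N p * F N g i p A).
    have sp i p : dom i p -> smooth_near i p (fun x => \prod_(j < N) (1 - chi j x)).
      move=> ip; apply: smooth_near_prod => // j; apply: smooth_nearB; last exact: schi.
      exact: smooth_near_cst.
    have := section_onM hPhi openT (scalar_section_fun setT sp) s1; rewrite addr0.
    apply: section_on_eq; first exact: openT.
    by move=> g i p _ _ _ A; rewrite /psi /partition_fun; ring.
  apply: (section_on_eq openT _ (section_onD hPhi openT IH s2)).
  by move=> g i p _ _ _ A; rewrite /S big_ord_recr.
have psi0 k l p : V k p -> (k < l)%N -> psi l p = 0.
  move=> Vp kl; apply: (partition_fun_eq0 _ kl).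
  by have [_ _ _ _ [_ h _]] := HX' k; exact: h.
have SE k N p : V k p -> (k < N)%N -> forall g i A, S N g i p A = S k.+1 g i p A.
  move=> Vp kN g i A; rewrite /S (big_ord_widen N (fun k : nat => psi k p * F k g i p A) kN).
  rewrite [LHS](bigID (fun j : 'I_N => (j < k.+1)%N))/= [X in _ + X]big1 ?addr0// => j.
  by rewrite -leqNgt => kj; rewrite (psi0 k)// mul0r.
(* [K p] is an index with [p] in [V (K p)]. The infinite sum is read at the partial sum where it has
   stabilised; nearby points with another index give the same value. *)
have [K HK] := choice HP.
exists (fun g i p A => S (K p).+1 g i p A).
  apply: section_local => p; exists (V (K p)); have [_ _ oV _ _] := HX' (K p).
  split; [exact: oV|exact: HK|apply: (section_on_eq oV _ (section_onS openT oV (@subsetT _ _) (sS (K p).+1)))].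
  move=> g i x _ Vx ix A; pose N := (maxn (K p) (K x)).+1.
  by rewrite -(SE (K p) N x)// ?ltnS ?leq_maxl// -(SE (K x) N x)// ?ltnS ?leq_maxr//; exact: HK.
move=> g i p cg Sp ip A; rewrite /S.
have ck : chi (K p) p = 1 by have [_ _ _ _ [_ h _]] := HX' (K p); apply: h; exact: HK.
rewrite -[RHS]mul1r -(partition_fun_sum1 ck) mulr_suml; apply: eq_bigr => j _.
have [[oU _] eF _ _ [_ _ [C [_ CU chi0]]]] := HX' j.
have [Cp|nCp] := pselect (C p); last by rewrite /psi /partition_fun chi0// !mul0r.
by rewrite eF//; split => //; exact: CU.
Qed.

End Extension.

(** * The formal recursion *)

Section Recursion.
Variables (R : realType) (n : nat) (M : manifold R n) (m : nat).
Notation d := (n.+1%:R : R).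
Hypothesis n2 : (2 <= n)%N.
Variables (q : nat) (c : set (metric_field M)) (Phi : subbundle M m).
Hypothesis hc : conformal_class q c.
Hypothesis hPhi : tractor_bundle c Phi.
Variables (sigma : density M) (Sigma : set M).
Hypothesis hsigma : is_density c 1 sigma.
Hypothesis hSigma : defining_density c sigma Sigma.
Hypothesis hI : forall g i p, c g -> dom i p -> Isq sigma g i p != 0.
Implicit Types (g : metric_field M) (i : chart M) (p : M) (F G S : tractor_field M m) (w : R).
Notation sec := (is_section c Phi).
Notation "F =M G" := (eq_on c setT F G) (at level 70).
Notation zero := (fun _ _ _ _ => 0).

Lemma sec_eq w F G : F =M G -> sec w F -> sec w G.
Proof. exact: section_on_eq openT. Qed.

Lemma secD w F G : sec w F -> sec w G -> sec w (fun g i p A => F g i p A + G g i p A).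
Proof. exact: (section_onD hPhi openT). Qed.

Lemma secZ w a F : sec w F -> sec w (fun g i p A => a * F g i p A).
Proof. exact: (section_onZ hPhi a openT). Qed.

Lemma sec_sigma w k F : sec (w - k%:R) F -> sec w (fun g i p A => sigma g p ^+ k * F g i p A).
Proof.
move=> sF; have := section_onM hPhi openT (scalar_section_sigma hsigma setT k) sF.
by rewrite subrK.
Qed.

Lemma sec_IsqV w F : sec w F -> sec w (fun g i p A => (Isq sigma g i p)^-1 * F g i p A).
Proof.
move=> sF; have := section_onM hPhi openT (scalar_section_IsqV n2 hc hsigma hI setT) sF.
by rewrite addr0.
Qed.

Lemma sec_Isq w F : sec w F -> sec w (fun g i p A => Isq sigma g i p * F g i p A).
Proof.
move=> sF; have := section_onM hPhi openT (scalar_section_Isq n2 hc hsigma setT) sF.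
by rewrite addr0.
Qed.

Lemma sec_IdotD w F : sec w F -> sec (w - 1) (IdotD sigma w F).
Proof. exact: (section_IdotD n2 hc hPhi hsigma). Qed.

Lemma IdotDD w F G : sec w F -> sec w G ->
  IdotD sigma w (fun g i p A => F g i p A + G g i p A) =M
  (fun g i p A => IdotD sigma w F g i p A + IdotD sigma w G g i p A).
Proof.
move=> sF sG g i p cg _ ip A; rewrite -[X in X + _]mul1r.
have /= <- := IdotD_lin hc sigma 1 sF sG cg (Logic.I : [set: M] p) ip A.
by apply: (IdotD_eq _ _ _ cg (Logic.I : [set: M] p) ip A) => g' i' x _ _ _ B; rewrite mul1r.
Qed.

(** One factor of [Pop], which is peeled off from the inside of the iterate. *)
Definition yop w F : tractor_field M m :=
  fun g i p A => - (Isq sigma g i p)^-1 * IdotD sigma w F g i p A.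

Lemma sec_yop w F : sec w F -> sec (w - 1) (yop w F).
Proof.
move=> sF; apply: sec_eq (secZ (-1) (sec_IsqV (sec_IdotD sF))) => g i p _ _ _ A.
by rewrite /yop mulrA mulN1r.
Qed.

Lemma yop_eq w F G : F =M G -> yop w F =M yop w G.
Proof. by move=> FG g i p cg x ip A; rewrite /yop (IdotD_eq _ w FG). Qed.

Lemma yop_sigma w k F : sec w F ->
  yop (w + k.+1%:R) (fun g i p A => sigma g p ^+ k.+1 * F g i p A) =M
  (fun g i p A => sigma g p ^+ k * (- (k.+1%:R * (d + 2 * w + k%:R)) * F g i p A
     + sigma g p * yop w F g i p A)).
Proof.
move=> sF g i p cg x ip A; rewrite /yop (IdotD_sigma hc hsigma k sF cg x ip A).
have := hI cg ip; move: (Isq _ _ _ _) (IdotD _ _ _ _ _ _ _) (F _ _ _ _) k.+1%:R k%:R => J D y a b J0.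
by rewrite exprS; field.
Qed.

Lemma yop_lin w a F G : sec w F -> sec w G ->
  yop w (fun g i p A => a * F g i p A + G g i p A) =M
  (fun g i p A => a * yop w F g i p A + yop w G g i p A).
Proof.
by move=> sF sG g i p cg x ip A; rewrite /yop (IdotD_lin hc sigma a sF sG cg x ip A) mulrDr mulrCA.
Qed.

Lemma PopS w k F : Pop sigma w k.+1 F = Pop sigma (w - 1) k (yop w F).
Proof. by []. Qed.

Lemma Pop_eq w k F G : F =M G -> Pop sigma w k F =M Pop sigma w k G.
Proof. by elim: k w F G => [//|k IH] w F G FG; rewrite !PopS; apply: IH; exact: yop_eq. Qed.

Lemma Pop_lin w k a F G : sec w F -> sec w G ->
  Pop sigma w k (fun g i p A => a * F g i p A + G g i p A) =M
  (fun g i p A => a * Pop sigma w k F g i p A + Pop sigma w k G g i p A).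
Proof.
elim: k w F G => [//|k IH] w F G sF sG g i p cg x ip A; rewrite !PopS.
rewrite (Pop_eq _ _ (yop_lin a sF sG))// IH//; exact: sec_yop.
Qed.

(* Tangentiality: the second term drops out when [k = d + 2 (w - 1)]. *)
Lemma Pop_sigma1 w k G : sec (w - 1) G ->
  Pop sigma w k.+1 (fun g i p A => sigma g p * G g i p A) =M
  (fun g i p A => - (k.+1%:R * (d + 2 * (w - 1) - k%:R)) * Pop sigma (w - 1) k G g i p A
     + sigma g p * Pop sigma (w - 1) k.+1 G g i p A).
Proof.
have y1 v F : sec (v - 1) F -> yop v (fun g i p A => sigma g p * F g i p A) =M
    (fun g i p A => - (d + 2 * (v - 1)) * F g i p A + sigma g p * yop (v - 1) F g i p A).
  move=> sF g i p cg x ip A; have := yop_sigma 0 sF cg x ip A.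
  rewrite subrK expr0 mul1r addr0 mul1r => <-.
  by apply: yop_eq => // g' i' x' _ _ _ B; rewrite expr1.
elim: k w G => [|k IH] w G sG g i p cg x ip A; rewrite PopS.
  by rewrite (Pop_eq _ _ (y1 _ _ sG))// mul1r subr0.
rewrite (Pop_eq _ _ (y1 _ _ sG))//.
have sy := sec_yop sG.
rewrite Pop_lin//; last first.
  apply: sec_eq (sec_sigma (k := 1) _); last exact: sy.
  by move=> g' i' x' _ _ _ B; rewrite expr1.
rewrite (IH (w - 1) (yop (w - 1) G) sy)// -PopS -PopS.
rewrite -[k.+2]addn1 -[k.+1]addn1 !natrD.
move: (Pop _ _ _ _ _ _ _ _) (Pop _ _ _ _ _ _ _ _) => a b; ring.
Qed.

(** Each factor lowers the power of sigma by one and multiplies the leading coefficient by an sl(2)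
    constant; the condition lists the factors [d + 2 w + e] of [K] that must not vanish. The surplus
    power [j] is kept for residuals of higher order. *)
Lemma Pop_sigma w k j G : sec w G -> exists K G', [/\
  (forall e, (j <= e < k + j)%N -> d + 2 * w + e%:R != 0) -> K != 0, sec (w - 1) G' &
  Pop sigma (w + (k + j)%:R) k (fun g i p A => sigma g p ^+ (k + j) * G g i p A) =M
  (fun g i p A => sigma g p ^+ j * (K * G g i p A + sigma g p * G' g i p A))].
Proof.
elim: k G => [|k IH] G sG.
  exists 1, zero; split; first by rewrite oner_neq0.
    exact: (section_on0 hPhi _ openT).
  by move=> g i p cg x ip A; rewrite /= mul1r mulr0 addr0.
pose a := - ((k + j).+1%:R * (d + 2 * w + (k + j)%:R)).
pose G1 : tractor_field M m := fun g i p A => a * G g i p A + sigma g p * yop w G g i p A.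
have sG1 : sec w G1.
  apply: secD; first exact: secZ.
  apply: sec_eq (sec_sigma (k := 1) (sec_yop sG)) => g' i' x' _ _ _ B.
  by rewrite expr1.
have [K [G' [K0 sG' E]]] := IH G1 sG1.
exists (K * a), (fun g i p A => K * yop w G g i p A + G' g i p A); split.
- move=> H; rewrite mulf_neq0//; first by apply: K0 => e /andP[je ek]; apply: H; rewrite je/= addSn ltnS ltnW.
  rewrite oppr_eq0 mulf_neq0// ?pnatr_eq0//; apply: H.
  by rewrite addSn ltnS leqnn leq_addl.
- apply: secD; last exact: sG'.
  by apply: secZ; exact: sec_yop.
- move=> g i p cg x ip A; rewrite PopS.
  rewrite addSn (Pop_eq _ _ (yop_sigma (k + j) sG))//.
  have -> : w + (k + j).+1%:R - 1 = w + (k + j)%:R by rewrite -natr1; ring.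
  rewrite E// /G1; ring.
Qed.

Variable w0 : R.
Notation h0 := (d + 2 * w0).

(** For [G] of weight [w = w0 - l - 1] the sl(2) factor [d + 2 w + l] is [h0 - l - 2]. *)
Lemma IdotD_step l F G : sec w0 F -> sec (w0 - l.+1%:R) G ->
  IdotD sigma w0 (fun g i p A => F g i p A + sigma g p ^+ l.+1 * G g i p A) =M
  (fun g i p A => IdotD sigma w0 F g i p A + sigma g p ^+ l *
    (l.+1%:R * (h0 - l.+2%:R) * (Isq sigma g i p * G g i p A)
     + sigma g p * IdotD sigma (w0 - l.+1%:R) G g i p A)).
Proof.
move=> sF sG g i p cg x ip A; rewrite IdotDD//; last exact: sec_sigma.
have := IdotD_sigma hc hsigma l sG cg x ip A; rewrite subrK => ->.
rewrite exprS -[l.+2%:R]natr1 -[in l.+1%:R + 1]natr1.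
have -> : d + 2 * (w0 - l.+1%:R) + l%:R = h0 - (l%:R + 1 + 1) by rewrite -natr1; ring.
move: (IdotD _ _ _ _ _ _ _) (IdotD _ _ _ _ _ _ _) (Isq _ _ _ _) => a b e; ring.
Qed.

Variable f0 : tractor_field M m.
Hypothesis sf0 : sec w0 f0.
Notation expan := (expansion sigma f0).
Implicit Types (fs gs : nat -> tractor_field M m).

Lemma expansionS fs l g i p A :
  expan fs l.+1 g i p A = expan fs l g i p A + sigma g p ^+ l.+1 * fs l.+1 g i p A.
Proof. by rewrite /expansion big_nat_recr//= addrA. Qed.

Lemma expansion0 fs g i p A : expan fs 0 g i p A = f0 g i p A.
Proof. by rewrite /expansion big_geq// addr0. Qed.

Lemma expansion_eq fs gs l : (forall k, (1 <= k <= l)%N -> gs k = fs k) ->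
  expan gs l = expan fs l.
Proof.
move=> E; apply/funext => g; apply/funext => i; apply/funext => p; apply/funext => A.
congr (_ + _); rewrite !big_nat; apply: eq_bigr => k kl; rewrite E//.
Qed.

Definition coefficients fs l := forall k, (1 <= k <= l)%N -> sec (w0 - k%:R) (fs k).

Lemma coefficientsS fs l : coefficients fs l.+1 -> coefficients fs l.
Proof. by move=> H k /andP[k1 kl]; apply: H; rewrite k1 ltnW. Qed.

Lemma coefficients_last fs l : coefficients fs l.+1 -> sec (w0 - l.+1%:R) (fs l.+1).
Proof. by apply; rewrite leqnn. Qed.

Lemma sec_expansion fs l : coefficients fs l -> sec w0 (expan fs l).
Proof.
elim: l => [|l IH] H.
  by apply: sec_eq sf0 => g i p _ _ _ A; rewrite expansion0.
have := secD (IH (coefficientsS H)) (sec_sigma (coefficients_last H)).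
by apply: sec_eq => g i p _ _ _ A; rewrite expansionS.
Qed.

(** The recursion carries the quotient of I.D of the expansion by [sigma^l] explicitly, since its
    values on the hypersurface decide the next coefficient. *)
Definition residual fs l S := sec (w0 - 1 - l%:R) S /\
  IdotD sigma w0 (expan fs l) =M (fun g i p A => sigma g p ^+ l * S g i p A).

Lemma IdotD_expansionS fs l : coefficients fs l.+1 ->
  IdotD sigma w0 (expan fs l.+1) =M
  (fun g i p A => IdotD sigma w0 (expan fs l) g i p A + sigma g p ^+ l *
    (l.+1%:R * (h0 - l.+2%:R) * (Isq sigma g i p * fs l.+1 g i p A)
     + sigma g p * IdotD sigma (w0 - l.+1%:R) (fs l.+1) g i p A)).
Proof.
move=> H g i p cg x ip A.
rewrite -(IdotD_step (sec_expansion (coefficientsS H)) (coefficients_last H) cg x ip A).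
by apply: IdotD_eq => // g' i' x' _ _ _ B; rewrite expansionS.
Qed.

(** [solves_to] quantifies over every section with the given expansion. A change by [sigma^(l+1) T]
    alters I.D by a multiple of [sigma^l], so testing the partial sum itself is enough. *)
Lemma solves_toP fs l : solves_to c Phi sigma w0 f0 fs l <->
  coefficients fs l /\ exists S, residual fs l S.
Proof.
split=> [[cf H]|[cf [S [sS E]]]]; split => //.
  have [|S sS E] := H _ (sec_expansion cf); last by exists S.
  exists zero; first exact: (section_on0 hPhi _ openT).
  by move=> g i p _ _ _ A; rewrite /sub_field subrr mulr0.
move=> F sF [T sT FE].
have FE' : F =M (fun g i p A => expan fs l g i p A + sigma g p ^+ l.+1 * T g i p A).
  by move=> g i p cg x ip A; rewrite -FE// /sub_field addrC subrK.
exists (fun g i p A => S g i p A + (l.+1%:R * (h0 - l.+2%:R) * (Isq sigma g i p * T g i p A)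
     + sigma g p * IdotD sigma (w0 - l.+1%:R) T g i p A)).
  have wE : w0 - 1 - l%:R = w0 - l.+1%:R by rewrite -natr1; ring.
  rewrite wE; apply: secD; first by rewrite -wE.
  apply: secD; first by apply: secZ; exact: sec_Isq.
  apply: sec_eq (sec_sigma (k := 1) (sec_IdotD sT)) => g i p _ _ _ A.
  by rewrite expr1.
move=> g i p cg x ip A; rewrite (IdotD_eq _ _ FE')// IdotD_step//; last exact: sec_expansion.
by rewrite E//; exact/esym/mulrDr.
Qed.

Lemma same_expansion_sub fs gs l (V : tractor_field M m) : coefficients fs l.+1 -> coefficients gs l.+1 ->
  sec (w0 - l.+1%:R) V ->
  sub_field (expan fs l) (expan gs l) =M (fun g i p A => sigma g p ^+ l.+1 * V g i p A) ->
  exists U, [/\ sec (w0 - l.+1%:R) U,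
    U =M (fun g i p A => V g i p A + (fs l.+1 g i p A - gs l.+1 g i p A)) &
    sub_field (expan fs l.+1) (expan gs l.+1) =M (fun g i p A => sigma g p ^+ l.+1 * U g i p A)].
Proof.
move=> cf cf' sV E; exists (fun g i p A => V g i p A + (fs l.+1 g i p A + -1 * gs l.+1 g i p A)).
split.
- apply: secD => //; apply: secD; first exact: coefficients_last.
  by apply: secZ; exact: coefficients_last.
- by move=> g i p _ _ _ A; rewrite mulN1r.
- move=> g i p cg x ip A; have := E g i p cg x ip A.
  rewrite /sub_field !expansionS => /eqP; rewrite subr_eq => /eqP ->; ring.
Qed.

Lemma bigO_of_vanishing w k F U : sec (w - k%:R) U ->
  F =M (fun g i p A => sigma g p ^+ k * U g i p A) -> eq_on c Sigma U zero ->
  bigO c Phi sigma w k.+1 F.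
Proof.
move=> sU FE U0; have [S sS UE] := section_div hc hPhi hsigma hSigma sU U0.
exists S; first by have -> : w - k.+1%:R = w - k%:R - 1 by rewrite -natr1; ring.
by move=> g i p cg x ip A; rewrite FE// UE// exprSr mulrA.
Qed.

Lemma sigma_pow_cancel w k F G : sec w F -> sec w G ->
  (fun g i p A => sigma g p ^+ k * F g i p A) =M (fun g i p A => sigma g p ^+ k * G g i p A) ->
  F =M G.
Proof.
move=> sF sG E g i p cg x ip A; apply/eqP; rewrite -subr_eq0; apply/eqP.
have sFG := secD sF (secZ (-1) sG).
have H : eq_on c setT (fun g i p A => F g i p A + -1 * G g i p A) zero.
  apply: (section_cancel hsigma hSigma (k := k) openT sFG) => g' i' x' cg' X ix B.
  by have /= E' := E g' i' x' cg' X ix B; rewrite mulN1r mulrBr E' subrr.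
by rewrite -mulN1r; exact: H.
Qed.

Lemma sigma_eq0 g p : c g -> Sigma p -> sigma g p = 0.
Proof. by move=> cg Sp; exact/(SigmaP hSigma p cg). Qed.

(** If the expansions up to order [l + 1] differ by [sigma^(l+1) U], I.D of the difference starts
    with [(l + 1) (h0 - l - 2) I^2 U] at order [sigma^l], while both residuals push it to order
    [sigma^(l+1)]. After cancelling [sigma^l], [U] vanishes along the hypersurface and one more
    power of sigma splits off. *)
Lemma uniqueness_step fs gs l : (exists S, residual fs l.+1 S) -> (exists S, residual gs l.+1 S) ->
  coefficients fs l.+1 -> coefficients gs l.+1 -> h0 != l.+2%:R ->
  bigO c Phi sigma w0 l.+1 (sub_field (expan fs l) (expan gs l)) ->
  bigO c Phi sigma w0 l.+2 (sub_field (expan fs l.+1) (expan gs l.+1)).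
Proof.
move=> [S [sS ES]] [T [sT ET]] cf cf' hl [V sV EV].
have [U [sU _ EU]] := same_expansion_sub cf cf' sV EV.
apply: (bigO_of_vanishing sU EU).
pose a := l.+1%:R * (h0 - l.+2%:R).
have a0 : a != 0 by rewrite mulf_neq0// ?pnatr_eq0// subr_eq0.
have wE : w0 - 1 - l%:R = w0 - l.+1%:R by rewrite -natr1; ring.
have wE' : w0 - 1 - l.+1%:R = w0 - l.+1%:R - 1 by ring.
pose X : tractor_field M m := fun g i p A => a * (Isq sigma g i p * U g i p A)
  + sigma g p * IdotD sigma (w0 - l.+1%:R) U g i p A.
pose Y : tractor_field M m := fun g i p A => sigma g p * (S g i p A + -1 * T g i p A).
have s1 G : sec (w0 - l.+1%:R - 1) G -> sec (w0 - l.+1%:R) (fun g i p A => sigma g p * G g i p A).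
  move=> sG; apply: sec_eq (sec_sigma (k := 1) sG) => g i p _ _ _ A.
  by rewrite expr1.
have sX : sec (w0 - l.+1%:R) X.
  by apply: secD; [apply: secZ; exact: sec_Isq|apply: s1; exact: sec_IdotD].
have sY : sec (w0 - l.+1%:R) Y.
  by apply: s1; rewrite -wE'; apply: secD => //; exact: secZ.
have XY : X =M Y.
  apply: (sigma_pow_cancel (k := l) sX sY) => g i p cg x ip A.
  have e1 : expan fs l.+1 =M (fun g i p A => expan gs l.+1 g i p A + sigma g p ^+ l.+1 * U g i p A).
    by move=> g' i' x' cg' y' ix B; have := EU g' i' x' cg' y' ix B; rewrite /sub_field => <-; rewrite addrC subrK.
  have e2 := IdotD_step (sec_expansion cf') sU cg x ip A.
  have e3 : IdotD sigma w0 (expan fs l.+1) g i p A = _ := etrans (IdotD_eq _ _ e1 cg x ip A) e2.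
  move: e3; rewrite (ES g i p cg x ip A) (ET g i p cg x ip A) /X /Y -/a.
  move: (Isq _ _ _ _) (IdotD _ _ _ _ _ _ _) => J D /eqP; rewrite addrC -subr_eq => /eqP <-.
  rewrite exprS; ring.
move=> g i p cg Sp ip A; have := XY g i p cg Logic.I ip A.
rewrite /X /Y (sigma_eq0 cg Sp) !mul0r addr0 => /eqP.
by rewrite mulf_eq0 (negbTE a0) mulf_eq0 (negbTE (hI cg ip))/= => /eqP.
Qed.

(** The coefficient that cancels the residual [S] of order [l]. At a resonance the inverted constant
    is zero, and so is this section: the recursion is total and only its correctness is
    conditional. *)
Definition next_coef l S : tractor_field M m :=
  fun g i p A => - (l.+1%:R * (h0 - l.+2%:R))^-1 * ((Isq sigma g i p)^-1 * S g i p A).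

Lemma sec_next_coef l S : sec (w0 - 1 - l%:R) S -> sec (w0 - l.+1%:R) (next_coef l S).
Proof.
have -> : w0 - 1 - l%:R = w0 - l.+1%:R by rewrite -natr1; ring.
by move=> sS; apply: secZ; exact: sec_IsqV.
Qed.

(** Once [next_coef] has cancelled the residual of order [l], the residual of order [l + 1] is
    exactly I.D of the new coefficient. *)
Fixpoint resid a S k : tractor_field M m :=
  if k is k'.+1 then IdotD sigma (w0 - (a + k').+1%:R) (next_coef (a + k') (resid a S k')) else S.

(** The starting order [a] is arbitrary because the resonant case restarts just above the resonance.
    The nonvanishing condition is imposed up to [l] only, so that one sequence also covers the
    orders below a resonance. *)
Lemma continuation a fs S : coefficients fs a -> residual fs a S ->
  exists gs, (forall k, (k <= a)%N -> gs k = fs k) /\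
    forall l, (a <= l)%N -> (forall k, (a <= k < l)%N -> h0 != k.+2%:R) ->
      coefficients gs l /\ exists T, residual gs l T.
Proof.
move=> cf [sS ES].
(* For [k > a] the coefficient of index [k] cancels the residual of order [k - 1], which is number
   [k - 1 - a] in the list started at [S]. *)
pose gs k := if (k <= a)%N then fs k else next_coef k.-1 (resid a S (k.-1 - a)).
have fa k : (k <= a)%N -> gs k = fs k by rewrite /gs => ->.
exists gs; split => // l al.
suff H : (forall k, (a <= k < l)%N -> h0 != k.+2%:R) ->
   coefficients gs l /\ residual gs l (resid a S (l - a)).
  by move=> /H[cl rl]; split => //; exists (resid a S (l - a)).
elim: l al => [|l IH].
  rewrite leqn0 => /eqP a0 _; move: cf sS ES; rewrite a0 => cf sS ES; split; first by case.
  split => //; by rewrite (expansion_eq (fs := fs))// => k /andP[]; case: k.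
rewrite leq_eqVlt => /orP[/eqP <- _|]; last rewrite ltnS => al hl.
  rewrite subnn /=; split.
    by move=> k /andP[k1 ka]; rewrite fa//; apply: cf; rewrite k1.
  by split => //; rewrite (expansion_eq (fs := fs))// => k /andP[_ ka]; exact: fa.
have [|cl [sl El]] := IH al; first by move=> k /andP[ak kl]; apply: hl; rewrite ak leqW.
have fl : gs l.+1 = next_coef l (resid a S (l - a)) by rewrite /gs ltnNge al.
have rl : resid a S (l.+1 - a) = IdotD sigma (w0 - l.+1%:R) (gs l.+1).
  by rewrite subSn//= subnKC// -fl.
have sf : sec (w0 - l.+1%:R) (gs l.+1) by rewrite fl; exact: sec_next_coef.
have cS : coefficients gs l.+1.
  move=> k /andP[k1]; rewrite leq_eqVlt => /orP[/eqP -> //|]; rewrite ltnS => kl.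
  by apply: cl; rewrite k1.
split => //; rewrite rl; split.
  have -> : w0 - 1 - l.+1%:R = w0 - l.+1%:R - 1 by ring.
  exact: sec_IdotD.
move=> g i p cg x ip A; rewrite IdotD_expansionS// El//.
have a0 : l.+1%:R * (h0 - l.+2%:R) != 0.
  by rewrite mulf_neq0 ?pnatr_eq0// subr_eq0; apply: hl; rewrite al leqnn.
rewrite [in Isq _ _ _ _ * _]fl /next_coef exprS.
have := hI cg ip; move: (Isq _ _ _ _) (IdotD _ _ _ _ _ _ _) (resid _ _ _ _ _ _ _) (sigma g p ^+ l) a0.
move: (l.+1%:R * (h0 - l.+2%:R)) => b J D y s b0 J0.
by field; rewrite b0 J0.
Qed.

(** Started from [f0] alone, whose residual of order zero is [IdotD sigma w0 f0]. In the resonant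
    case the same sequence provides the coefficients up to the resonance. *)
Lemma nonresonant_solution : exists fs, forall l,
  (forall k, (k < l)%N -> h0 != k.+2%:R) -> coefficients fs l /\ exists T, residual fs l T.
Proof.
have [||fs [_ H]] := @continuation 0 (fun=> zero) (IdotD sigma w0 f0).
- by case.
- split; first by rewrite subr0; exact: sec_IdotD.
  move=> g i p cg x ip A; rewrite expr0 mul1r.
  by apply: IdotD_eq => // g' i' x' _ _ _ B; rewrite expansion0.
by exists fs => l hl; apply: H.
Qed.

Lemma expansion_along fs l : eq_on c Sigma (expan fs l) f0.
Proof.
elim: l => [|l IH] g i p cg Sp ip A; first by rewrite expansion0.
by rewrite expansionS IH// exprS (sigma_eq0 cg Sp) !mul0r addr0.
Qed.

(** * The resonant case [h0 = t + 2], with obstruction operator [P_(t+1)] *)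

Variable t : nat.
Hypothesis ht : h0 = t.+2%:R.

(** Two extensions differ by a multiple of sigma, and the constant in [Pop_sigma1] contains
    [h0 - 2 - t = 0]: only a term with a factor sigma remains. *)
Lemma Pop_along F G : sec w0 F -> sec w0 G -> eq_on c Sigma F G ->
  eq_on c Sigma (Pop sigma w0 t.+1 F) (Pop sigma w0 t.+1 G).
Proof.
move=> sF sG FG; have sFG := secD sF (secZ (-1) sG).
have [|X sX EX] := section_div hc hPhi hsigma hSigma sFG.
  by move=> g i p cg Sp ip A; rewrite FG// mulN1r subrr.
have sX' : sec w0 (fun g i p A => sigma g p * X g i p A).
  by apply: sec_eq (sec_sigma (k := 1) sX) => g i p _ _ _ A; rewrite expr1.
have E : F =M (fun g i p A => 1 * G g i p A + sigma g p * X g i p A).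
  by move=> g i p cg x ip A; rewrite -EX// mul1r mulN1r addrC subrK.
move=> g i p cg Sp ip A; rewrite (Pop_eq _ _ E)// Pop_lin// Pop_sigma1//.
have -> : d + 2 * (w0 - 1) - t%:R = 0.
  have -> : d + 2 * (w0 - 1) - t%:R = h0 - 2 - t%:R by ring.
  by rewrite ht -[t.+2]addn2 natrD; ring.
by rewrite (sigma_eq0 cg Sp) mulr0 oppr0 !mul0r !addr0 mul1r.
Qed.

(** The innermost factor of [P_(t+1)] yields [- I^(-2) S] times [sigma^(t+j)], and the other [t]
    factors consume [t] powers of sigma. The constants [d + 2 w + e] become [e - t - 2 j] with
    [e < t + j], hence are nonzero. With [j = 0] the obstruction detects the residual of order [t];
    with [j > 0] it is seen to vanish when the expansion continues. *)
Lemma Pop_residual fs j S : coefficients fs (t + j) -> residual fs (t + j) S ->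
  exists K G, K != 0 /\ Pop sigma w0 t.+1 (expan fs (t + j)) =M
    (fun g i p A => sigma g p ^+ j * (K * (- (Isq sigma g i p)^-1 * S g i p A)
       + sigma g p * G g i p A)).
Proof.
move=> cf [sS ES]; pose X : tractor_field M m := fun g i p A => - (Isq sigma g i p)^-1 * S g i p A.
have sX : sec (w0 - 1 - (t + j)%:R) X.
  apply: sec_eq (secZ (-1) (sec_IsqV sS)) => g i p _ _ _ A.
  by rewrite mulrA mulN1r.
have [K [G [K0 _ E]]] := Pop_sigma t j sX.
exists K, G; split.
  apply: K0 => e /andP[_ et].
  have -> : d + 2 * (w0 - 1 - (t + j)%:R) + e%:R = e%:R - (t + j + j)%:R.
    have -> : d + 2 * (w0 - 1 - (t + j)%:R) + e%:R = h0 - 2 - 2 * (t + j)%:R + e%:R by ring.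
    by rewrite ht -[t.+2]addn2 !natrD; ring.
  by rewrite subr_eq0 eqr_nat ltn_eqF// (leq_trans et)// leq_addr.
rewrite subrK in E; move=> g i p cg x ip A; rewrite PopS -E//.
apply: Pop_eq => // g' i' x' cg' y ix B.
by rewrite /yop ES// /X mulrCA.
Qed.

Lemma residual_vanishes fs S : coefficients fs t -> residual fs t S ->
  eq_on c Sigma (Pop sigma w0 t.+1 f0) zero -> eq_on c Sigma S zero.
Proof.
move=> cf rS P0 g i p cg Sp ip A.
have := @Pop_residual fs 0 S; rewrite addn0 => /(_ cf rS)[K [G [K0 E]]].
have := Pop_along (sec_expansion cf) sf0 (expansion_along fs t) cg Sp ip A.
rewrite P0// E// (sigma_eq0 cg Sp) expr0 mul1r mul0r addr0 => /eqP.
rewrite mulf_eq0 (negbTE K0) mulf_eq0 oppr_eq0 invr_eq0 (negbTE (hI cg ip))/=.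
by move/eqP.
Qed.

Lemma Pop_vanishes fs l S : (t < l)%N -> coefficients fs l -> residual fs l S ->
  eq_on c Sigma (Pop sigma w0 t.+1 f0) zero.
Proof.
move=> tl cf rS g i p cg Sp ip A.
have [j lE] : exists j, l = (t + j.+1)%N by exists (l - t.+1)%N; rewrite addnS -addSn subnKC.
rewrite -(Pop_along (sec_expansion cf) sf0 (expansion_along fs l))//.
rewrite lE in cf rS *; have [K [G [_ E]]] := Pop_residual cf rS.
by rewrite E// (sigma_eq0 cg Sp) exprS !mul0r.
Qed.

(** At order [t] the new term enters with coefficient zero, so [G] is free, provided that [S] is
    divisible by sigma. With [S = sigma T] the residual of order [t + 1] is [T] plus I.D of [G], and
    the recursion resumes above the resonance. *)
Lemma resonant_solution gs S G : (forall l, (l <= t)%N -> coefficients gs l /\ exists T, residual gs l T) ->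
  residual gs t S -> eq_on c Sigma S zero -> sec (w0 - t.+1%:R) G ->
  exists fs, [/\ forall k, (k <= t)%N -> fs k = gs k, fs t.+1 = G &
    solves_to_infinity c Phi sigma w0 f0 fs].
Proof.
move=> Hg [sS ES] S0 sG; have [T sT ET] := section_div hc hPhi hsigma hSigma sS S0.
pose hs k := if (k <= t)%N then gs k else G.
have hsE k : (k <= t)%N -> hs k = gs k by rewrite /hs => ->.
have hsG : hs t.+1 = G by rewrite /hs ltnn.
have [cg _] := Hg t (leqnn t).
have ch : coefficients hs t.+1.
  move=> k /andP[k1]; rewrite leq_eqVlt => /orP[/eqP ->|]; first by rewrite hsG.
  by rewrite ltnS => kt; rewrite hsE//; apply: cg; rewrite k1.
have [|fs [fE Hf]] := @continuation t.+1 hs (fun g i p A => T g i p A + IdotD sigma (w0 - t.+1%:R) G g i p A) ch.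
- split.
    have wE : w0 - 1 - t.+1%:R = w0 - 1 - t%:R - 1 by rewrite -natr1; ring.
    rewrite wE; apply: secD => //.
    have -> : w0 - 1 - t%:R - 1 = w0 - t.+1%:R - 1 by rewrite -natr1; ring.
    exact: sec_IdotD.
  move=> g i p cg' x ip A; rewrite IdotD_expansionS// hsG.
  rewrite (expansion_eq (fs := gs)); last by move=> k /andP[_]; exact: hsE.
  rewrite ES// ET// ht subrr mulr0 mul0r add0r exprSr; ring.
have fg k : (k <= t)%N -> fs k = gs k by move=> kt; rewrite fE ?hsE// ltnW.
exists fs; split => //; first by rewrite fE.
move=> l; apply/solves_toP; have [lt|tl] := leqP l t.
  have [cl [U [sU EU]]] := Hg l lt; split.
    by move=> k /andP[k1 kl]; rewrite fg ?(leq_trans kl)//; apply: cl; rewrite k1.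
  exists U; split => //; rewrite (expansion_eq (fs := gs))// => k /andP[_ kl].
  by rewrite fg// (leq_trans kl).
by apply: Hf => // k /andP[tk _]; rewrite ht eqr_nat !eqSS ltn_eqF.
Qed.

(** Up to the resonance two solutions agree as expansions although their coefficients need not,
    since only the sum modulo powers of sigma is determined. The accumulated discrepancy is
    [sigma^(t+1) V], so the free datum of [fs], measured against expansions that start with [gs], is
    [V + fs t.+1] rather than [fs t.+1]. *)
Lemma resonant_uniqueness fs gs : solves_to_infinity c Phi sigma w0 f0 fs ->
  (forall l, (l <= t)%N -> coefficients gs l /\ exists T, residual gs l T) ->
  exists2 phi, sec (w0 - t.+1%:R) phi &
    forall hs, (forall k, (k <= t)%N -> hs k = gs k) -> solves_to_infinity c Phi sigma w0 f0 hs ->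
      (same_expansion c Phi sigma w0 f0 fs hs <-> eq_on c Sigma (hs t.+1) phi).
Proof.
move=> Hf Hg.
have cf l : coefficients fs l by have /solves_toP[] := Hf l.
have rf l : exists T, residual fs l T by have /solves_toP[] := Hf l.
have base hs : bigO c Phi sigma w0 1 (sub_field (expan fs 0) (expan hs 0)).
  exists zero; first exact: (section_on0 hPhi _ openT).
  by move=> g i p _ _ _ A; rewrite /sub_field !expansion0 subrr mulr0.
have nres l : l != t -> h0 != l.+2%:R by rewrite ht eqr_nat !eqSS eq_sym.
have low l : (l <= t)%N -> bigO c Phi sigma w0 l.+1 (sub_field (expan fs l) (expan gs l)).
  elim: l => [_|l IH lt]; first exact: base.
  have [cg rg] := Hg _ lt.
  apply: (uniqueness_step (rf l.+1) rg (cf l.+1) cg); last by apply: IH; exact: ltnW.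
  by apply: nres; rewrite ltn_eqF.
have [V sV EV] := low t (leqnn t).
exists (fun g i p A => V g i p A + fs t.+1 g i p A).
  by apply: secD => //; exact: coefficients_last.
move=> hs hE Hh.
have ch l : coefficients hs l by have /solves_toP[] := Hh l.
have rh l : exists T, residual hs l T by have /solves_toP[] := Hh l.
have eE l : (l <= t)%N -> expan hs l = expan gs l.
  by move=> lt; apply: expansion_eq => k /andP[_ kl]; apply: hE; exact: leq_trans lt.
rewrite -(eE t (leqnn t)) in EV.
have [U [sU UE EU]] := same_expansion_sub (cf t.+1) (ch t.+1) sV EV.
have U0P : eq_on c Sigma U zero <-> eq_on c Sigma (hs t.+1) (fun g i p A => V g i p A + fs t.+1 g i p A).
  split=> H g i p cg Sp ip A.
    have := H g i p cg Sp ip A; rewrite UE// => /eqP; rewrite addrA subr_eq0 => /eqP //.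
  by rewrite UE// addrA H// subrr.
split=> [same|/U0P U0].
  apply/U0P => g i p cg Sp ip A.
  have [W sW EW] := same t.+1.
  have sW' : sec (w0 - t.+1%:R) (fun g i p A => sigma g p * W g i p A).
    apply: sec_eq (sec_sigma (k := 1) _); last first.
      by rewrite -addrA -opprD natr1; exact: sW.
    by move=> g' i' x' _ _ _ B; rewrite expr1.
  rewrite (sigma_pow_cancel (k := t.+1) sU sW')//; first by rewrite (sigma_eq0 cg Sp) mul0r.
  by move=> g' i' x' cg' y ix B; rewrite -EU// EW// exprSr mulrA.
elim=> [|l IH]; first exact: base.
have [lt|lt] := eqVneq l t; last exact: (uniqueness_step (rf l.+1) (rh l.+1) (cf l.+1) (ch l.+1) (nres l lt)).
by rewrite lt; exact: bigO_of_vanishing sU EU U0.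
Qed.

End Recursion.

(** * Solvability, obstruction and parametrisation of the solutions *)

Theorem proposition9p9 (R : realType) (n : nat) (hn : (2 <= n)%N)
    (M : manifold R n) (q : nat) (c : set (metric_field M))
    (hc : conformal_class q c)
    (sigma : density M) (hsigma : almost_pseudo_riemannian c sigma)
    (Sigma : set M) (hSigma : defining_density c sigma Sigma)
    (hI : forall g i p, c g -> dom i p -> Isq sigma g i p != 0)
    (m : nat) (Phi : subbundle M m) (hPhi : tractor_bundle c Phi)
    (w0 : R) :
  let h0 : R := n.+1%:R + 2 * w0 in
  ((~ exists2 h : nat, (2 <= h)%N & h0 = h%:R) ->
     forall f0, is_section c Phi w0 f0 ->
       exists f_, solves_to_infinity c Phi sigma w0 f0 f_)
  /\
  (forall h : nat, (2 <= h)%N -> h0 = h%:R ->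
     forall f f0, is_section c Phi w0 f -> is_section c Phi w0 f0 ->
       eq_on c Sigma f0 f ->
     let obstruction_vanishes :=
       eq_on c Sigma (Pop sigma w0 h.-1 f) (fun _ _ _ _ => 0) in
     [/\ exists f_, solves_to c Phi sigma w0 f0 f_ (h - 2)%N,
         forall l : nat, (h - 2 < l)%N ->
           (exists f_, solves_to c Phi sigma w0 f0 f_ l) ->
           obstruction_vanishes &
         obstruction_vanishes ->
         exists Psi : tractor_field M m -> nat -> tractor_field M m,
           (forall phi,
              section_along c Phi Sigma (- n.+1%:R - w0 + 1) phi ->
              solves_to_infinity c Phi sigma w0 f0 (Psi phi) /\
              eq_on c Sigma (Psi phi h.-1) phi)
           /\
           (forall f_, solves_to_infinity c Phi sigma w0 f0 f_ ->
              exists2 phi,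
                section_along c Phi Sigma (- n.+1%:R - w0 + 1) phi &
                forall phi',
                  section_along c Phi Sigma (- n.+1%:R - w0 + 1) phi' ->
                  (same_expansion c Phi sigma w0 f0 f_ (Psi phi') <->
                   eq_on c Sigma phi' phi))]).
Proof.
move=> h0; have [hs _] := hsigma.
split=> [hZ f0 sf0|].
  have [fs H] := nonresonant_solution hn hc hPhi hs hI sf0.
  exists fs => l; apply/(solves_toP hn hc hPhi hs sf0); apply: H => k _.
  by apply/eqP => hk; apply: hZ; exists k.+2.
(* From here on [h = t + 2]: the order reached without a condition is [t], and [h.-1] is [t + 1]. *)
case=> [//|[//|t]] _ ht f f0 sf sf0 f0f obs; rewrite subSS subSS subn0 [t.+2.-1]/=.
have [gs Hgs] := nonresonant_solution hn hc hPhi hs hI sf0.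
have Hg l : (l <= t)%N -> coefficients c Phi w0 gs l /\ exists T, residual c Phi sigma w0 f0 gs l T.
  move=> lt; apply: Hgs => k kl.
  by rewrite -/h0 ht eqr_nat !eqSS gtn_eqF// (leq_trans kl).
(* By tangentiality the obstruction may be computed from the extension [f0] that starts the
   expansion. *)
have obsE : obs <-> eq_on c Sigma (Pop sigma w0 t.+1 f0) (fun _ _ _ _ => 0).
  have E := Pop_along hn hc hPhi hs hSigma hI ht sf0 sf f0f.
  by split=> H g i p cg Sp ip A; [rewrite E//; exact: H|rewrite -E//; exact: H].
split.
- by exists gs; apply/(solves_toP hn hc hPhi hs sf0); exact: Hg.
- move=> l tl [fs /(solves_toP hn hc hPhi hs sf0)[cf [S rS]]]; apply/obsE.
  exact: (Pop_vanishes hn hc hPhi hs hSigma hI sf0 ht tl cf rS).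
move=> /obsE P0; have [cg [S rS]] := Hg t (leqnn t).
have S0 := residual_vanishes hn hc hPhi hs hSigma hI sf0 ht cg rS P0.
(* [- d - w0 + 1 = w0 - h0 + 1], the weight of the coefficient of index [h0 - 1]. *)
have wE : - n.+1%:R - w0 + 1 = w0 - t.+1%:R :> R.
  have -> : - n.+1%:R - w0 + 1 = w0 - h0 + 1 by rewrite /h0; ring.
  by rewrite ht -[t.+2]addn1 natrD; ring.
rewrite wE.
(* All members of the family share the lower coefficients [gs], as the comparison with an arbitrary
   solution requires; a field that is not a section along the hypersurface is sent to [gs]. *)
have /choice[Psi HPsi] : forall phi, exists fs, section_along c Phi Sigma (w0 - t.+1%:R) phi ->
    [/\ forall k, (k <= t)%N -> fs k = gs k, eq_on c Sigma (fs t.+1) phi &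
      solves_to_infinity c Phi sigma w0 f0 fs].
  move=> phi; have [hphi|nphi] := pselect (section_along c Phi Sigma (w0 - t.+1%:R) phi).
    have [G sG Gphi] := section_extension hc hPhi hs hSigma hphi.
    have [fs [fg fG Hf]] := resonant_solution hn hc hPhi hs hSigma hI sf0 ht Hg rS S0 sG.
    by exists fs => _; split => //; rewrite fG.
  by exists gs.
exists Psi; split=> [phi /HPsi[]//|fs Hf].
have [phi sphi Hphi] := resonant_uniqueness hn hc hPhi hs hSigma hI sf0 ht Hf Hg.
exists phi.
  (* [phi] is a global section, hence its own local extension. *)
  by move=> p _; exists setT, phi; split => //; exact: openT.
move=> phi' sphi'; have [hg h' hsol] := HPsi phi' sphi'.
have := Hphi (Psi phi') hg hsol => ->.
split=> H g i p cg' Sp ip A; first by rewrite -h'// H.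
by rewrite h'// H.
Qed.
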